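(* Let $n\ge1$, let $V$ be a vertex operator algebra satisfying the standing assumptions (A1)--(A3) listed in the context, let $W_1,\dots,W_n$ be $V$-modules, $w_i\in W_i$ homogeneous, $\sigma=\sum_{j=1}^n\mathrm{wt}\,w_j$. Let $m\ge1$, $a_{p,i}\in R_p$, $b_{p,i}\in R_{2p}$ ($1\le p\le m$, $1\le i\le n$) be coefficients of a system $$\frac{\partial^m\varphi}{\partial z_i^m}+\sum_{p=1}^ma_{p,i}\frac{\partial^{m-p}\varphi}{\partial z_i^{m-p}}=0,\qquad \prod_{k=1}^m\mathcal{O}_i\bigl(\sigma+2(m-k)\bigr)\varphi+\sum_{p=1}^mb_{p,i}\prod_{k=1}^{m-p}\mathcal{O}_i\bigl(\sigma+2(m-p-k)\bigr)\varphi=0\qquad(i=1,\dots,n)$$ that is satisfied by the $q$-traces $F_{\mathcal{Y}_1,\dots,\mathcal{Y}_n}(w_1,\dots,w_n;z_1,\dots,z_n;q)$ for all $V$-modules $\tilde W_i$ and all intertwining operators $\mathcal{Y}_i$ of types $\binom{\tilde W_{i-1}}{W_i\tilde W_i}$ ($\tilde W_0=\tilde W_n$). Let $\varphi(z_1,\dots,z_n;\tau)$ be a solution of this system with $q=q_\tau$. Then for any $$\begin{pmatrix}\alpha&\beta\\ \gamma&\delta\end{pmatrix}\in SL(2,\mathbb{Z}),$$ $$\left(\frac1{\gamma\tau+\delta}\right)^{\mathrm{wt}\,w_1+\cdots+\mathrm{wt}\,w_n}\varphi\left(\frac{z_1}{\gamma\tau+\delta},\dots,\frac{z_n}{\gamma\tau+\delta};\frac{\alpha\tau+\beta}{\gamma\tau+\delta}\right)$$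 is also a solution of the system with $q=q_\tau$.
   Context: Vertex operator algebras $(V,Y,\mathbf 1,\omega)$, $V$-modules (graded by $L(0)$-eigenvalues, called weights) and intertwining operators are in the sense of Frenkel--Lepowsky--Meurman and Frenkel--Huang--Lepowsky; $Y(u,x)=\sum_n u_nx^{-n-1}$, $Y(\omega,x)=\sum_n L(n)x^{-n-2}$, $c$ is the central charge of $V$. For $z\in\mathbb{C}$, $q_z=e^{2\pi i z}$. For $z\neq0$, $z^r=e^{r\log z}$ with $\log z=\log|z|+i\arg z$, $0\le\arg z<2\pi$. Standing assumptions. (A1) All $V$-modules are $\mathbb{R}$-graded and $C_2$-cofinite ($\dim W/C_2(W)<\infty$, where $C_2(W)$ is spanned by $u_{-2}w$, $u\in V$, $w\in W$). (A2) For intertwining operators $\mathcal{Y}_i$ of types $\binom{\tilde W_{i-1}}{W_i\tilde W_i}$, $\tilde W_0=\tilde W_n$, the series $\langle\tilde w_n',\mathcal{Y}_1(w_1,z_1)\cdots\mathcal{Y}_n(w_n,z_n)\tilde w_n\rangle$ is absolutely convergent when $|z_1|>\cdots>|z_n|>0$. (A3) Commutativity and associativity of intertwining operators hold (a product of two intertwining operators equals an iterate of two intertwining operators in the region $|z_1|>|z_2|>|z_1-z_2|>0$; and it is an analytic extension of a product of two intertwining operators in the opposite order). Define $A_j\in\mathbb{C}$ ($j\ge1$) by $\frac1{2\pi i}\log(1+2\pi iy)=\exp\bigl(\sum_{j\ge1}A_jy^{j+1}\frac{\partial}{\partial y}\bigr)y$, $L_+(A)=\sum_{j\ge1}A_jL(j)$,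 $\mathcal{U}(x)=(2\pi ix)^{L(0)}e^{-L_+(A)}$ with $(2\pi i)^{L(0)}=e^{(\log2\pi+i\pi/2)L(0)}$, and $$F_{\mathcal{Y}_1,\dots,\mathcal{Y}_n}(w_1,\dots,w_n;z_1,\dots,z_n;q)=\mathrm{Tr}_{\tilde W_n}\mathcal{Y}_1(\mathcal{U}(q_{z_1})w_1,q_{z_1})\cdots\mathcal{Y}_n(\mathcal{U}(q_{z_n})w_n,q_{z_n})q^{L(0)-\frac{c}{24}}.$$ For $k\ge0$, $\tilde G_{2k+2}(q)=2\zeta(2k+2)+\frac{2(2\pi i)^{2k+2}}{(2k+1)!}\sum_{l\ge1}\frac{l^{2k+1}q^l}{1-q^l}$; for $m\ge1$, $\tilde\wp_m(y;q)=\frac1{y^m}+(-1)^m\sum_{k\ge1}\binom{2k+1}{m-1}\tilde G_{2k+2}(q)y^{2k+2-m}$. $R$ is the commutative associative $\mathbb{C}$-algebra generated by $\tilde G_4(q),\tilde G_6(q)$ and $\tilde\wp_2(z_i-z_j;q),\tilde\wp_3(z_i-z_j;q)$, $1\le i<j\le n$, graded by modular weight ($\tilde G_4,\tilde G_6,\tilde\wp_2,\tilde\wp_3$ have modular weights $4,6,2,3$); $R_p$ is the subspace of modular weight $p$. For $\alpha\in\mathbb{C}$, $$\mathcal{O}_j(\alpha)=(2\pi i)^2q\frac{\partial}{\partial q}+\tilde G_2(q)\alpha+\tilde G_2(q)\sum_{i=1}^nz_i\frac{\partial}{\partial z_i}-\sum_{i\ne j}\tilde\wp_1(z_i-z_j;q)\frac{\partial}{\partial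 z_i},$$ and products of the $\mathcal{O}_j$ are ordered, $\prod_{k=1}^m\mathcal{O}_j(\alpha_k)=\mathcal{O}_j(\alpha_1)\cdots\mathcal{O}_j(\alpha_m)$. ''With $q=q_\tau$'' means: $\tau\in\mathbb{H}$, $(2\pi i)^2q\frac{\partial}{\partial q}=2\pi i\frac{\partial}{\partial\tau}$, $\tilde G_{2k}(q)$ is replaced by the Eisenstein series $G_{2k}(\tau)=\tilde G_{2k}(q_\tau)$, and $\tilde\wp_m(z;q)$ by $\wp_m(z;\tau)$, where $\wp_1$ is the Weierstrass zeta function $\frac1z+\sum_{(k,l)\ne(0,0)}\bigl(\frac1{z-(k\tau+l)}+\frac1{k\tau+l}+\frac z{(k\tau+l)^2}\bigr)$ and $\wp_{m+1}=-\frac1m\frac{\partial}{\partial z}\wp_m$. Solutions are (multivalued) analytic functions on $\Im\tau>0$, $z_i\ne z_j+k\tau+l$ ($i\neq j$, $k,l\in\mathbb{Z}$). *)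

(* Defs.v *)
From HB Require Import structures.
From mathcomp Require Import all_boot all_order all_algebra.
From mathcomp Require Import finmap.
From mathcomp Require Import all_classical all_reals all_analysis.
From mathcomp Require Import complex.

Set Implicit Arguments.
Unset Strict Implicit.
Unset Printing Implicit Defensive.
Import Order.TTheory GRing.Theory Num.Theory.
Import numFieldNormedType.Exports.
Local Open Scope classical_set_scope.
Local Open Scope ring_scope.

(* MathComp-Analysis puts its topology on the carriers of abstract numeric
   fields; naming R[i] as a [numClosedFieldType] makes those instances apply.
   The order on [Cx R] is partial: [0 < z] says that z is a positive real. *)
Definition Cx (R : realType) : numClosedFieldType := R[i].

Section ComplexFunctions.
Variable R : realType.
Local Notation C := (Cx R).

Definition ofR (x : R) : C := Complex x 0.
Definition ii : C := Complex 0 1.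
Definition cRe (z : C) : R := complex.Re z.
Definition cIm (z : C) : R := complex.Im z.

Definition twopii : C := ofR (2 * pi) * ii.

Definition cexp (z : C) : C :=
  Complex (expR (cRe z) * cos (cIm z)) (expR (cRe z) * sin (cIm z)).

Definition cmod (z : C) : R := Num.sqrt (cRe z ^+ 2 + cIm z ^+ 2).

(* 0 <= carg z < 2 pi for z != 0 *)
Definition carg (z : C) : R :=
  if 0 <= cIm z then acos (cRe z / cmod z) else 2 * pi - acos (cRe z / cmod z).

Definition clog (z : C) : C := Complex (ln (cmod z)) (carg z).

Definition cpow (z r : C) : C := cexp (r * clog z).

Definition qexp (z : C) : C := cexp (twopii * z).

Definition partial_sum (I : choiceType) (f : I -> C) (B : {fset I}) : C :=
  \sum_(i <- B) f i.

Definition finsets_to_top (I : choiceType) : set_system {fset I} :=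
  filter_from setT (fun B => [set B' | (B `<=` B')%fset]).

Definition usum (I : choiceType) (f : I -> C) : C :=
  lim (partial_sum f @ @finsets_to_top I).

Definition abs_summable (I : choiceType) (f : I -> C) : Prop :=
  exists M : C, forall B : {fset I}, \sum_(i <- B) `|f i| <= M.

End ComplexFunctions.

(* The sum of a sequence with finitely many nonzero terms; used for the
   locally finite sums of the formal calculus. *)
Definition evsum (W : zmodType) (f : nat -> W) : W :=
  xget 0 [set s | \forall N \near \oo, \sum_(i < N) f i = s].

Section MultivaluedAnalytic.
Variable R : realType.
Local Notation C := (Cx R).
Variable X : normedModType C.

(* Complex (Frechet) differentiability: the scalars are C. *)
Definition analytic_at (f : X -> C) (p : X) : Prop :=
  \forall x \near p, differentiable f x.

Definition same_germ (p : X) (f g : X -> C) : Prop :=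
  \forall x \near p, f x = g x.

Definition path_in (D : set X) (g : R -> X) : Prop :=
  {within `[0, 1]%classic, continuous g} /\
  (forall t : R, 0 <= t <= 1 -> D (g t)).

Definition continuation (g : R -> X) (F : R -> X -> C) : Prop :=
  forall t : R, 0 <= t <= 1 ->
    analytic_at (F t) (g t) /\
    (\forall s \near t, 0 <= s <= 1 -> same_germ (g s) (F s) (F t)).

(* A multivalued analytic function on D is given by its branches:
   [Phi p f] means that f is a branch near p.  Every branch can be continued
   along every path in D, and any two branches are continuations of each other
   along some path. *)
Record multivalued_analytic (D : set X) (Phi : X -> (X -> C) -> Prop) : Prop := {
  mv_inhabited : exists p f, Phi p f;
  mv_analytic : forall p f, Phi p f -> D p /\ analytic_at f p;
  mv_germ : forall p f g, Phi p f -> same_germ p f g -> Phi p g;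
  mv_open : forall p f, Phi p f -> \forall x \near p, Phi x f;
  mv_continue : forall p f g, Phi p f -> path_in D g -> g 0 = p ->
    exists F, [/\ continuation g F, F 0 = f &
                  forall t : R, 0 <= t <= 1 -> Phi (g t) (F t)];
  mv_connected : forall p f p' f', Phi p f -> Phi p' f' ->
    exists g F, [/\ path_in D g, g 0 = p, g 1 = p' &
                 [/\ continuation g F, F 0 = f & F 1 = f']] }.

End MultivaluedAnalytic.

Section VertexAlgebra.
Variable R : realType.
Local Notation C := (Cx R).

Definition binz (l : int) (i : nat) : C :=
  (\prod_(j < i) (l - j%:Z)%:~R) / (i`!)%:R.

Definition bilinear_modes (I : Type) (U W W' : lmodType C)
    (Z : U -> I -> W -> W') : Prop :=
  (forall n w, linear (fun u => Z u n w)) /\ (forall u n, linear (Z u n)).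

Definition truncated_modes (U W W' : lmodType C) (Z : U -> int -> W -> W') :=
  forall u w, exists N : int, forall n : int, N <= n -> Z u n w = 0.

(* The coefficient of x0^(-l-1) x1^(-m-1) x2^(-n-1) in the Jacobi identity,
   where l, m are integers and n ranges over the exponents of Z, which are
   integers for vertex operators and complex for intertwining operators. *)
Definition jacobi (I : pzRingType) (V W1 W2 W3 : lmodType C)
    (Y1 : V -> int -> W1 -> W1) (Y2 : V -> int -> W2 -> W2)
    (Y3 : V -> int -> W3 -> W3) (Z : W1 -> I -> W2 -> W3) : Prop :=
  forall (u : V) (w1 : W1) (w2 : W2) (l m : int) (n : I),
    evsum (fun i : nat =>
        ((-1) ^+ i * binz l i) *:
          (Y3 u (m + l - i%:Z) (Z w1 (n + i%:R) w2)
           - ((-1) ^ l) *: Z w1 (n + l%:~R - i%:R) (Y2 u (m + i%:Z) w2)))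
    = evsum (fun i : nat =>
        binz m i *: Z (Y1 u (l + i%:Z) w1) (n + m%:~R - i%:R) w2).

Definition virasoro (W : lmodType C) (c : C) (L : int -> W -> W) : Prop :=
  forall (m n : int) (w : W),
    L m (L n w) - L n (L m w) =
    (m - n)%:~R *: L (m + n) w +
    (if m + n == 0 then (m ^+ 3 - m)%:~R / 12%:R * c else 0) *: w.

Definition has_weight (W : lmodType C) (L : int -> W -> W) (h : C) (w : W) :=
  L 0 w = h *: w.

Definition graded_by_L0 (W : lmodType C) (L : int -> W -> W) : Prop :=
  forall w : W, exists (d : nat) (h : 'I_d -> C) (x : 'I_d -> W),
    (forall k, has_weight L (h k) (x k)) /\ w = \sum_(k < d) x k.

Definition finite_weight_spaces (W : lmodType C) (L : int -> W -> W) : Prop :=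
  forall h : C, exists (d : nat) (e : 'I_d -> W),
    forall w, has_weight L h w -> exists x : 'I_d -> C, w = \sum_k x k *: e k.

Definition weights_bounded_below (W : lmodType C) (L : int -> W -> W) : Prop :=
  exists N : R, forall h w, cRe h < N -> has_weight L h w -> w = 0.

Record voa : Type := VOA {
  voa_sort :> lmodType C;
  voaY : voa_sort -> int -> voa_sort -> voa_sort;
  vacuum : voa_sort;
  omega : voa_sort;
  central_charge : C;
  voaL := fun n : int => voaY omega (n + 1);
  voa_bilinear : bilinear_modes voaY;
  voa_truncated : truncated_modes voaY;
  voa_vacuum : forall n v, voaY vacuum n v = if n == -1 then v else 0;
  voa_creation : forall v,
    voaY v (-1) vacuum = v /\ (forall n : int, 0 <= n -> voaY v n vacuum = 0);
  voa_jacobi : jacobi voaY voaY voaY voaY;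
  voa_virasoro : virasoro central_charge voaL;
  voa_derivative : forall u n v,
    voaY (voaL (-1) u) n v = - n%:~R *: voaY u (n - 1) v;
  voa_graded : graded_by_L0 voaL;
  voa_integral : forall h v, v != 0 -> has_weight voaL h v ->
    exists k : int, h = k%:~R;
  voa_finite : finite_weight_spaces voaL;
  voa_bounded : weights_bounded_below voaL;
  voa_vacuum_weight : has_weight voaL 0 vacuum;
  voa_omega_weight : has_weight voaL 2%:R omega }.

Record vmodule (V : voa) : Type := VModule {
  vm_sort :> lmodType C;
  vmY : V -> int -> vm_sort -> vm_sort;
  vmL := fun n : int => vmY (omega V) (n + 1);
  vm_bilinear : bilinear_modes vmY;
  vm_truncated : truncated_modes vmY;
  vm_vacuum : forall n w, vmY (vacuum V) n w = if n == -1 then w else 0;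
  vm_jacobi : jacobi (@voaY V) vmY vmY vmY;
  vm_virasoro : virasoro (central_charge V) vmL;
  vm_derivative : forall u n w,
    vmY (@voaL V (-1) u) n w = - n%:~R *: vmY u (n - 1) w;
  vm_graded : graded_by_L0 vmL;
  vm_finite : finite_weight_spaces vmL;
  vm_bounded : weights_bounded_below vmL }.

Definition homogeneous (V : voa) (W : vmodule V) (h : C) (w : W) : Prop :=
  has_weight (@vmL V W) h w.

(* Intertwining operators of type (W3 over W1 W2):
   Y(w1, x) w2 = sum over complex n of (mode w1 n w2) x^(-n-1). *)
Record intertwiner (V : voa) (W3 W1 W2 : vmodule V) : Type := Intertwiner {
  mode : W1 -> C -> W2 -> W3;
  iw_bilinear : bilinear_modes mode;
  iw_truncated : forall w1 w2, exists N : R,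
    forall n : C, N <= cRe n -> mode w1 n w2 = 0;
  iw_jacobi : jacobi (@vmY V W1) (@vmY V W2) (@vmY V W3) mode;
  iw_derivative : forall w1 n w2,
    mode (@vmL V W1 (-1) w1) n w2 = - n *: mode w1 (n - 1) w2 }.

Definition graded_dual (V : voa) (W : vmodule V) (w' : {scalar W}) : Prop :=
  exists s : seq C, forall h w, h \notin s -> homogeneous h w -> w' w = 0.

Definition in_C2 (V : voa) (W : vmodule V) (w : W) : Prop :=
  exists (d : nat) (u : 'I_d -> V) (x : 'I_d -> W),
    w = \sum_(k < d) vmY (u k) (-2) (x k).

Definition C2_cofinite (V : voa) (W : vmodule V) : Prop :=
  exists (d : nat) (e : 'I_d -> W), forall w : W,
    exists x : 'I_d -> C, in_C2 (w - \sum_(k < d) x k *: e k).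

Definition real_graded (V : voa) (W : vmodule V) : Prop :=
  forall (h : C) (w : W), w != 0 -> homogeneous h w -> h \is Num.real.

(* Cyclic families: with indices starting from 0, the i-th intertwining operator
   is of type (M_(i-1) over W_i M_i), with M_(-1) read as M_(n-1).  Families are
   indexed by nat, and only the entries with index < n are used. *)
Definition cpred (V : voa) (n : nat) (M : nat -> vmodule V) (i : nat) :=
  if i is j.+1 then M j else M n.-1.

Section Products.
Variables (V : voa) (n : nat) (W M : nat -> vmodule V).
Variable Y : forall i, intertwiner (cpred n M i) (W i) (M i).

Fixpoint mode_product (w : forall i, W i) (r : seq C) (k : nat) :
    M k -> M n.-1 :=
  match k return M k -> M n.-1 with
  | 0 => fun v => mode (Y 0) (w 0%N) r`_0 v
  | j.+1 => fun v => @mode_product w r j (mode (Y j.+1) (w j.+1) r`_j.+1 v)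
  end.

(* The terms of < w', Y_0(w_0, x_0) ... Y_(n-1)(w_(n-1), x_(n-1)) v > with x_k^s
   evaluated as exp (s * lg k). *)
Definition product_term (w : forall i, W i) (lg : nat -> C)
    (w' : {scalar (M n.-1)}) (v : M n.-1) (r : n.-tuple C) : C :=
  w' (mode_product w r v) *
  \prod_(k < n) cexp (- (r`_k + 1) * lg k).

End Products.

Section TwoOperators.
Variables (V : voa) (W0 W1 W2 W3 W4 W5 : vmodule V).

Definition product2_term (Y1 : intertwiner W0 W1 W4) (Y2 : intertwiner W4 W2 W3)
    (w' : {scalar W0}) (w1 : W1) (w2 : W2) (w3 : W3) (l1 l2 : C) (r : C * C) : C :=
  w' (mode Y1 w1 r.1 (mode Y2 w2 r.2 w3)) *
  (cexp (- (r.1 + 1) * l1) * cexp (- (r.2 + 1) * l2)).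

Definition iterate2_term (Y4 : intertwiner W0 W5 W3) (Y3 : intertwiner W5 W1 W2)
    (w' : {scalar W0}) (w1 : W1) (w2 : W2) (w3 : W3) (l0 l2 : C) (r : C * C) : C :=
  w' (mode Y4 (mode Y3 w1 r.1 w2) r.2 w3) *
  (cexp (- (r.1 + 1) * l0) * cexp (- (r.2 + 1) * l2)).

End TwoOperators.

Definition products_converge (V : voa) : Prop :=
  forall (n : nat) (W M : nat -> vmodule V)
    (Y : forall i, intertwiner (cpred n M i) (W i) (M i))
    (w : forall i, W i) (w' : {scalar (M n.-1)}) (v : M n.-1) (z : nat -> C),
    (0 < n)%N -> graded_dual w' ->
    (forall i, (i < n)%N -> z i != 0) ->
    (forall i j, (i < j < n)%N -> `|z j| < `|z i|) ->
    abs_summable (product_term Y w (fun k => clog (z k)) w' v).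

(* The equality is one of multivalued functions on
   |z1| > |z2| > |z1 - z2| > 0: it relates the branches given by logarithms l1,
   l2, l0 of z1, z2, z1 - z2 that are close to each other. *)
Definition associativity (V : voa) : Prop :=
  forall (W0 W1 W2 W3 W4 : vmodule V)
    (Y1 : intertwiner W0 W1 W4) (Y2 : intertwiner W4 W2 W3),
  exists (W5 : vmodule V) (Y3 : intertwiner W5 W1 W2) (Y4 : intertwiner W0 W5 W3),
  forall (w' : {scalar W0}) (w1 : W1) (w2 : W2) (w3 : W3) (l0 l1 l2 : C),
    graded_dual w' ->
    cexp l0 = cexp l1 - cexp l2 ->
    `|cexp l2| < `|cexp l1| -> `|cexp l0| < `|cexp l2| ->
    `|cIm (l1 - l2)| < pi -> `|cIm (l0 - l2)| < pi ->
    abs_summable (product2_term Y1 Y2 w' w1 w2 w3 l1 l2) /\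
    abs_summable (iterate2_term Y4 Y3 w' w1 w2 w3 l0 l2) /\
    usum (product2_term Y1 Y2 w' w1 w2 w3 l1 l2) =
    usum (iterate2_term Y4 Y3 w' w1 w2 w3 l0 l2).

Definition off_cut (x : C) : Prop := ~ (0 <= x).

(* The two products, as functions of (z1, z2) in the regions |z1| > |z2| > 0 and
   |z2| > |z1| > 0, are analytic continuations of each other in the space of all
   (z1, z2) with z1, z2 != 0 and z1 != z2. *)
Definition commutativity (V : voa) : Prop :=
  forall (W0 W1 W2 W3 W4 : vmodule V)
    (Y1 : intertwiner W0 W1 W4) (Y2 : intertwiner W4 W2 W3),
  exists (W5 : vmodule V) (Y3 : intertwiner W0 W2 W5) (Y4 : intertwiner W5 W1 W3),
  forall (w' : {scalar W0}) (w1 : W1) (w2 : W2) (w3 : W3), graded_dual w' ->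
  exists (g : R -> (C * C)%type) (F : R -> (C * C)%type -> C),
    path_in [set z : C * C | [/\ z.1 != 0, z.2 != 0 & z.1 != z.2]] g /\
    continuation g F /\
    [/\ off_cut (g 0).1, off_cut (g 0).2, `|(g 0).2| < `|(g 0).1| &
        same_germ (g 0) (F 0) (fun z =>
          usum (product2_term Y1 Y2 w' w1 w2 w3 (clog z.1) (clog z.2)))] /\
    [/\ off_cut (g 1).1, off_cut (g 1).2, `|(g 1).1| < `|(g 1).2| &
        same_germ (g 1) (F 1) (fun z =>
          usum (product2_term Y3 Y4 w' w2 w1 w3 (clog z.2) (clog z.1)))].

Record standing_assumptions (V : voa) : Prop := {
  all_real_graded : forall W : vmodule V, real_graded W;
  all_C2_cofinite : forall W : vmodule V, C2_cofinite W;
  all_products_converge : products_converge V;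
  all_commutative : commutativity V;
  all_associative : associativity V }.

End VertexAlgebra.

Section GeometricModification.
Variable R : realType.
Local Notation C := (Cx R).

(* The derivation sum_(j >= 1) A_j y^(j+1) d/dy, on formal power series in y. *)
Definition Aderiv (A : nat -> C) (f : nat -> C) : nat -> C :=
  fun N => \sum_(1 <= j < N.+1) A j * ((N - j)%:R * f (N - j)%N).

(* (2 pi i)^-1 log(1 + 2 pi i y) = exp(sum_j A_j y^(j+1) d/dy) y, coefficientwise:
   the k-th power of the derivation sends y to a series of order > k. *)
Definition log_coordinates (A : nat -> C) : Prop :=
  forall N : nat,
    evsum (fun k => (k`!)%:R^-1 * iter k (Aderiv A) (fun j => (j == 1%N)%:R) N) =
    if N is N'.+1 then (-1) ^+ N' * twopii R ^+ N' / N%:R else 0.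

Variables (V : voa R) (W : vmodule V) (A : nat -> C).

Definition Lplus (w : W) : W :=
  evsum (fun j => A j.+1 *: @vmL R V W (j.+1)%:Z w).

Definition exp_minus_Lplus (w : W) : W :=
  evsum (fun k => (k`!)%:R^-1 *: iter k (fun v => - Lplus v) w).

(* e^(lam L(0)) *)
Definition expL0 (lam : C) (w : W) : W :=
  xget 0 [set v | exists (d : nat) (h : 'I_d -> C) (x : 'I_d -> W),
    [/\ forall k, homogeneous (h k) (x k), w = \sum_k x k &
        v = \sum_k cexp (lam * h k) *: x k]].

Definition log_twopii : C := Complex (ln (2 * pi)) (pi / 2).

(* U(x) w, with lg the value of log x *)
Definition Uop (lg : C) (w : W) : W :=
  expL0 (log_twopii + lg) (exp_minus_Lplus w).

End GeometricModification.

Section Coefficients.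
Variable R : realType.
Local Notation C := (Cx R).

Definition zeta (s : nat) : C :=
  lim (series (fun l => (l.+1%:R : C) ^- s) @ \oo).

Definition eis_const (k : nat) : C :=
  2 * twopii R ^+ (2 * k + 2) / ((2 * k + 1)`!)%:R.

(* The coefficient of q^s in G~_(2k+2)(q); the Lambert series is expanded as
   sum_(l >= 1) l^(2k+1) q^l / (1 - q^l)
     = sum_(s >= 1) (sum_(l | s) l^(2k+1)) q^s. *)
Definition Gser (k s : nat) : C :=
  if s == 0%N then 2 * zeta (2 * k + 2)
  else eis_const k * \sum_(l <- divisors s) (l%:R ^+ (2 * k + 1)).

(* G_(2k+2)(tau) *)
Definition Geis (k : nat) (tau : C) : C :=
  2 * zeta (2 * k + 2) +
  eis_const k *
  lim (series (fun l => l.+1%:R ^+ (2 * k + 1) * qexp tau ^+ l.+1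
                        / (1 - qexp tau ^+ l.+1)) @ \oo).

(* The coefficient of q^s in ~wp_m(y; q).  The power series in y converges for
   |y| < 1.  The subtraction in the exponent truncates only where the binomial
   coefficient is zero. *)
Definition wpser (m : nat) (y : C) (s : nat) : C :=
  (if s == 0%N then y ^- m else 0) +
  (-1) ^+ m *
  lim (series (fun j => let k := j.+1 in
         ('C(2 * k + 1, m.-1))%:R * Gser k s * y ^+ (2 * k + 2 - m)) @ \oo).

Definition lattice_zeta (tau z : C) : C :=
  z^-1 + usum (fun kl : int * int =>
    if kl == (0, 0) then 0
    else let a := kl.1%:~R * tau + kl.2%:~R in
      (z - a)^-1 + a^-1 + z / a ^+ 2).

(* [wpS k] is wp_(k+1) *)
Fixpoint wpS (k : nat) (tau : C) : C -> C :=
  if k is j.+1 then fun z => - (j.+1%:R)^-1 * 'D_1 (wpS j tau) z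
  else lattice_zeta tau.

Definition wp (m : nat) (tau z : C) : C := wpS m.-1 tau z.

(* Elements of the space R_p of modular weight p, written in the generators. *)
Inductive Relt (n : nat) : nat -> Type :=
  | Rzero p : Relt n p
  | Rconst (x : C) : Relt n 0
  | RG4 : Relt n 4
  | RG6 : Relt n 6
  | Rwp2 (i j : 'I_n) (ltij : (i < j)%N) : Relt n 2
  | Rwp3 (i j : 'I_n) (ltij : (i < j)%N) : Relt n 3
  | Radd p (x y : Relt n p) : Relt n p
  | Rmul p p' (x : Relt n p) (y : Relt n p') : Relt n (p + p').

Fixpoint Reval (n : nat) (T : Type) (const : C -> T) (add mul : T -> T -> T)
    (g4 g6 : T) (p2 p3 : 'I_n -> 'I_n -> T) (p : nat) (x : Relt n p) : T :=
  let ev := @Reval n T const add mul g4 g6 p2 p3 in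
  match x with
  | Rzero _ => const 0
  | Rconst a => const a
  | RG4 => g4
  | RG6 => g6
  | Rwp2 i j _ => p2 i j
  | Rwp3 i j _ => p3 i j
  | Radd _ a b => add (ev _ a) (ev _ b)
  | Rmul _ _ a b => mul (ev _ a) (ev _ b)
  end.

(* The left-hand sides of the system, for a space T of functions or of formal
   series with operators D = d/dz_i and O alpha = O_i(alpha) and an action of the
   coefficients. *)
Section System.
Variables (n : nat) (T : zmodType) (D : T -> T) (O : C -> T -> T).
Variable act : forall p, Relt n p -> T -> T.
Variables (sigma : C) (m : nat).

Definition Oprod (m' : nat) (f : T) : T :=
  foldr (fun k => O (sigma + (2 * (m' - k))%:R)) f (iota 1 m').

Definition eq1_lhs (a : forall p, Relt n p) (f : T) : T :=
  iter m D f + \sum_(1 <= p < m.+1) act (a p) (iter (m - p) D f).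

Definition eq2_lhs (b : forall p, Relt n (2 * p)) (f : T) : T :=
  Oprod m f + \sum_(1 <= p < m.+1) act (b p) (Oprod (m - p) f).

End System.

Section Formal.
Variable n : nat.
Local Notation Z := 'rV[C]_n.

(* Formal power series in q, and formal series in complex powers of q, whose
   coefficients are functions of z_1, ..., z_n. *)
Local Notation pser := (nat -> Z -> C).
Local Notation qser := (C -> Z -> C).

Definition pser_const (x : C) : pser := fun s _ => if s == 0%N then x else 0.
Definition pser_add (a b : pser) : pser := fun s z => a s z + b s z.
Definition pser_mul (a b : pser) : pser :=
  fun s z => \sum_(i < s.+1) a i z * b (s - i)%N z.

Definition pser_G (k : nat) : pser := fun s _ => Gser k s.
Definition pser_wp (m : nat) (i j : 'I_n) : pser :=
  fun s z => wpser m (z 0 i - z 0 j) s.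

Definition Rformal p (x : Relt n p) : pser :=
  Reval pser_const pser_add pser_mul (pser_G 1) (pser_G 2)
    (pser_wp 2) (pser_wp 3) x.

Definition qser_mul (a : pser) (f : qser) : qser :=
  fun e z => evsum (fun s => a s z * f (e - s%:R) z).

Definition qser_dz (i : 'I_n) (f : qser) : qser :=
  fun e z => 'D_(delta_mx 0 i) (f e) z.

Definition qser_qdq (f : qser) : qser := fun e z => e * f e z.

Definition qser_zmul (i : 'I_n) (f : qser) : qser := fun e z => z 0 i * f e z.

Definition formal_O (j : 'I_n) (alpha : C) (f : qser) : qser :=
  fun e z =>
    twopii R ^+ 2 * qser_qdq f e z
    + alpha * qser_mul (pser_G 0) f e z
    + qser_mul (pser_G 0) (fun e' z' => \sum_(i < n) qser_zmul i (qser_dz i f) e' z') e z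
    - \sum_(i < n | i != j) qser_mul (pser_wp 1 i j) (qser_dz i f) e z.

(* |q_(z_1)| > ... > |q_(z_n)|, where the intertwining operators converge;
   |z_i - z_j| < 1, where the coefficients of ~wp_m(z_i - z_j; q) converge; and
   q_(z_i) off the cut of the logarithm, where the q-traces are analytic. *)
Definition trace_region : set Z :=
  [set z : Z | [/\ forall i j : 'I_n, (i < j)%N -> `|qexp (z 0 j)| < `|qexp (z 0 i)|,
              forall i j : 'I_n, `|z 0 i - z 0 j| < 1 &
              forall i : 'I_n, off_cut (qexp (z 0 i))]].

Definition formal_solution (sigma : C) (m : nat)
    (a : forall p, 'I_n -> Relt n p) (b : forall p, 'I_n -> Relt n (2 * p))
    (f : qser) : Prop :=
  forall (i : 'I_n) (e : C) (z : Z), trace_region z ->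
    eq1_lhs (qser_dz i) (fun p x => qser_mul (Rformal x)) m (a ^~ i) f e z = 0 /\
    eq2_lhs (formal_O i) (fun p x => qser_mul (Rformal x)) sigma m (b ^~ i) f e z
      = 0.

End Formal.

Section Analytic.
Variable n : nat.
Local Notation P := ('rV[C]_n * C)%type.

Definition an_dz (i : 'I_n) (f : P -> C) : P -> C :=
  fun p => 'D_(delta_mx 0 i, 0) f p.

Definition an_dtau (f : P -> C) : P -> C := fun p => 'D_(0, 1) f p.

Definition an_wp (m : nat) (i j : 'I_n) : P -> C :=
  fun p => wp m p.2 (p.1 0 i - p.1 0 j).

Definition Ranalytic p (x : Relt n p) : P -> C :=
  Reval (fun c _ => c) (fun f g p => f p + g p) (fun f g p => f p * g p)
    (fun p => Geis 1 p.2) (fun p => Geis 2 p.2) (an_wp 2) (an_wp 3) x.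

Definition analytic_O (j : 'I_n) (alpha : C) (f : P -> C) : P -> C :=
  fun p =>
    twopii R * an_dtau f p
    + Geis 0 p.2 * alpha * f p
    + Geis 0 p.2 * (\sum_(i < n) p.1 0 i * an_dz i f p)
    - \sum_(i < n | i != j) an_wp 1 i j p * an_dz i f p.

Definition config_space : set P :=
  [set p : P | 0 < cIm p.2 /\
     forall (i j : 'I_n) (k l : int), i != j ->
       p.1 0 i != p.1 0 j + k%:~R * p.2 + l%:~R].

Record analytic_solution (sigma : C) (m : nat)
    (a : forall p, 'I_n -> Relt n p) (b : forall p, 'I_n -> Relt n (2 * p))
    (phi : P -> (P -> C) -> Prop) : Prop := {
  sol_analytic : multivalued_analytic config_space phi;
  sol_eq1 : forall p f i, phi p f ->
    eq1_lhs (an_dz i) (fun _ x g p' => Ranalytic x p' * g p') m (a ^~ i) f p = 0;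
  sol_eq2 : forall p f i, phi p f ->
    eq2_lhs (analytic_O i) (fun _ x g p' => Ranalytic x p' * g p') sigma m
      (b ^~ i) f p = 0 }.

Definition autom (g : 'M[int]_2) (tau : C) : C :=
  (g 1 0)%:~R * tau + (g 1 1)%:~R.

Definition modular_act (g : 'M[int]_2) (p : P) : P :=
  ((autom g p.2)^-1 *: p.1, ((g 0 0)%:~R * p.2 + (g 0 1)%:~R) / autom g p.2).

(* The branches of (1/(gamma tau + delta))^sigma phi(g . (z, tau)). *)
Definition modular_transform (g : 'M[int]_2) (sigma : C)
    (phi : P -> (P -> C) -> Prop) : P -> (P -> C) -> Prop :=
  fun p f => exists2 h, phi (modular_act g p) h &
    same_germ p f (fun x => cpow (autom g x.2)^-1 sigma * h (modular_act g x)).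

End Analytic.
End Coefficients.

Section QTraces.
Variable R : realType.
Local Notation C := (Cx R).
Variables (V : voa R) (n : nat).

Record dual_weight_bases (M : vmodule V) (h : C) (d : nat)
    (e : 'I_d -> M) (e' : 'I_d -> {scalar M}) : Prop := {
  dwb_weight : forall k, homogeneous h (e k);
  dwb_dual : forall k l, e' k (e l) = (k == l)%:R;
  dwb_span : forall v, homogeneous h v -> v = \sum_k e' k v *: e k;
  dwb_zero : forall k h' v, h' != h -> homogeneous h' v -> e' k v = 0 }.

Definition zat (z : 'rV[C]_n) (k : nat) : C :=
  if insub k is Some i then z 0 i else 0.

(* F is the q-trace of the Y_i at the w_i, as a formal series in q: the coefficient
   of q^(h - c/24) is the trace over the weight space of weight h. *)
Definition is_qtrace (A : nat -> C) (W M : nat -> vmodule V)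
    (Y : forall i, intertwiner (cpred n M i) (W i) (M i)) (w : forall i, W i)
    (F : C -> 'rV[C]_n -> C) : Prop :=
  forall (h : C) (z : 'rV[C]_n),
    (forall i j : 'I_n, (i < j)%N -> `|qexp (z 0 j)| < `|qexp (z 0 i)|) ->
    let lg k := clog (qexp (zat z k)) in
    exists (d : nat) (e : 'I_d -> M n.-1) (e' : 'I_d -> {scalar (M n.-1)}),
      dual_weight_bases h e e' /\
      F (h - central_charge V / 24%:R) z =
        \sum_(k < d) usum (product_term Y (fun i => Uop A (lg i) (w i)) lg
                             (e' k) (e k)).

End QTraces.

(* Main.v *)
(** The system itself is modular covariant.  For the slash operator
   [h |-> (gamma tau + delta)^(-s) h (g (z, tau))], the operator d/dz_i raises the weight
   [s] by 1, and multiplication by an element of R_p raises it by p.  In O_i(s) the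
   derivatives of the automorphy factor and of z / (gamma tau + delta) are exactly
   absorbed by the quasi-modularity of G_2, so O_i(s) raises the weight from [s] to
   [s + 2]; both equations are thus transformed into themselves.

   The transformation laws come from lattice sums.  The Weierstrass zeta function is an
   absolutely convergent sum over the lattice, covariant by reindexing; its rows are
   cotangents, so that its quasi-periods are G_2 and tau G_2 - 2 pi i (Legendre), and
   evaluating its covariance at a period gives the law of G_2.  By Lipschitz' formula
   G_4 and G_6 are lattice sums as well.

   Branches must stay analytic under d/dz_i and O_i, which needs that derivatives of
   differentiable functions are differentiable: this is Cauchy's estimate, obtained from
   Goursat's bisection argument with Riemann sums in the place of contour integrals. *)
Require Import Defs.
From HB Require Import structures.
From mathcomp Require Import all_boot all_order all_algebra finmap.
From mathcomp Require Import all_classical all_reals all_analysis complex.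
From mathcomp Require Import ring lra zify.
Set Implicit Arguments.
Unset Strict Implicit.
Unset Printing Implicit Defensive.
Import Order.TTheory GRing.Theory Num.Theory.
Import numFieldNormedType.Exports.
Local Open Scope classical_set_scope.
Local Open Scope ring_scope.

(** * Holomorphic functions *)

(** The obstacle is weight 2: the lattice sum of G_2 does not converge absolutely and cannot be
    reindexed. The zeta function is the primary object because its single absolutely convergent sum
    admits both operations, reindexing by a matrix of determinant 1 and summation row by row. The
    convention [0^-1 = 0] makes the origin an ordinary index of that sum.

    A second point is the branch of the power. The logarithm is cut along the nonnegative reals. If
    gamma is nonzero, gamma tau + delta is never real on the upper half plane; if gamma is 0, it is
    constant. In both cases the automorphy factor is analytic and adds no monodromy to the branches
    of phi.

    Holomorphy is expressed by a radius and a bound on a ball of an arbitrary normed space, so that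
    the same estimates serve functions of z, of (z, tau) and of all variables at once. Several
    complex variables enter only through restriction to complex lines. *)

Section Modulus.
Variable R : realType.
Local Notation C := (Cx R).
Implicit Types (a b z : C).

Lemma eqC z z' : cRe z = cRe z' -> cIm z = cIm z' -> z = z'.
Proof. by case: z z' => [x y] [x' y'] /= -> ->. Qed.

Lemma cReD a b : cRe (a + b) = cRe a + cRe b. Proof. by case: a b => ? ? []. Qed.
Lemma cImD a b : cIm (a + b) = cIm a + cIm b. Proof. by case: a b => ? ? []. Qed.
Lemma cReN a : cRe (- a) = - cRe a. Proof. by case: a. Qed.
Lemma cImN a : cIm (- a) = - cIm a. Proof. by case: a. Qed.
Lemma cReB a b : cRe (a - b) = cRe a - cRe b. Proof. by rewrite cReD cReN. Qed.
Lemma cImB a b : cIm (a - b) = cIm a - cIm b. Proof. by rewrite cImD cImN. Qed.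
Lemma cReM a b : cRe (a * b) = cRe a * cRe b - cIm a * cIm b.
Proof. by case: a b => ? ? []. Qed.
Lemma cImM a b : cIm (a * b) = cRe a * cIm b + cIm a * cRe b.
Proof. by case: a b => ? ? []. Qed.

Lemma ofRD (x y : R) : ofR (x + y) = ofR x + ofR y.
Proof. by apply: eqC; rewrite ?cReD ?cImD //= addr0. Qed.
Lemma ofRN (x : R) : ofR (- x) = - ofR x.
Proof. by apply: eqC; rewrite ?cReN ?cImN //= oppr0. Qed.
Lemma ofRM (x y : R) : ofR (x * y) = ofR x * ofR y.
Proof. by apply: eqC; rewrite ?cReM ?cImM /= ?mulr0 ?mul0r ?subr0 ?addr0. Qed.
Lemma ofR0 : ofR 0 = 0 :> C. Proof. by []. Qed.
Lemma ofR1 : ofR 1 = 1 :> C. Proof. by []. Qed.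
Lemma ofR_inj : injective (@ofR R). Proof. by move=> x y []. Qed.
Lemma ofR_eq0 (x : R) : (ofR x == 0) = (x == 0).
Proof. by rewrite -ofR0 (inj_eq ofR_inj). Qed.
Lemma ofRV (x : R) : ofR x^-1 = (ofR x)^-1.
Proof.
have [->|x0] := eqVneq x 0; first by rewrite ofR0 !invr0.
by apply: (mulfI (_ : ofR x != 0)); rewrite ?ofR_eq0 // -ofRM !divff ?ofR_eq0.
Qed.
Lemma ofRX (x : R) n : ofR (x ^+ n) = ofR x ^+ n.
Proof. by elim: n => [//|n IH]; rewrite !exprS ofRM IH. Qed.
Lemma ofR_nat n : ofR n%:R = n%:R :> C.
Proof. by elim: n => [//|n IH]; rewrite !mulrS ofRD IH ofR1. Qed.
Lemma ofR_int (n : int) : ofR n%:~R = n%:~R :> C.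
Proof.
case: n => n; first exact: ofR_nat.
by rewrite NegzE !mulrNz ofRN; congr (- _); exact: ofR_nat.
Qed.
Lemma ofR_le (x y : R) : (ofR x <= ofR y) = (x <= y).
Proof. by rewrite /ofR lecE /= eqxx. Qed.
Lemma ofR_lt (x y : R) : (ofR x < ofR y) = (x < y).
Proof. by rewrite /ofR ltcE /= eqxx. Qed.

Lemma Complex_ii (x y : R) : Complex x y = ofR x + ofR y * ii R :> C.
Proof.
apply: eqC; rewrite ?cReD ?cImD ?cReM ?cImM /=; ring.
Qed.
Lemma CE z : z = ofR (cRe z) + ofR (cIm z) * ii R.
Proof. by rewrite -Complex_ii; case: z. Qed.
Variable X : normedModType C.
Implicit Types x y : X.

(** Norms over [C] are elements of [C], which is only partially ordered. Their real parts lie in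
    [R], where suprema exist and [lra] applies; all estimates are made there. *)
Definition nrm (x : X) : R := cRe `|x|.

Lemma normE x : `|x| = ofR (nrm x).
Proof.
have := normr_ge0 x; rewrite lecE /= => /andP[/eqP im _].
by apply: eqC; rewrite //= -im.
Qed.
Lemma nrm_ge0 x : 0 <= nrm x.
Proof. by rewrite -ofR_le -normE; exact: normr_ge0. Qed.
Lemma nrmD x y : nrm (x + y) <= nrm x + nrm y.
Proof. by rewrite -ofR_le ofRD -!normE ler_normD. Qed.
Lemma nrmN x : nrm (- x) = nrm x.
Proof. by rewrite /nrm normrN. Qed.
Lemma nrmB x y : nrm (x - y) <= nrm x + nrm y.
Proof. by rewrite -(nrmN y) nrmD. Qed.
Lemma nrmC x y : nrm (x - y) = nrm (y - x).
Proof. by rewrite -nrmN opprB. Qed.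
Lemma nrm0 : nrm 0 = 0. Proof. by rewrite /nrm normr0. Qed.
Lemma nrm_eq0 x : (nrm x == 0) = (x == 0).
Proof. by rewrite -ofR_eq0 -normE normr_eq0. Qed.
Lemma nrm_gt0 x : (0 < nrm x) = (x != 0).
Proof. by rewrite lt_def nrm_eq0 nrm_ge0 andbT. Qed.
Lemma nrm_sum (I : Type) (r : seq I) (P : pred I) (F : I -> X) :
  nrm (\sum_(i <- r | P i) F i) <= \sum_(i <- r | P i) nrm (F i).
Proof.
elim/big_ind2: _ => [|x a y b xa yb|//]; first by rewrite nrm0.
by rewrite (le_trans (nrmD _ _)) // lerD.
Qed.
Lemma nrm_tri x y (z : X) : nrm (x - z) <= nrm (x - y) + nrm (y - z).
Proof. by rewrite (le_trans _ (nrmD _ _)) // addrA subrK. Qed.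

Lemma near_nrmP (p : X) (P : X -> Prop) :
  (\forall x \near p, P x) <->
  exists2 e : R, 0 < e & forall x, nrm (x - p) < e -> P x.
Proof.
split.
  (* A radius that is positive in the partial order of [C] is real. *)
  move=> /nbhs_normP[e /= e0 He]; have er : e = ofR (cRe e).
    by move: e0; rewrite ltcE /= => /andP[/eqP i _]; apply: eqC; rewrite //= -i.
  exists (cRe e); first by rewrite -ofR_lt -er.
  by move=> x xp; apply: He; rewrite /ball_ /= normE er ofR_lt nrmC.
move=> [e e0 He]; apply/nbhs_normP; exists (ofR e); first by rewrite /= (ofR_lt 0).
by move=> x; rewrite /ball_ /= normE ofR_lt nrmC; exact: He.
Qed.

Lemma near_ball (p : X) (e : R) : 0 < e -> \forall x \near p, nrm (x - p) < e.
Proof. by move=> e0; apply/near_nrmP; exists e. Qed.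

Lemma cvg_nrmP (T : Type) (F : set_system T) (FF : Filter F) (f : T -> X) (l : X) :
  f @ F --> l <-> forall e : R, 0 < e -> \forall t \near F, nrm (f t - l) < e.
Proof.
split.
  move=> H e e0; have /= := H (fun x => nrm (x - l) < e); rewrite !nbhs_simpl /=.
  by apply; apply: near_ball.
move=> H A /near_nrmP[e e0 He]; rewrite nbhs_simpl /=.
by apply: filterS (H _ e0) => t /He.
Qed.

End Modulus.

Section Modulus2.
Variable R : realType.
Local Notation C := (Cx R).
Lemma nrmZ (X : normedModType C) (a : C) (x : X) : nrm (a *: x) = nrm a * nrm x.
Proof. by apply: ofR_inj; rewrite ofRM -!normE normrZ. Qed.
Lemma nrmM (a b : C) : nrm (a * b) = nrm a * nrm b.
Proof. by apply: ofR_inj; rewrite ofRM -!normE normrM. Qed.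
Lemma nrmV (a : C) : nrm a^-1 = (nrm a)^-1.
Proof. by apply: ofR_inj; rewrite ofRV -!normE normfV. Qed.
Lemma nrmX (a : C) n : nrm (a ^+ n) = nrm a ^+ n.
Proof. by apply: ofR_inj; rewrite ofRX -!normE normrX. Qed.
Lemma nrm_ofR (x : R) : nrm (ofR x : C) = `|x|.
Proof.
rewrite /nrm normc_def /= expr0n addr0 /=; exact: sqrtr_sqr.
Qed.
Lemma nrm1 : nrm (1 : C) = 1. Proof. by rewrite -ofR1 nrm_ofR normr1. Qed.
Lemma nrm_nat n : nrm (n%:R : C) = n%:R.
Proof. by rewrite -ofR_nat nrm_ofR ger0_norm. Qed.
Lemma nrm_int (n : int) : nrm (n%:~R : C) = `|n%:~R|.
Proof. by rewrite -ofR_int nrm_ofR. Qed.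
Lemma nrmE (z : C) : nrm z = Num.sqrt (cRe z ^+ 2 + cIm z ^+ 2).
Proof. by rewrite /nrm normc_def. Qed.
Lemma nrm_cmod (z : C) : nrm z = cmod z. Proof. by rewrite nrmE. Qed.
Lemma nrm_sqr (z : C) : nrm z ^+ 2 = cRe z ^+ 2 + cIm z ^+ 2.
Proof. by rewrite nrmE sqr_sqrtr // addr_ge0 // sqr_ge0. Qed.
Lemma nrm_Re (z : C) : `|cRe z| <= nrm z.
Proof.
by rewrite -sqrtr_sqr nrmE ler_wsqrtr // lerDl sqr_ge0.
Qed.
Lemma nrm_Im (z : C) : `|cIm z| <= nrm z.
Proof.
by rewrite -sqrtr_sqr nrmE ler_wsqrtr // lerDr sqr_ge0.
Qed.
Lemma nrm_ii : nrm (ii R : C) = 1.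
Proof. by rewrite nrmE /= expr0n expr1n add0r sqrtr1. Qed.
Lemma nrm_le_ReIm (z : C) : nrm z <= `|cRe z| + `|cIm z|.
Proof.
rewrite [in leLHS](CE z) (le_trans (nrmD _ _)) // nrmM nrm_ii mulr1.
by rewrite !nrm_ofR.
Qed.
End Modulus2.

(** * Differentials from real-valued estimates *)

Section Differentials.
Variable R : realType.
Local Notation C := (Cx R).
Variables X Y : normedModType C.

Lemma differentiable_linear (f : X -> Y) (L : {linear X -> Y}) (x : X) :
  continuous L ->
  (forall e : R, 0 < e -> exists2 d : R, 0 < d &
    forall h, nrm h < d -> nrm (f (x + h) - f x - L h) <= e * nrm h) ->
  differentiable f x /\ 'd f x = L :> (X -> Y).
Proof.
move=> Lc Lo.
have Ld : f \o shift x = cst (f x) + L +o_ 0 id.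
  apply/eqaddoP => e e0.
  have er : e = ofR (cRe e).
    by move: e0; rewrite ltcE /= => /andP[/eqP i _]; apply: eqC; rewrite //= -i.
  have [d d0 Hd] : exists2 d : R, 0 < d &
    forall h, nrm h < d -> nrm (f (x + h) - f x - L h) <= cRe e * nrm h.
    by apply: Lo; rewrite -ofR_lt -er.
  apply/near_nrmP; exists d => // h; rewrite subr0 => /Hd.
  rewrite !normE er -ofRM ofR_le /=; congr (nrm _ <= _).
  by rewrite -!/(_ + _) -[RHS]/(f (h + x) - (f x + L h)) opprD addrA (addrC h).
have dE := diff_unique Lc Ld.
by split; [apply/diff_locallyP; rewrite dE | exact: dE].
Qed.

Lemma differentiable_intro (f L : X -> Y) (x : X) (K : R) :
  linear L -> (forall h, nrm (L h) <= K * nrm h) ->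
  (forall e : R, 0 < e -> exists2 d : R, 0 < d &
    forall h, nrm h < d -> nrm (f (x + h) - f x - L h) <= e * nrm h) ->
  differentiable f x /\ 'd f x = L :> (X -> Y).
Proof.
move=> Llin LK.
pose L' : {linear X -> Y} := HB.pack L (GRing.isLinear.Build C X Y *:%R L Llin).
apply: (@differentiable_linear f L' x).
apply/linear_bounded_continuous/bounded_funP => r.
exists (ofR (`|K| * `|cRe r|)) => h hr.
rewrite normE ofR_le (le_trans (LK h)) //.
have h1 : nrm h <= `|cRe r|.
  move: hr; rewrite normE lecE => /andP[_] /= hr.
  exact: le_trans hr (ler_norm _).
by rewrite (le_trans (ler_wpM2r (nrm_ge0 _) (ler_norm K))) // ler_wpM2l.
Qed.

Lemma diff_nrm (f : X -> Y) (x : X) : differentiable f x ->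
  forall e : R, 0 < e -> exists2 d : R, 0 < d &
    forall h, nrm h < d -> nrm (f (x + h) - f x - 'd f x h) <= e * nrm h.
Proof.
move=> /diff_locallyP[_ /eqaddoP H] e e0.
have /H/near_nrmP[d d0 Hd] : 0 < (ofR e : C) by rewrite (ofR_lt 0).
exists d => // h hd.
have := Hd h; rewrite subr0 => /(_ hd).
rewrite !normE -ofRM ofR_le /=; congr (nrm _ <= _).
by rewrite -[LHS]/(f (h + x) - (f x + 'd f x h)) opprD addrA (addrC h).
Qed.

Lemma near_eq_diff (f g : X -> Y) (x : X) : (\forall y \near x, f y = g y) ->
  differentiable f x -> differentiable g x /\ 'd g x = 'd f x :> (X -> Y).
Proof.
move=> /near_nrmP[r r0 Hr] df.
apply: (differentiable_linear (diff_continuous df)) => e e0.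
have [d d0 Hd] := diff_nrm df e0.
exists (Num.min r d); first by rewrite lt_min r0.
move=> h; rewrite lt_min => /andP[hr hd].
rewrite -!Hr; [exact: Hd | by rewrite subrr nrm0 | by rewrite addrC addKr].
Qed.

End Differentials.

(** * The mean value inequality *)

Section MeanValue.
Variable R : realType.
Local Notation C := (Cx R).

Lemma is_derive_intro (g : R -> R) (t l : R) :
  (forall e : R, 0 < e -> exists2 d : R, 0 < d &
    forall s, `|s| < d -> `|g (t + s) - g t - l * s| <= e * `|s|) ->
  is_derive t 1 g l.
Proof.
move=> H.
have cv : (fun h : R => h^-1 *: ((g \o shift t) (h *: (1 : R)) - g t)) @ 0^' --> l.
  apply/cvgrPdist_le => e /H[d d0 Hd].
  rewrite near_withinE; apply/nbhs_normP; exists d => //= s.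
  rewrite /ball_ /= sub0r normrN => sd s0.
  have Hs := Hd _ sd; rewrite /=.
  rewrite distrC -(ler_pM2r (_ : 0 < `|s|)) ?normr_gt0 // -normrM.
  rewrite [s *: 1]mulr1 (addrC s) /GRing.scale /=.
  have -> : (s^-1 * (g (t + s) - g t) - l) * s = g (t + s) - g t - l * s
    by field.
  by exact: Hs.
by split; [apply/cvg_ex; exists l | exact: cvg_lim].
Qed.

Variable X : normedModType C.

(** [c] will be the real or the imaginary part. The mean value theorem is about real functions, so
    [f] is restricted to a real segment and read through [c]. *)
Lemma is_derive_line (c : C -> R) (f : X -> C) (x h : X) (t : R) :
  (forall a b, c (a - b) = c a - c b) -> (forall a, `|c a| <= nrm a) ->
  (forall s a, c (ofR s * a) = s * c a) ->
  differentiable f (x + ofR t *: h) ->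
  is_derive t 1 (fun s => c (f (x + ofR s *: h))) (c ('d f (x + ofR t *: h) h)).
Proof.
move=> cB cle cZ df; apply: is_derive_intro => e e0.
have [d d0 Hd] : exists2 d : R, 0 < d & forall k, nrm k < d ->
    nrm (f (x + ofR t *: h + k) - f (x + ofR t *: h) - 'd f (x + ofR t *: h) k)
      <= e / (1 + nrm h) * nrm k.
  by apply: (diff_nrm df); rewrite divr_gt0 // ltr_pwDl // nrm_ge0.
have h1 : 0 < 1 + nrm h by rewrite ltr_pwDl // nrm_ge0.
exists (d / (1 + nrm h)); first by rewrite divr_gt0.
move=> s sd; have nk : nrm (ofR s *: h) = `|s| * nrm h by rewrite nrmZ nrm_ofR.
have /Hd : nrm (ofR s *: h) < d.
  rewrite nk; move: sd; rewrite ltr_pdivlMr // => sd.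
  by apply: le_lt_trans sd; rewrite ler_wpM2l // lerDr.
rewrite -(addrA x) -scalerDl -ofRD linearZ /= => Hs.
rewrite (mulrC _ s) -cZ -!cB.
apply: le_trans (cle _) _; apply: le_trans Hs _.
rewrite nk mulrAC ler_pdivrMr // -[leRHS]mulrA ler_pM2l //.
by rewrite ler_wpM2l // lerDr.
Qed.

(** The real and the imaginary parts are estimated separately, each at its own intermediate point;
    this costs the factor 2. *)
Lemma mean_value_le (f : X -> C) (x h : X) (K : R) :
  (forall t : R, 0 <= t <= 1 -> differentiable f (x + ofR t *: h) /\
     nrm ('d f (x + ofR t *: h) h) <= K) ->
  nrm (f (x + h) - f x) <= 2 * K.
Proof.
move=> H.
have comp (c : C -> R) :
  (forall a b, c (a - b) = c a - c b) -> (forall a, `|c a| <= nrm a) ->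
  (forall s a, c (ofR s * a) = s * c a) -> `|c (f (x + h) - f x)| <= K.
  move=> cB cle cZ.
  have dl t : 0 <= t <= 1 -> _ := fun tI => is_derive_line cB cle cZ (H t tI).1.
  have [t||t tI] := @MVT R (fun s => c (f (x + ofR s *: h)))
      (fun t => c ('d f (x + ofR t *: h) h)) 0 1 ltr01.
  - rewrite in_itv /= => /andP[t0 t1]; apply: dl; by rewrite !ltW.
  - apply: derivable_within_continuous => t; rewrite in_itv /= => tI.
    by have [] := dl t tI.
  rewrite ofR0 ofR1 scale0r scale1r addr0 subr0 mulr1 cB => ->.
  rewrite (le_trans (cle _)) // (H t _).2 //.
  by move: tI; rewrite in_itv /= => /andP[? ?]; rewrite !ltW.
rewrite (le_trans (nrm_le_ReIm _)) // mulr_natl mulr2n lerD //.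
  apply: comp => [a b|a|s a]; [exact: cReB|exact: nrm_Re|].
  by rewrite cReM /= mul0r subr0.
apply: comp => [a b|a|s a]; [exact: cImB|exact: nrm_Im|].
by rewrite cImM /= mul0r addr0.
Qed.

End MeanValue.

(** * Rules of differentiation in pointwise form *)

Section PointwiseRules.
Variable R : realType.
Local Notation C := (Cx R).
Variables X Y Z : normedModType C.

Lemma fdiff_cst (a : Y) (x : X) : differentiable (fun _ => a) x.
Proof. exact: differentiable_cst. Qed.
Lemma fdiff_id (x : X) : differentiable (fun y : X => y) x.
Proof. exact: (@ex_diff _ _ _ _ _ _ _ (is_diff_id x)). Qed.
Lemma fdiffD (f g : X -> Y) (x : X) : differentiable f x -> differentiable g x ->
  differentiable (fun y => f y + g y) x.
Proof. exact: differentiableD. Qed.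
Lemma fdiffB (f g : X -> Y) (x : X) : differentiable f x -> differentiable g x ->
  differentiable (fun y => f y - g y) x.
Proof. exact: differentiableB. Qed.
Lemma fdiffM (f g : X -> C) (x : X) : differentiable f x -> differentiable g x ->
  differentiable (fun y => f y * g y) x.
Proof. exact: differentiableM. Qed.
Lemma fdiffMl (f : X -> C) (a : C) (x : X) : differentiable f x ->
  differentiable (fun y => a * f y) x.
Proof. by move=> df; apply: fdiffM => //; exact: fdiff_cst. Qed.
Lemma fdiffV (f : X -> C) (x : X) : differentiable f x -> f x != 0 ->
  differentiable (fun y => (f y)^-1) x.
Proof. by move=> df fx; apply: differentiableV. Qed.
Lemma fdiffX (f : X -> C) n (x : X) : differentiable f x ->
  differentiable (fun y => f y ^+ n) x.
Proof.
move=> df; elim: n => [|n IH]; first exact: (differentiable_cst (1 : C) x).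
by under eq_fun do rewrite exprS; exact: fdiffM.
Qed.
Lemma fdiff_sum (I : Type) (r : seq I) (P : pred I) (f : I -> X -> Y) (x : X) :
  (forall i, P i -> differentiable (f i) x) ->
  differentiable (fun y => \sum_(i <- r | P i) f i y) x.
Proof.
move=> df; elim: r => [|i r IH].
  by under eq_fun do rewrite big_nil; exact: fdiff_cst.
under eq_fun do rewrite big_cons.
by case Pi: (P i) => //; apply: fdiffD => //; apply: df.
Qed.
Lemma fdiff_comp (f : X -> Y) (g : Y -> Z) (x : X) : differentiable f x ->
  differentiable g (f x) -> differentiable (fun y => g (f y)) x.
Proof. exact: differentiable_comp. Qed.
End PointwiseRules.

Section DifferentialRules.
Variable R : realType.
Local Notation C := (Cx R).
Variables X Y Z : normedModType C.

Lemma diff_sub (f g : X -> Y) (x : X) : differentiable f x -> differentiable g x ->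
  'd (fun y => f y - g y) x = (fun h => 'd f x h - 'd g x h) :> (X -> Y).
Proof. by move=> df dg; have := diffB df dg. Qed.

Lemma diff_linear_fun (L : {linear X -> Y}) (x : X) : continuous L ->
  differentiable L x /\ 'd L x = L :> (X -> Y).
Proof. by move=> Lc; split; [exact: linear_differentiable|exact: diff_lin]. Qed.

Lemma diff_shift (f : X -> Y) (x k : X) : differentiable f (x + k) ->
  differentiable (fun y => f (y + k)) x /\
  'd (fun y => f (y + k)) x = 'd f (x + k) :> (X -> Y).
Proof.
move=> df.
have dsh : differentiable (fun x : X => x + k) x.
  by apply: fdiffD; [exact: fdiff_id | exact: fdiff_cst].
have dE : 'd (fun x : X => x + k) x = id :> (X -> X).
  apply: (@differentiable_intro _ _ _ _ _ _ 1 _ _ _).2.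
  - by move=> c a b.
  - by move=> h; rewrite mul1r.
  - move=> e e0; exists 1 => // h _.
    have -> : x + h + k - (x + k) - h = 0.
      by rewrite opprD addrACA subrr addr0 (addrC x) addrK subrr.
    by rewrite nrm0 mulr_ge0 ?nrm_ge0 // ltW.
split; first exact: fdiff_comp dsh df.
have := diff_comp dsh df; rewrite dE; exact.
Qed.

End DifferentialRules.

(** * The complex exponential *)

Section ComplexExponential.
Variable R : realType.
Local Notation C := (Cx R).

Lemma is_derive_nrm (g : R -> R) (t l : R) : is_derive t 1 g l ->
  forall e : R, 0 < e -> exists2 d : R, 0 < d &
    forall s, `|s| < d -> `|g (t + s) - g t - l * s| <= e * `|s|.
Proof.
move=> [cv dv] e e0.
have : (fun h : R => h^-1 *: ((g \o shift t) (h *: (1 : R)) - g t)) @ 0^' --> l.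
  by rewrite -dv; exact: cv.
move=> /cvgrPdist_le /(_ e e0); rewrite near_withinE => /nbhs_normP[d d0 Hd].
exists d => // s sd; have [->|s0] := eqVneq s 0.
  by rewrite addr0 subrr mulr0 subr0 normr0 mulr0.
have := Hd s; rewrite /ball_ /= sub0r normrN => /(_ sd s0).
rewrite [s *: 1]mulr1 (addrC s) /GRing.scale /= distrC.
rewrite -(ler_pM2r (_ : 0 < `|s|)) ?normr_gt0 // -normrM.
by have -> : (s^-1 * (g (t + s) - g t) - l) * s = g (t + s) - g t - l * s
  by field.
Qed.

Lemma cexpD (a b : C) : cexp (a + b) = cexp a * cexp b.
Proof.
apply: eqC; rewrite ?cReM ?cImM /= cReD cImD expRD ?cosD ?sinD; ring.
Qed.

Lemma cexp0 : cexp (0 : C) = 1.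
Proof. by apply: eqC; rewrite /= expR0 ?cos0 ?sin0 ?mulr1 ?mulr0. Qed.

Lemma cexpN (a : C) : cexp (- a) = (cexp a)^-1.
Proof.
have H : cexp a * cexp (- a) = 1 by rewrite -cexpD subrr cexp0.
have a0 : cexp a != 0.
  by apply: contra_eq_neq H => ->; rewrite mul0r eq_sym oner_eq0.
by apply: (mulfI a0); rewrite H divff.
Qed.

Lemma cexp_neq0 (a : C) : cexp a != 0.
Proof.
have H : cexp a * cexp (- a) = 1 by rewrite -cexpD subrr cexp0.
by apply: contra_eq_neq H => ->; rewrite mul0r eq_sym oner_eq0.
Qed.

Lemma cexpMn (a : C) n : cexp (n%:R * a) = cexp a ^+ n.
Proof.
elim: n => [|n IH]; first by rewrite mul0r cexp0.
by rewrite exprS -IH -cexpD mulrS mulrDl mul1r.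
Qed.

Lemma nrm_cexp (a : C) : nrm (cexp a) = expR (cRe a).
Proof.
rewrite nrmE /= !exprMn -mulrDr cos2Dsin2 mulr1.
by rewrite sqrtr_sqr ger0_norm // expR_ge0.
Qed.

Lemma cexp_twopii : cexp (twopii R) = 1.
Proof.
have -> : twopii R = Complex 0 (2 * pi).
  by rewrite Complex_ii ofR0 add0r.
by apply: eqC; rewrite /= expR0 mul1r mulr_natl ?cos2pi ?sin2pi.
Qed.

Lemma twopii_neq0 : twopii R != 0.
Proof.
rewrite /twopii mulf_neq0 ?ofR_eq0 //.
  by rewrite mulf_neq0 // ?pnatr_eq0 // gt_eqF // pi_gt0.
by apply/eqP => /(congr1 (@cIm R)) /= /eqP; rewrite oner_eq0.
Qed.

(** For [h = x + i y] and [c = cos y + i sin y] the remainder splits into [(expR x - 1 - x) c],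
    [x (c - 1)] and [c - 1 - i y], for which first-order expansions of the three real functions at 0
    are enough. *)
Lemma cexp_o : forall e : R, 0 < e -> exists2 d : R, 0 < d &
  forall h : C, nrm h < d -> nrm (cexp h - 1 - h) <= e * nrm h.
Proof.
(* The three parts contribute 1, 3 and 2 times [u * nrm h]; [u <= 1] serves to bound [nrm (c - 1)]
   by [3 * u]. *)
move=> e e0; have [u [u0 u1 ue]] : exists u : R, [/\ 0 < u, u <= 1 & u <= e / 6].
  exists (Num.min (e / 6) 1); rewrite lt_min ltr01 andbT divr_gt0 //.
  by rewrite !ge_min !lexx orbT.
have [dx dx0 Hx] := is_derive_nrm (is_derive_expR (0 : R)) u0.
have [dc dc0 Hc] := is_derive_nrm (is_derive_cos (0 : R)) u0.
have [ds ds0 Hs] := is_derive_nrm (is_derive_sin (0 : R)) u0.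
exists (Num.min u (Num.min dx (Num.min dc ds))).
  by rewrite !lt_min u0 dx0 dc0 ds0.
move=> h; rewrite !lt_min => /and4P[hu hdx hdc hds].
have hx := nrm_Re h; have hy := nrm_Im h.
move: (Hx _ (le_lt_trans hx hdx)) (Hc _ (le_lt_trans hy hdc))
  (Hs _ (le_lt_trans hy hds)).
rewrite !add0r expR0 cos0 sin0 oppr0 mul0r !(addr0, subr0) !mul1r => {}Hx {}Hc {}Hs.
set x := cRe h in hx Hx *; set y := cIm h in hy Hc Hs *.
pose c : C := Complex (cos y) (sin y).
have c1 : nrm c = 1 by rewrite nrmE /= cos2Dsin2 sqrtr1.
have E : cexp h - 1 - h =
    ofR (expR x - 1 - x) * c + ofR x * (c - 1) + (c - 1 - ofR y * ii R).
  by apply: eqC; rewrite !(cReD, cImD, cReN, cImN, cReM, cImM) /=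
    -/x -/y; ring.
have cy : nrm (c - 1 - ofR y * ii R) <= 2 * u * `|y|.
  apply: le_trans (nrm_le_ReIm _) _.
  have -> : cRe (c - 1 - ofR y * ii R) = cos y - 1.
    by rewrite !(cReD, cReN, cReM) /=; ring.
  have -> : cIm (c - 1 - ofR y * ii R) = sin y - y.
    by rewrite !(cImD, cImN, cImM) /=; ring.
  lra.
have cy1 : nrm (c - 1) <= 2 * u * `|y| + `|y|.
  rewrite -[c - 1](subrK (ofR y * ii R)) (le_trans (nrmD _ _)) // lerD //.
  by rewrite nrmM nrm_ii mulr1 nrm_ofR.
rewrite E (le_trans (nrmD _ _)) // (le_trans (lerD (nrmD _ _) (lexx _))) //.
rewrite !nrmM c1 mulr1 !nrm_ofR.
have h0 := nrm_ge0 h.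
have := normr_ge0 x; have := normr_ge0 y; move: (nrm_ge0 (c - 1)).
move: (`|x|) (`|y|) hx hy Hx cy cy1 => ax ay hx hy Hx cy cy1 n0 ay0 ax0.
have a1 : u * ax <= u * nrm h by rewrite ler_pM2l.
have a2 : u * ay <= u * nrm h by rewrite ler_pM2l.
have a3 : nrm (c - 1) <= 3 * u.
  have : u * ay <= ay by rewrite ler_piMl.
  lra.
have a4 : ax * nrm (c - 1) <= nrm h * (3 * u) by rewrite ler_pM.
have a5 : u * nrm h <= e / 6 * nrm h by rewrite ler_wpM2r.
lra.
Qed.

Lemma linear_mulr (a : C) : linear (fun h : C => a * h : C).
Proof. by move=> k x y; rewrite mulrDr mulrCA. Qed.

Lemma differentiable_cexp (z : C) :
  differentiable (@cexp R) z /\ 'd (@cexp R) z = (fun h => cexp z * h) :> (C -> C).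
Proof.
apply: (@differentiable_intro _ _ _ _ _ _ (nrm (cexp z))) => [|h|e e0].
- exact: linear_mulr.
- by rewrite nrmM.
have p0 : 0 < nrm (cexp z) by rewrite nrm_gt0 cexp_neq0.
have [|d d0 Hd] := @cexp_o (e / nrm (cexp z)); first by rewrite divr_gt0.
exists d => // h /Hd Hh.
have -> : cexp (z + h) - cexp z - cexp z * h = cexp z * (cexp h - 1 - h).
  by rewrite cexpD; ring.
rewrite nrmM (le_trans (ler_wpM2l (ltW p0) Hh)) // mulrA mulrCA divff ?mulr1 //.
by rewrite gt_eqF.
Qed.

End ComplexExponential.

(** * Riemann sums around rectangles and Goursat's argument *)

Section RectangleSums.
Variable R : realType.
Local Notation C := (Cx R).

Definition cplx (x y : R) : C := ofR x + ofR y * ii R.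

(* The left Riemann sum of f over [a, a + s] with 2 ^ n steps; in this recursive
   form it is exactly additive under bisection of the interval. *)
Fixpoint lsum (n : nat) (f : R -> C) (a s : R) : C :=
  if n is n'.+1 then lsum n' f a (s / 2) + lsum n' f (a + s / 2) (s / 2)
  else ofR s * f a.

Lemma lsum_le n f a s (M : R) : 0 <= s ->
  (forall u, a <= u <= a + s -> nrm (f u) <= M) -> nrm (lsum n f a s) <= s * M.
Proof.
elim: n a s => [|n IH] a s s0 H /=.
  rewrite nrmM nrm_ofR ger0_norm // ler_wpM2l // H // lexx /=; lra.
rewrite (le_trans (nrmD _ _)) // [s in leRHS](splitr s) mulrDl lerD // IH //.
- lra.
- by move=> u /andP[? ?]; apply: H; lra.
- lra.
- by move=> u /andP[? ?]; apply: H; lra.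
Qed.

Lemma eq_lsum n f g a s : f =1 g -> lsum n f a s = lsum n g a s.
Proof. by move=> E; elim: n a s => [|n IH] a s /=; rewrite ?E ?IH. Qed.

Lemma lsumDc n f k a s :
  lsum n (fun u => f u + k) a s = lsum n f a s + ofR s * k.
Proof.
elim: n a s => [|n IH] a s /=; first by rewrite mulrDr.
by rewrite !IH addrACA -mulrDl -ofRD -splitr.
Qed.

Lemma lsumB n f g a s :
  lsum n (fun u => f u - g u) a s = lsum n f a s - lsum n g a s.
Proof.
elim: n a s => [|n IH] a s /=; first by rewrite mulrBr.
by rewrite !IH opprD addrACA.
Qed.

(** Riemann sum with [2 ^ n] steps on each side for the integral of [G] counterclockwise around the
    rectangle with lower left corner [x + i y] and sides [s], [t]. *)
Definition boundary_sum (n : nat) (G : C -> C) (x y s t : R) : C :=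
  lsum n (fun u => G (cplx u y)) x s
  + ii R * lsum n (fun v => G (cplx (x + s) v)) y t
  - lsum n (fun u => G (cplx u (y + t))) x s
  - ii R * lsum n (fun v => G (cplx x v)) y t.

(** The inner sides of the four quarters cancel exactly at every finite level, because [lsum] is
    built by bisection. *)
Lemma boundary_sumS n G x y s t :
  boundary_sum n.+1 G x y s t =
  boundary_sum n G x y (s / 2) (t / 2) +
  boundary_sum n G (x + s / 2) y (s / 2) (t / 2) +
  boundary_sum n G x (y + t / 2) (s / 2) (t / 2) +
  boundary_sum n G (x + s / 2) (y + t / 2) (s / 2) (t / 2).
Proof. rewrite /boundary_sum /= -!addrA -!splitr; ring. Qed.

(** The values on opposite sides differ by a constant, and [lsum] is exact on constants. Hence there
    is no error term at any level. *)
Lemma boundary_sum_affine n a b x y s t :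
  boundary_sum n (fun z => a + b * z) x y s t = 0.
Proof.
rewrite /boundary_sum.
rewrite (@eq_lsum n (fun u => a + b * cplx u (y + t))
  (fun u => (a + b * cplx u y) + b * (ofR t * ii R))); last first.
  by move=> u; rewrite /cplx ofRD; ring.
rewrite (@eq_lsum n (fun u => a + b * cplx (x + s) u)
  (fun u => (a + b * cplx x u) + b * ofR s)); last first.
  by move=> u; rewrite /cplx ofRD; ring.
rewrite !lsumDc; ring.
Qed.

Lemma boundary_sumB n G H x y s t :
  boundary_sum n (fun z => G z - H z) x y s t =
  boundary_sum n G x y s t - boundary_sum n H x y s t.
Proof. rewrite /boundary_sum !lsumB; ring. Qed.

Lemma boundary_sum_le n G x y s t (M : R) : 0 <= s -> 0 <= t ->
  (forall u v, x <= u <= x + s -> y <= v <= y + t -> nrm (G (cplx u v)) <= M) ->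
  nrm (boundary_sum n G x y s t) <= 2 * (s + t) * M.
Proof.
move=> s0 t0 H.
rewrite /boundary_sum (le_trans (nrmB _ _)) //.
rewrite (le_trans (lerD (nrmB _ _) (lexx _))) //.
rewrite (le_trans (lerD (lerD (nrmD _ _) (lexx _)) (lexx _))) //.
rewrite !nrmM nrm_ii !mul1r.
have -> : 2 * (s + t) * M = s * M + t * M + s * M + t * M by ring.
rewrite !lerD // lsum_le // => u hu; apply: H => //; lra.
Qed.

(** A bound proportional to the area adds up over the quarters, so that a rectangle violating it has
    a quarter violating it. Speaking of all fine sums avoids the existence of an integral. *)
Definition negligible_boundary (G : C -> C) (e x y s t : R) : Prop :=
  \forall n \near \oo, nrm (boundary_sum n G x y s t) <= e * (s * t).

Lemma negligible_boundary_bisect G e x y s t :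
  negligible_boundary G e x y (s / 2) (t / 2) ->
  negligible_boundary G e (x + s / 2) y (s / 2) (t / 2) ->
  negligible_boundary G e x (y + t / 2) (s / 2) (t / 2) ->
  negligible_boundary G e (x + s / 2) (y + t / 2) (s / 2) (t / 2) ->
  negligible_boundary G e x y s t.
Proof.
move=> [N1 _ H1] [N2 _ H2] [N3 _ H3] [N4 _ H4].
exists (N1 + N2 + N3 + N4).+1 => //= -[//|n]; rewrite /= ltnS => nN.
rewrite boundary_sumS (le_trans (nrmD _ _)) //.
rewrite (le_trans (lerD (nrmD _ _) (lexx _))) //.
rewrite (le_trans (lerD (lerD (nrmD _ _) (lexx _)) (lexx _))) //.
have -> : e * (s * t) = e * (s / 2 * (t / 2)) + e * (s / 2 * (t / 2)) +
  e * (s / 2 * (t / 2)) + e * (s / 2 * (t / 2)) by field.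
by rewrite !lerD // ?H1 ?H2 ?H3 ?H4 //=; lia.
Qed.

(** The point is the supremum of the left ends, which increase and stay below every right end. *)
Lemma nested_point (x s : R) (p : nat -> R) : 0 <= s -> p 0%N = x ->
  (forall k, p k.+1 = p k \/ p k.+1 = p k + s / 2 ^+ k.+1) ->
  exists c, forall k, p k <= c <= p k + s / 2 ^+ k.
Proof.
move=> s0 p0 pS.
have p2 k : 0 <= s / 2 ^+ k by rewrite divr_ge0 // exprn_ge0.
have half k : s / 2 ^+ k = s / 2 ^+ k.+1 + s / 2 ^+ k.+1.
  by rewrite exprS; field; rewrite expf_neq0.
have up k : p k <= p k.+1.
  by case: (pS k) => ->; rewrite ?lerDl.
have dn k : p k.+1 + s / 2 ^+ k.+1 <= p k + s / 2 ^+ k.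
  by rewrite (half k); have := p2 k.+1; case: (pS k) => ->; lra.
have upm k m : (k <= m)%N -> p k <= p m.
  by elim: m => [|m IH]; rewrite leq_eqVlt => /orP[/eqP->|] // /IH /le_trans; apply.
have dnm k m : (k <= m)%N -> p m + s / 2 ^+ m <= p k + s / 2 ^+ k.
  elim: m => [|m IH]; rewrite leq_eqVlt => /orP[/eqP->|] // /IH.
  by apply: le_trans.
have ub k : ubound (range p) (p k + s / 2 ^+ k).
  move=> _ [m _ <-]; have [km|mk] := leqP k m.
    by apply: le_trans (dnm _ _ km); rewrite lerDl.
  by rewrite (le_trans (upm _ _ (ltnW mk))) // lerDl.
exists (sup (range p)) => k; apply/andP; split.
  apply: ub_le_sup; last by exists k.
  by exists (p 0%N + s / 2 ^+ 0); apply: ub.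
by apply: ge_sup; [exists (p 0%N); exists 0%N | apply: ub].
Qed.

Lemma cplx_Re x y : cRe (cplx x y) = x.
Proof. by rewrite /cplx cReD cReM /=; ring. Qed.
Lemma cplx_Im x y : cIm (cplx x y) = y.
Proof. by rewrite /cplx cImD cImM /=; ring. Qed.

Lemma pow2_lt (a d : R) : 0 < d -> exists k : nat, a / 2 ^+ k < d.
Proof.
move=> d0; exists (Num.bound (a / d)).
rewrite ltr_pdivrMr ?exprn_gt0 // mulrC -ltr_pdivrMr //.
exact: upper_nthrootP.
Qed.

(** Bad rectangles would shrink to a point, near which [G] is affine up to a small multiple of the
    distance. The affine part has zero boundary sum, and the rest is small against the area. *)
Theorem Goursat (G : C -> C) (e x y s t : R) : 0 < e -> 0 < s -> 0 < t ->
  (forall u v, x <= u <= x + s -> y <= v <= y + t ->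
     differentiable G (cplx u v)) ->
  negligible_boundary G e x y s t.
Proof.
move=> e0 s0 t0 dG; apply: contrapT => bad.
pose Bad k (p : R * R) :=
  ~ negligible_boundary G e p.1 p.2 (s / 2 ^+ k) (t / 2 ^+ k).
pose next k (p q : R * R) :=
  (q.1 = p.1 \/ q.1 = p.1 + s / 2 ^+ k.+1) /\
  (q.2 = p.2 \/ q.2 = p.2 + t / 2 ^+ k.+1).
have half (a : R) k : a / 2 ^+ k.+1 = a / 2 ^+ k / 2.
  by rewrite exprSr; field; rewrite expf_neq0.
(* The implication stands under the existential, so that [choice] yields a total function selecting
   quarters. *)
have step k p : exists q, Bad k p -> Bad k.+1 q /\ next k p q.
  have [[q Hq]|N] := pselect (exists q, Bad k.+1 q /\ next k p q); first by exists q.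
  exists p => Bp; exfalso; apply: Bp.
  have ok q : next k p q -> negligible_boundary G e q.1 q.2
      (s / 2 ^+ k.+1) (t / 2 ^+ k.+1).
    by move=> nq; apply: contrapT => bq; apply: N; exists q.
  apply: negligible_boundary_bisect; rewrite -!half.
  - by apply: (ok (p.1, p.2)); split; left.
  - by apply: (ok (_, p.2)); split; [right|left].
  - by apply: (ok (p.1, _)); split; [left|right].
  - by apply: (ok (_, _)); split; right.
have [nx Hnx] := choice (fun kp : nat * (R * R) => step kp.1 kp.2).
pose p := fix p k := if k is k'.+1 then nx (k', p k') else (x, y).
have pS k : Bad k (p k) /\ next k (p k) (p k.+1).
  elim: k => [|k [Bk nk]].
    have B0 : Bad 0%N (p 0%N) by rewrite /Bad /= !expr0 !divr1.
    by split => //; have [] := Hnx (0%N, (x, y)) B0.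
  have [B1 _] := Hnx (k, p k) Bk; split => //.
  by have [] := Hnx (k.+1, p k.+1) B1.
have [cx Hx] := nested_point (ltW s0) (erefl : (p 0%N).1 = x)
  (fun k => (pS k).2.1).
have [cy Hy] := nested_point (ltW t0) (erefl : (p 0%N).2 = y)
  (fun k => (pS k).2.2).
have dGc : differentiable G (cplx cx cy).
  by apply: dG; [have := Hx 0%N | have := Hy 0%N]; rewrite /= expr0 divr1.
have st0 : 0 < s + t by rewrite addr_gt0.
(* Chosen so that perimeter [2 * (s + t)] times [eta * (s + t)] equals [e * (s * t)]. Both sides
   scale by the same power of 4 under bisection, so one [eta] serves every level. *)
pose eta := e * (s * t) / (2 * (s + t) ^+ 2).
have eta0 : 0 < eta by rewrite divr_gt0 // !mulr_gt0 // exprn_gt0.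
have [d d0 Hd] := diff_nrm dGc eta0.
have [k Hk] := pow2_lt (s + t) d0.
(* In this small rectangle the bound holds for every [n], against its being bad. *)
case: (pS k) => + _; apply; exists 0%N => // n _.
set L := 'd G (cplx cx cy) in Hd.
pose a := G (cplx cx cy) - cplx cx cy * L 1.
have k0 : 0 < 2 ^+ k :> R by rewrite exprn_gt0.
have EG : boundary_sum n G (p k).1 (p k).2 (s / 2 ^+ k) (t / 2 ^+ k) =
  boundary_sum n (fun z => G z - (a + L 1 * z)) (p k).1 (p k).2
    (s / 2 ^+ k) (t / 2 ^+ k).
  by rewrite boundary_sumB boundary_sum_affine subr0.
have -> : e * (s / 2 ^+ k * (t / 2 ^+ k)) =
  2 * (s / 2 ^+ k + t / 2 ^+ k) * (eta * (s / 2 ^+ k + t / 2 ^+ k)).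
  by rewrite /eta; field; rewrite expf_neq0 //= gt_eqF.
rewrite EG; apply: boundary_sum_le; rewrite ?divr_ge0 ?ltW // => u v hu hv.
have [hx hy] := (Hx k, Hy k).
have near : nrm (cplx u v - cplx cx cy) <= s / 2 ^+ k + t / 2 ^+ k.
  rewrite (le_trans (nrm_le_ReIm _)) // cReB cImB !cplx_Re !cplx_Im.
  by rewrite lerD // ler_norml; lra.
have := Hd (cplx u v - cplx cx cy).
rewrite -mulrDl in near * => /(_ (le_lt_trans near Hk)).
rewrite (addrC (cplx cx cy)) subrK => Hz.
have -> : G (cplx u v) - (a + L 1 * cplx u v) =
  G (cplx u v) - G (cplx cx cy) - L (cplx u v - cplx cx cy).
  have -> : L (cplx u v - cplx cx cy) = (cplx u v - cplx cx cy) * L 1.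
    by rewrite -[X in L X]mulr1 -[X in L X]/(_ *: (1 : C)) linearZ.
  by rewrite /a; ring.
by apply: le_trans Hz _; rewrite ler_pM2l // mulrDl.
Qed.

End RectangleSums.

(** * Cauchy's estimate *)

Section CauchyEstimate.
Variable R : realType.
Local Notation C := (Cx R).

Lemma cexp_cplx_top u : cexp (cplx u (0 + 2 * pi) : C) = cexp (cplx u 0).
Proof.
have -> : cplx u (0 + 2 * pi) = cplx u 0 + twopii R :> C.
  by rewrite /cplx /twopii add0r ofR0 mul0r addr0.
by rewrite cexpD cexp_twopii mulr1.
Qed.

(* Goursat on a rectangle of height 2 pi for [F (e^w)], [F z = (phi z - phi 0) / z]: the
   horizontal sides cancel, and the left side tends to [2 pi phi'(0)]. *)
Lemma cauchy_disc (phi : C -> C) (r rho M : R) : 0 < rho < r ->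
  (forall z, nrm z < r -> differentiable phi z /\ nrm (phi z) <= M) ->
  nrm ('d phi 0 1) <= 2 * M / rho.
Proof.
move=> /andP[p0 pr] H; apply/ler_addgt0Pr => k k0.
set F0 := 'd phi 0 1.
have d0 : differentiable phi 0 by apply: (H _ _).1; rewrite nrm0 (lt_trans p0).
have [del del0 Hdel] := diff_nrm d0 (divr_gt0 k0 (ltr0n R 2)).
pose F z := (phi z - phi 0) / z.
pose G w := F (cexp w).
(* Below [del] the quotient [F] is within [k / 2] of the derivative at 0. *)
have [r0 [r00 r0p r0d]] : exists r0 : R, [/\ 0 < r0, r0 < rho & r0 < del].
  exists (Num.min rho del / 2); rewrite divr_gt0 ?lt_min ?p0 ?del0 //.
  have : 0 < Num.min rho del by rewrite lt_min p0 del0.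
  have : Num.min rho del <= rho by rewrite ge_min lexx.
  have : Num.min rho del <= del by rewrite ge_min lexx orbT.
  by split => //; lra.
(* The exponential wraps this rectangle once around the annulus between [r0] and [rho]; the left and
   right sides become the two circles. *)
pose x := ln r0; pose s := ln rho - ln r0; pose t : R := 2 * pi.
have s0 : 0 < s by rewrite subr_gt0 ltr_ln.
have t0 : 0 < t by rewrite mulr_gt0 // pi_gt0.
(* Times the area this allows an error [t * (k / 2)]; the left side costs the same amount again. *)
have e0 : 0 < k / (2 * s) by rewrite divr_gt0 // mulr_gt0.
have nc u v : nrm (cexp (cplx u v : C)) = expR u by rewrite nrm_cexp cplx_Re.
have [N _ HN] : negligible_boundary G (k / (2 * s)) x 0 s t.
  apply: (Goursat e0 s0 t0) => u v; rewrite /x /s => /andP[_].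
  rewrite addrC subrK => hu _.
  have hc : nrm (cexp (cplx u v : C)) < r.
    by rewrite nc (le_lt_trans _ pr) // -[leRHS]lnK ?posrE // ler_expR.
  have dF : differentiable F (cexp (cplx u v)).
    apply: fdiffM; first by apply: fdiffB; [exact: (H _ hc).1|exact: fdiff_cst].
    by apply: fdiffV; [exact: fdiff_id | exact: cexp_neq0].
  exact: fdiff_comp (differentiable_cexp _).1 dF.
have := HN N (leqnn N).
have -> : boundary_sum N G x 0 s t =
    ii R * (lsum N (fun v => G (cplx (x + s) v)) 0 t -
            lsum N (fun v => G (cplx x v)) 0 t).
  rewrite /boundary_sum (@eq_lsum _ _ (fun u => G (cplx u (0 + t)))
    (fun u => G (cplx u 0))); first by ring.
  by move=> u; rewrite /G cexp_cplx_top.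
rewrite nrmM nrm_ii mul1r.
set rt := lsum _ _ _ _; set lf := lsum _ _ _ _ => Hrl.
have Hrt : nrm rt <= t * (2 * M / rho).
  apply: lsum_le; rewrite ?ltW // => v _.
  rewrite /x /s addrC subrK /G /F nrmM nrmV nc lnK ?posrE //.
  rewrite ler_wpM2r ?invr_ge0 ?(ltW p0) // mulr_natl mulr2n.
  rewrite (le_trans (nrmB _ _)) // lerD // (H _ _).2 ?nrm0 ?(lt_trans p0) //.
  by rewrite nc lnK ?posrE.
have Hlt : nrm (lf - ofR t * F0) <= t * (k / 2).
  have -> : lf - ofR t * F0 = lsum N (fun v => G (cplx x v) + - F0) 0 t.
    by rewrite lsumDc mulrN.
  apply: lsum_le; rewrite ?ltW // => v _.
  set h := cexp (cplx x v).
  have hn : nrm h = r0 by rewrite nc lnK ?posrE.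
  have h0 : h != 0 by rewrite cexp_neq0.
  have -> : G (cplx x v) - F0 = (phi (0 + h) - phi 0 - 'd phi 0 h) / h.
    have -> : 'd phi 0 h = h * F0.
      by rewrite -[X in 'd phi 0 X]mulr1 -[X in 'd phi 0 X]/(_ *: (1 : C)) linearZ.
    by rewrite add0r /G /F -/h; field.
  rewrite nrmM nrmV ler_pdivrMr ?nrm_gt0 //.
  by apply: Hdel; rewrite hn.
rewrite -(ler_pM2l t0).
have -> : t * nrm F0 = nrm (ofR t * F0) by rewrite nrmM nrm_ofR ger0_norm // ltW.
have -> : ofR t * F0 = rt - (lf - ofR t * F0) - (rt - lf) by ring.
rewrite (le_trans (nrmB _ _)) // (le_trans (lerD (nrmB _ _) (lexx _))) //.
have E : k / (2 * s) * (s * t) = t * (k / 2) by field; rewrite gt_eqF.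
rewrite E in Hrl; rewrite mulrDr; lra.
Qed.

Variable X : normedModType C.

Lemma differentiable_line (f : X -> C) (x v : X) (z : C) :
  differentiable f (x + z *: v) ->
  differentiable (fun s : C => f (x + s *: v)) z /\
  'd (fun s : C => f (x + s *: v)) z = (fun k => 'd f (x + z *: v) (k *: v))
    :> (C -> C).
Proof.
move=> df.
have dl : differentiable (fun s : C => x + s *: v) z.
  by apply: fdiffD; [exact: fdiff_cst|exact: differentiableZl].
have E : 'd (fun s : C => x + s *: v) z = (fun k => k *: v) :> (C -> X).
  apply: (@differentiable_intro _ _ _ _ _ _ (nrm v) _ _ _).2.
  - by move=> k a b; rewrite scalerDl scalerA.
  - by move=> h; rewrite nrmZ mulrC.
  - move=> e e0; exists 1 => // h _; rewrite scalerDl addrA.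
    by rewrite (addrC _ (h *: v)) addrK subrr nrm0 mulr_ge0 ?nrm_ge0 // ltW.
have := differentiable_comp dl df; have := diff_comp dl df.
rewrite E /comp => Ed dd; split => //; exact: Ed.
Qed.

(** [cauchy_disc] on the complex line through [x] in the direction [v]; the 4 comes from taking
    [rho = r / 2] there. *)
Lemma cauchy_estimate (f : X -> C) (x v : X) (r M : R) : 0 < r ->
  (forall z : C, nrm z < r -> differentiable f (x + z *: v) /\
     nrm (f (x + z *: v)) <= M) ->
  nrm ('d f x v) <= 4 * M / r.
Proof.
move=> r0 H.
have d0 : differentiable f (x + 0 *: v) by apply: (H _ _).1; rewrite nrm0.
have := @cauchy_disc (fun s : C => f (x + s *: v)) r (r / 2) M.
rewrite (differentiable_line d0).2 scale1r scale0r addr0.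
have -> : 2 * M / (r / 2) = 4 * M / r by field; rewrite gt_eqF.
apply; first lra.
by move=> z /H[dz Mz]; split => //; exact: (differentiable_line dz).1.
Qed.

End CauchyEstimate.

(** * Limits in the complex numbers *)

Section ComplexLimits.
Variable R : realType.
Local Notation C := (Cx R).

(** Completeness of [R], applied to the real and to the imaginary part. *)
Lemma cvg_complete (T : Type) (F : set_system T) {FF : ProperFilter F} (u : T -> C) :
  (forall e : R, 0 < e -> exists x : C, \forall t \near F, nrm (u t - x) < e) ->
  exists l : C, u @ F --> l.
Proof.
move=> H.
have comp (c : C -> R) : (forall a b, c (a - b) = c a - c b) ->
    (forall a, `|c a| <= nrm a) -> cvg ((c \o u) @ F).
  move=> cB cle; apply: cauchy_cvg; apply: cauchy_exP => e /H[x Hx].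
  exists (c x); rewrite /fmap /=; apply: filterS Hx => t /=.
  rewrite -ball_normE /= nrmC -cB; exact: le_lt_trans.
have /cvg_ex[a /cvgrPdist_lt Ha] := comp _ (@cReB R) (@nrm_Re R).
have /cvg_ex[b /cvgrPdist_lt Hb] := comp _ (@cImB R) (@nrm_Im R).
exists (Complex a b); apply/cvg_nrmP => e e0.
near=> t.
rewrite (le_lt_trans (nrm_le_ReIm _)) // cReB cImB /= [ltRHS](splitr e).
rewrite ltrD // distrC.
- by near: t; apply: Ha; rewrite divr_gt0.
- by near: t; apply: Hb; rewrite divr_gt0.
Unshelve. all: by end_near.
Qed.

Lemma nrm_lim_le (X : normedModType C) (T : Type) (F : set_system T)
    {FF : ProperFilter F} (u : T -> X) (l : X) (B : R) :
  u @ F --> l -> (\forall t \near F, nrm (u t) <= B) -> nrm l <= B.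
Proof.
move=> /cvg_nrmP H HB; apply/ler_addgt0Pr => e e0.
have [t [h1 h2]] := filter_ex (filterI (H e e0) HB).
rewrite -(subrK (u t) l) addrC (le_trans (nrmD _ _)) // lerD // nrmC.
exact: ltW.
Qed.

Lemma lim_unique_nrm (X : normedModType C) (T : Type) (F : set_system T)
    {FF : ProperFilter F} (u : T -> X) (l l' : X) :
  u @ F --> l -> u @ F --> l' -> l = l'.
Proof. by move=> H H'; apply: cvg_unique H H'; exact: norm_hausdorff. Qed.

End ComplexLimits.

(** * Bounded holomorphic functions and their limits *)

Section BoundedHolomorphic.
Variable R : realType.
Local Notation C := (Cx R).
Variable X : normedModType C.
Implicit Types (f : X -> C) (p x y v h : X) (r M : R).

(** Radius and bound are explicit because Cauchy's estimate turns them into bounds for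
    differentials, which must be uniform along a filter. *)
Definition bounded_hol f p r M :=
  forall y, nrm (y - p) < r -> differentiable f y /\ nrm (f y) <= M.

Lemma bounded_hol_sub f p r M p' r' : nrm (p' - p) + r' <= r ->
  bounded_hol f p r M -> bounded_hol f p' r' M.
Proof.
move=> pr H y yp; apply: H; apply: le_lt_trans (nrm_tri _ p' _) _.
by rewrite addrC (lt_le_trans _ pr) // ltrD2l.
Qed.

Lemma bounded_hol_ge0 f p r M : 0 < r -> bounded_hol f p r M -> 0 <= M.
Proof.
move=> r0 /(_ p); rewrite subrr nrm0 => /(_ r0)[_].
by apply: le_trans; exact: nrm_ge0.
Qed.

(** The complex line in the direction [v] meets the ball in a disc of radius [r / nrm v]. *)
Lemma diff_bound f y v r M : 0 < r -> bounded_hol f y r M ->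
  nrm ('d f y v) <= 4 * M / r * nrm v.
Proof.
move=> r0 H; have [->|v0] := eqVneq v 0.
  by rewrite linear0 !nrm0 mulr0.
have nv : 0 < nrm v by rewrite nrm_gt0.
have -> : 4 * M / r * nrm v = 4 * M / (r / nrm v).
  by field; rewrite !gt_eqF.
apply: cauchy_estimate; first by rewrite divr_gt0.
move=> z; rewrite ltr_pdivlMr // => hz; apply: H.
by rewrite addrC addKr nrmZ.
Qed.

Lemma diff_bound_ball f p y v r M : 0 < r -> bounded_hol f p r M ->
  nrm (y - p) <= r / 2 -> nrm ('d f y v) <= 8 * M / r * nrm v.
Proof.
move=> r0 H hy.
have -> : 8 * M / r = 4 * M / (r / 2) by field; rewrite gt_eqF.
apply: diff_bound; first by rewrite divr_gt0.
apply: bounded_hol_sub H; lra.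
Qed.

Lemma nrm_segment p y h (t r : R) : 0 <= t <= 1 -> nrm (y - p) + nrm h <= r ->
  nrm (y + ofR t *: h - p) <= r.
Proof.
move=> /andP[t0 t1] H; rewrite addrAC (le_trans (nrmD _ _)) //.
apply: le_trans H; rewrite lerD2l nrmZ nrm_ofR ger0_norm //.
by rewrite ler_piMl // nrm_ge0.
Qed.

Lemma lipschitz_ball f p y h r M : 0 < r -> bounded_hol f p r M ->
  nrm (y - p) + nrm h <= r / 2 -> nrm (f (y + h) - f y) <= 16 * M / r * nrm h.
Proof.
move=> r0 H hy.
have -> : 16 * M / r * nrm h = 2 * (8 * M / r * nrm h) by field; rewrite gt_eqF.
apply: mean_value_le => t tI.
have hb := nrm_segment tI hy.
split; last exact: diff_bound_ball H hb.
by apply: (H _ _).1; apply: le_lt_trans hb _; lra.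
Qed.

(** A second-order Taylor bound without second derivatives. The mean value inequality is applied to
    [f - 'd f y]; the difference of the differentials at [y + k] and [y] is the differential at [y]
    of [f (x + k) - f x], which is small by the Lipschitz bound, so that Cauchy's estimate applies
    to it. The factors 2, 4, 16 and 8 of these steps make 1024. *)
Lemma quadratic_ball f p y h r M : 0 < r -> bounded_hol f p r M ->
  nrm (y - p) <= r / 8 -> nrm h <= r / 8 ->
  nrm (f (y + h) - f y - 'd f y h) <= 1024 * M / r ^+ 2 * nrm h ^+ 2.
Proof.
move=> r0 H hy hh; have rn0 : r != 0 by rewrite gt_eqF.
have dy : differentiable f y by apply: (H _ _).1; apply: le_lt_trans hy _; lra.
pose g x := f x - 'd f y x.
have -> : f (y + h) - f y - 'd f y h = g (y + h) - g y.
  by rewrite /g linearD /=; ring.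
have -> : 1024 * M / r ^+ 2 * nrm h ^+ 2 =
    2 * (4 * (16 * M / r * nrm h) / (r / 8) * nrm h) by field.
have dlin (a : X) := diff_linear_fun a (diff_continuous dy).
apply: mean_value_le => t tI; set k := ofR t *: h.
have kh : nrm k <= nrm h.
  move: tI => /andP[t0 t1].
  by rewrite nrmZ nrm_ofR ger0_norm // ler_piMl // nrm_ge0.
have hyk : nrm (y + k - p) <= r / 4.
  by apply: nrm_segment => //; lra.
have dyk : differentiable f (y + k).
  by apply: (H _ _).1; apply: le_lt_trans hyk _; lra.
split; first exact: fdiffB dyk (dlin _).1.
have -> : 'd g (y + k) h = 'd f (y + k) h - 'd f y h.
  have E := congr1 (fun F : X -> C => F h) (diff_sub dyk (dlin (y + k)).1).
  have E2 := congr1 (fun F : X -> C => F h) (dlin (y + k)).2.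
  exact: etrans E (congr1 (fun c => 'd f (y + k) h - c) E2).
pose D x := f (x + k) - f x.
have -> : 'd f (y + k) h - 'd f y h = 'd D y h.
  have E := congr1 (fun F : X -> C => F h) (diff_sub (diff_shift dyk).1 dy).
  have E2 := congr1 (fun F : X -> C => F h) (diff_shift dyk).2.
  exact: esym (etrans E (congr1 (fun c => c - 'd f y h) E2)).
apply: diff_bound; first lra.
move=> x hx.
have hxp : nrm (x - p) <= r / 4.
  by apply: le_trans (nrm_tri _ y _) _; lra.
have hxk : nrm (x + k - p) <= r / 2.
  by rewrite addrAC (le_trans (nrmD _ _)) //; lra.
split.
  apply: fdiffB; last by apply: (H _ _).1; apply: le_lt_trans hxp _; lra.
  apply: (diff_shift _).1.
  by apply: (H _ _).1; apply: le_lt_trans hxk _; lra.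
apply: le_trans (lipschitz_ball r0 H _) _; first lra.
rewrite ler_wpM2l // divr_ge0 ?(ltW r0) // mulr_ge0 //.
exact: bounded_hol_ge0 H.
Qed.

(** A common bound on a ball takes the place of locally uniform convergence: pointwise limits
    suffice, since the bound makes first-order expansions uniform. *)
Definition hol_cvg (T : Type) (F : set_system T) (f_ : T -> X -> C) f p :=
  exists r M, [/\ 0 < r, \forall t \near F, bounded_hol (f_ t) p r M &
    forall x, nrm (x - p) < r -> f_ ^~ x @ F --> f x].

(** Difference quotients with a fixed step converge along [F], and by [quadratic_ball] they
    approximate the differentials uniformly in [t]. Hence the differentials converge; their limit is
    linear, and the quadratic bound, passing to the limit, identifies it as the differential of
    [f]. *)
Lemma bounded_hol_lim (T : Type) (F : set_system T) {FF : ProperFilter F}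
    (f_ : T -> X -> C) f p r M : 0 < r ->
  (\forall t \near F, bounded_hol (f_ t) p r M) ->
  (forall x, nrm (x - p) < r -> f_ ^~ x @ F --> f x) ->
  bounded_hol f p (r / 8) M /\
  forall x v, nrm (x - p) < r / 8 -> (fun t => 'd (f_ t) x v) @ F --> 'd f x v.
Proof.
move=> r0 FH Fc.
suff K x : nrm (x - p) < r / 8 -> differentiable f x /\
    forall v, (fun t => 'd (f_ t) x v) @ F --> 'd f x v.
  split=> [x hx|x v hx]; last exact: (K x hx).2.
  split; first exact: (K x hx).1.
  have hxr : nrm (x - p) < r by lra.
  apply: nrm_lim_le (Fc x hxr) _.
  by apply: filterS FH => t /(_ x hxr)[].
move=> hx; pose B := 1024 * M / r ^+ 2.
have [t0 Ht0] := filter_ex FH.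
have M0 : 0 <= M := bounded_hol_ge0 r0 Ht0.
have B0 : 0 <= B.
  apply: divr_ge0; first exact: mulr_ge0 (ler0n _ _) M0.
  by apply: exprn_ge0; exact: ltW.
have inball h : nrm h <= r / 8 -> nrm (x + h - p) < r.
  move=> hh; rewrite addrAC (le_lt_trans (nrmD _ _)) //; lra.
have quad h : nrm h <= r / 8 -> \forall t \near F,
    nrm (f_ t (x + h) - f_ t x - 'd (f_ t) x h) <= B * nrm h ^+ 2.
  move=> hh; apply: filterS FH => t Ht; apply: quadratic_ball Ht _ _ => //.
  exact: ltW.
have dq h : nrm h <= r / 8 ->
    (fun t => f_ t (x + h) - f_ t x) @ F --> f (x + h) - f x.
  move=> hh; apply: cvgB; apply: Fc; first exact: inball.
  by rewrite (lt_trans hx) //; lra.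
have ex v : exists l : C, (fun t => 'd (f_ t) x v) @ F --> l.
  apply: cvg_complete => e e0.
  (* The step keeps [s v] in the ball where the quadratic bound holds and makes its error, divided
     by [s], at most [e / 2]. *)
  have [s [s0 s1 s2]] : exists s : R,
      [/\ 0 < s, s * nrm v <= r / 8 & B * (s * nrm v ^+ 2) <= e / 2].
    pose a := 1 + nrm v + B * nrm v ^+ 2.
    have nv := nrm_ge0 v.
    have bv : 0 <= B * nrm v ^+ 2 by rewrite mulr_ge0 // exprn_ge0.
    have a0 : 0 < a by rewrite /a; lra.
    have m0 : 0 < Num.min (r / 8) (e / 2) by rewrite lt_min !divr_gt0.
    exists (Num.min (r / 8) (e / 2) / a); split; first by rewrite divr_gt0.
      rewrite mulrAC ler_pdivrMr // (@le_trans _ _ (r / 8 * nrm v)) //.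
        by rewrite ler_wpM2r // ge_min lexx.
      by rewrite ler_wpM2l ?divr_ge0 ?(ltW r0) ?(ltW e0) // /a; lra.
    rewrite mulrCA mulrAC ler_pdivrMr // (@le_trans _ _ (e / 2 * (B * nrm v ^+ 2))) //.
      by rewrite ler_wpM2r // ge_min lexx orbT.
    by rewrite ler_wpM2l ?divr_ge0 ?(ltW r0) ?(ltW e0) // /a; lra.
  pose h := ofR s *: v.
  have nh : nrm h = s * nrm v by rewrite nrmZ nrm_ofR ger0_norm // ltW.
  have hh : nrm h <= r / 8 by rewrite nh.
  have sn0 : ofR s != 0 :> C by rewrite ofR_eq0 gt_eqF.
  exists ((ofR s)^-1 * (f (x + h) - f x)).
  have e2 : 0 < s * e / 2 by rewrite divr_gt0 // mulr_gt0.
  have /cvg_nrmP/(_ _ e2) := dq h hh.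
  apply: filterS2 (quad h hh) => t Hq Hd.
  rewrite -(ltr_pM2l s0).
  have -> : s * nrm ('d (f_ t) x v - (ofR s)^-1 * (f (x + h) - f x)) =
      nrm ('d (f_ t) x h - (f (x + h) - f x)).
    rewrite -[X in X * _]ger0_norm ?ltW // -nrm_ofR -nrmM; congr nrm.
    have -> : 'd (f_ t) x h = ofR s * 'd (f_ t) x v by rewrite /h linearZ.
    by rewrite [LHS]mulrBr (mulrA (ofR s)) divff // mul1r.
  rewrite nrmC (le_lt_trans (nrm_tri _ (f_ t (x + h) - f_ t x) _)) //.
  rewrite nrmC; have -> : s * e = s * e / 2 + s * e / 2 by field.
  rewrite ltr_leD // (le_trans Hq) // nh exprMn.
  have -> : B * (s ^+ 2 * nrm v ^+ 2) = s * (B * (s * nrm v ^+ 2)) by ring.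
  by rewrite -mulrA ler_pM2l.
have [L HL] := choice ex.
have Llin : linear L.
  move=> k a b; apply: lim_unique_nrm (HL _) _.
  have -> : (fun t => 'd (f_ t) x (k *: a + b)) =
      (fun t => k *: 'd (f_ t) x a + 'd (f_ t) x b).
    by apply/funext => t; rewrite linearP.
  by apply: cvgD (HL b); apply: cvgZl_tmp; exact: HL.
have Lb h : nrm (L h) <= 8 * M / r * nrm h.
  apply: nrm_lim_le (HL h) _; apply: filterS FH => t Ht.
  by apply: diff_bound_ball Ht _ => //; lra.
have Lq h : nrm h <= r / 8 -> nrm (f (x + h) - f x - L h) <= B * nrm h ^+ 2.
  move=> hh; apply: nrm_lim_le (quad h hh).
  by apply: cvgB (HL h); exact: dq.
have [df dE] : differentiable f x /\ 'd f x = L :> (X -> C).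
  apply: differentiable_intro Llin Lb _ => e e0.
  exists (Num.min (r / 8) (e / (B + 1))).
    by rewrite lt_min !divr_gt0 // ltr_wpDl.
  move=> h; rewrite lt_min => /andP[h1 h2].
  rewrite (le_trans (Lq _ (ltW h1))) // expr2 mulrA ler_wpM2r ?nrm_ge0 //.
  move: h2; rewrite ltr_pdivlMr ?ltr_wpDl // => h2.
  apply: le_trans (ltW h2); rewrite mulrDr mulr1 mulrC lerDl; exact: nrm_ge0.
split; first exact: df.
move=> v; have E : 'd f x v = L v := congr1 (fun F : X -> C => F v) dE.
by refine (@eq_ind_r _ (L v) (fun c : C => (fun t => 'd (f_ t) x v) @ F --> c) (HL v) _ E).
Qed.

End BoundedHolomorphic.

(** * Analyticity of derivatives and of limits *)

Section Analytic.
Variable R : realType.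
Local Notation C := (Cx R).
Variable X : normedModType C.
Implicit Types (f : X -> C) (p x y v h : X) (r M : R).

(** The derivative is a pointwise limit of difference quotients, which are holomorphic and bounded
    by the Lipschitz estimate, so [bounded_hol_lim] applies. One factor 8 in the radius leaves room
    for the shifts, the other is lost in the limit. *)
Lemma bounded_hol_derive f p v r M : 0 < r -> bounded_hol f p r M ->
  bounded_hol (fun x => 'd f x v) p (r / 64) (16 * M / r * nrm v).
Proof.
move=> r0 H.
pose s (n : nat) : R := r / 8 / (1 + nrm v) / n.+1%:R.
have v1 : 0 < 1 + nrm v by rewrite ltr_pwDl // nrm_ge0.
have r8 : 0 < r / 8 by rewrite divr_gt0.
have s0 n : 0 < s n by rewrite !divr_gt0.
have sv n : nrm (ofR (s n) *: v) = s n * nrm v.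
  by rewrite nrmZ nrm_ofR ger0_norm // ltW.
have svn n : s n * nrm v <= r / 8 / n.+1%:R.
  rewrite /s mulrAC ler_wpM2r ?invr_ge0 // mulrAC ler_pdivrMr //.
  by rewrite ler_wpM2l ?(ltW r8) // lerDr.
have sv8 n : s n * nrm v <= r / 8.
  apply: le_trans (svn n) _; rewrite ler_pdivrMr // ler_peMr ?(ltW r8) //.
  by rewrite ler1n.
pose q n x : C := (ofR (s n))^-1 * (f (x + ofR (s n) *: v) - f x).
have shifted n x : nrm (x - p) < r / 8 -> nrm (x + ofR (s n) *: v - p) < r.
  move=> hx; rewrite addrAC (le_lt_trans (nrmD _ _)) // sv.
  by have := sv8 n; lra.
have -> : r / 64 = r / 8 / 8 by field.
have qb n : bounded_hol (q n) p (r / 8) (16 * M / r * nrm v).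
  move=> x hx; split.
    apply: fdiffMl; apply: fdiffB; last by apply: (H _ _).1; lra.
    by apply: (diff_shift _).1; exact: (H _ (shifted n x hx)).1.
  rewrite nrmM nrmV nrm_ofR ger0_norm ?(ltW (s0 n)) // ler_pdivrMl //.
  have -> : s n * (16 * M / r * nrm v) = 16 * M / r * (s n * nrm v) by ring.
  rewrite -sv; apply: (lipschitz_ball r0 H).
  by rewrite sv; have := sv8 n; lra.
apply: (@bounded_hol_lim _ _ _ \oo _ q _ _ _ _ r8 _ _).1.
  by apply: nearW => n; exact: qb.
move=> x hx; apply/cvg_nrmP => e e0.
have dx : differentiable f x by apply: (H _ _).1; lra.
have e1 : 0 < e / (1 + nrm v) by rewrite divr_gt0.
have [d d0 Hd] := diff_nrm dx e1.
have d8 : 0 < d / (r / 8) by rewrite divr_gt0.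
near=> n.
have hn : nrm (ofR (s n) *: v) < d.
  rewrite sv (le_lt_trans (svn n)) // mulrC -ltr_pdivlMr //.
  by near: n; exact: (near_infty_natSinv_lt (PosNum d8)).
have sn0 : ofR (s n) != 0 :> C by rewrite ofR_eq0 gt_eqF.
rewrite -(ltr_pM2l (s0 n)).
have -> : s n * nrm (q n x - 'd f x v) =
   nrm (f (x + ofR (s n) *: v) - f x - 'd f x (ofR (s n) *: v)).
  rewrite -[X in X * _]ger0_norm ?ltW // -nrm_ofR -nrmM; congr nrm.
  have -> : 'd f x (ofR (s n) *: v) = ofR (s n) * 'd f x v by rewrite linearZ.
  by rewrite [LHS]mulrBr /q (mulrA (ofR (s n))) divff // mul1r.
rewrite (le_lt_trans (Hd _ hn)) // sv mulrCA ltr_pM2l // mulrAC ltr_pdivrMr //.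
by rewrite ltr_pM2l // ltrDr.
Unshelve. all: by end_near.
Qed.

Lemma analytic_atP f p :
  analytic_at f p <-> exists r M, 0 < r /\ bounded_hol f p r M.
Proof.
split=> [H|[r [M [r0 H]]]]; last by apply/near_nrmP; exists r => // x /H[].
have /near_nrmP[r r0 Hr] := H.
have df : differentiable f p by apply: Hr; rewrite subrr nrm0.
have /cvg_nrmP/(_ 1 ltr01) : f @ p --> f p by exact: differentiable_continuous df.
move=> /near_nrmP[d d0 Hd].
exists (Num.min r d), (nrm (f p) + 1); rewrite lt_min r0 d0; split=> // x.
rewrite lt_min => /andP[/Hr ? /Hd fx]; split => //.
by rewrite -(subrK (f p) (f x)) addrC (le_trans (nrmD _ _)) // lerD2l ltW.
Qed.

Lemma analytic_at_diff f p : analytic_at f p -> differentiable f p.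
Proof. by move=> /nbhs_singleton. Qed.

Lemma near_near (P : X -> Prop) p : (\forall x \near p, P x) ->
  \forall x \near p, \forall y \near x, P y.
Proof.
move=> /near_nrmP[r r0 Hr]; apply/near_nrmP; exists r => // x xr.
apply/near_nrmP; exists (r - nrm (x - p)); first by rewrite subr_gt0.
move=> y yx; apply: Hr; apply: le_lt_trans (nrm_tri _ x _) _; lra.
Qed.

Lemma eq_analytic_at f g p : same_germ p f g -> analytic_at f p -> analytic_at g p.
Proof.
move=> /near_near fg; apply: filterS2 fg => x fg df.
exact: (near_eq_diff fg df).1.
Qed.

Lemma same_germ_derive f g p v : same_germ p f g ->
  same_germ p ('D_v f) ('D_v g).
Proof.
move=> /near_near; apply: filterS => x fg.
by apply: near_eq_derive; apply: filterS fg.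
Qed.

Lemma derive_diff f x v : differentiable f x -> 'D_v f x = 'd f x v.
Proof. exact: deriveE. Qed.

(** ['D_v f] and the differential are compared only where [f] is differentiable; the rest is
    equality of germs. *)
Lemma bounded_hol_D f p v r M : 0 < r -> bounded_hol f p r M ->
  bounded_hol ('D_v f) p (r / 64) (16 * M / r * nrm v).
Proof.
move=> r0 H; have Hd := bounded_hol_derive v r0 H.
have E x : nrm (x - p) < r -> 'D_v f x = 'd f x v.
  by move=> xr; apply: derive_diff; exact: (H _ xr).1.
move=> x xr; have [dx nx] := Hd x xr.
split; last by rewrite E //; lra.
apply: (near_eq_diff _ dx).1; apply/near_nrmP; exists (r / 64); first lra.
move=> y yx; rewrite E //; apply: le_lt_trans (nrm_tri _ x _) _; lra.
Qed.

Lemma analytic_at_D f p v : analytic_at f p -> analytic_at ('D_v f) p.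
Proof.
move=> /analytic_atP[r [M [r0 H]]]; apply/analytic_atP.
by exists (r / 64), (16 * M / r * nrm v); split; [lra|exact: bounded_hol_D].
Qed.

Section HolomorphicLimits.
Context {T : Type} {F : set_system T} {FF : ProperFilter F}.

Lemma hol_cvg_analytic (f_ : T -> X -> C) f p : hol_cvg F f_ f p -> analytic_at f p.
Proof.
move=> [r [M [r0 H1 H2]]]; apply/analytic_atP; exists (r / 8), M.
by split; [lra | have := bounded_hol_lim r0 H1 H2 => -[]].
Qed.

Lemma hol_cvg_cvg (f_ : T -> X -> C) f p : hol_cvg F f_ f p -> f_ ^~ p @ F --> f p.
Proof. by move=> [r [M [r0 _]]]; apply; rewrite subrr nrm0. Qed.

(** Weierstrass's theorem on derivatives of limits, by which both expansions of the cotangent will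
    be differentiated termwise. *)
Lemma hol_cvg_D (f_ : T -> X -> C) f p v : hol_cvg F f_ f p ->
  hol_cvg F (fun t => 'D_v (f_ t)) ('D_v f) p.
Proof.
move=> [r [M [r0 H1 H2]]].
have [Hf Hd] := bounded_hol_lim r0 H1 H2.
exists (r / 64), (16 * M / r * nrm v); split; first lra.
  by apply: filterS H1 => t Ht; exact: bounded_hol_D.
move=> x xr; have xr8 : nrm (x - p) < r / 8 by lra.
have -> : 'D_v f x = 'd f x v by apply: derive_diff; exact: (Hf x xr8).1.
apply: cvg_trans (Hd x v xr8); apply: near_eq_cvg.
apply: filterS H1 => t Ht; rewrite derive_diff //.
by apply: (Ht _ _).1; lra.
Qed.

End HolomorphicLimits.

End Analytic.

(** * Unconditional sums *)

Section FiniteSubsets.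
Variable I : choiceType.

Lemma near_finsetsP (P : {fset I} -> Prop) :
  (\forall B \near @finsets_to_top I, P B) <->
  exists A : {fset I}, forall B, (A `<=` B)%fset -> P B.
Proof.
split=> [[A _ H]|[A H]]; last by exists A.
by exists A => B AB; exact: H.
Qed.

Global Instance finsets_to_top_filter : ProperFilter (@finsets_to_top I).
Proof.
split.
  move=> /near_finsetsP[A H]; exact: (H A (fsubset_refl A)).
split.
- by apply/near_finsetsP; exists fset0.
- move=> P Q /near_finsetsP[A HA] /near_finsetsP[B HB].
  apply/near_finsetsP; exists (A `|` B)%fset => D /fsubUsetP[AD BD].
  by split; [exact: HA | exact: HB].
- move=> P Q PQ /near_finsetsP[A HA].
  by apply/near_finsetsP; exists A => B /HA /PQ.
Qed.

Lemma sum_fsetID (V : zmodType) (A B : {fset I}) (f : I -> V) : (A `<=` B)%fset ->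
  \sum_(i <- B) f i = \sum_(i <- A) f i + \sum_(i <- B | i \notin A) f i.
Proof.
move=> AB; rewrite (bigID (mem A)) /=; congr (_ + _).
rewrite big_fset_condE; apply: eq_fbigl => i; rewrite !inE /=.
by apply/andP/idP => [[]//|iA]; split=> //; exact: (fsubsetP AB).
Qed.

Lemma sum_fset_le (K : numDomainType) (A B : {fset I}) (f : I -> K) :
  (forall i, 0 <= f i) -> (A `<=` B)%fset -> \sum_(i <- A) f i <= \sum_(i <- B) f i.
Proof. by move=> f0 AB; rewrite (sum_fsetID _ AB) lerDl sumr_ge0. Qed.

End FiniteSubsets.

(** * Absolute bounds, reindexing and summation by rows *)

Section Summation.
Variable R : realType.
Local Notation C := (Cx R).

Definition abs_bound (I : choiceType) (f : I -> C) (M : R) : Prop :=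
  forall B : {fset I}, \sum_(i <- B) nrm (f i) <= M.

Definition has_sum (I : choiceType) (f : I -> C) (s : C) : Prop :=
  partial_sum f @ @finsets_to_top I --> s.

Section OneIndex.
Variable I : choiceType.
Implicit Types (f g : I -> C) (s t : C).

Lemma has_sumP f s : has_sum f s <->
  forall e : R, 0 < e -> exists A : {fset I}, forall B, (A `<=` B)%fset ->
    nrm (partial_sum f B - s) < e.
Proof.
split=> [/cvg_nrmP H e /H /near_finsetsP //|H].
by apply/cvg_nrmP => e /H /near_finsetsP.
Qed.

Lemma has_sum_unique f s t : has_sum f s -> has_sum f t -> s = t.
Proof. exact: lim_unique_nrm. Qed.

Lemma has_sum_usum f s : has_sum f s -> usum f = s.
Proof. by move=> H; apply: cvg_lim H; exact: norm_hausdorff. Qed.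

(** A finite set whose sum of norms nearly attains the supremum leaves a tail below [e], whatever
    larger finite set is taken. *)
Lemma abs_has_sum f M : abs_bound f M -> has_sum f (usum f).
Proof.
move=> HM; suff [s Hs] : exists s, has_sum f s by rewrite (has_sum_usum Hs).
apply: cvg_complete => e e0.
pose S := [set x : R | exists B : {fset I}, x = \sum_(i <- B) nrm (f i)].
have supS : has_sup S.
  split; first by exists (\sum_(i <- fset0) nrm (f i)), fset0.
  by exists M => _ [B ->].
have [_ [A ->] HA] := sup_adherent e0 supS.
exists (partial_sum f A); apply/near_finsetsP; exists A => B AB.
rewrite /partial_sum (sum_fsetID _ AB) addrC addKr.
apply: le_lt_trans (nrm_sum _ _ _) _.
have : \sum_(i <- B) nrm (f i) <= sup S by apply: ub_le_sup; [exact: supS.2|exists B].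
by rewrite (sum_fsetID _ AB); lra.
Qed.

Lemma has_sumD f g s t : has_sum f s -> has_sum g t ->
  has_sum (fun i => f i + g i) (s + t).
Proof.
rewrite /has_sum => Hf Hg.
rewrite (_ : partial_sum _ = fun B => partial_sum f B + partial_sum g B).
  exact: cvgD Hf Hg.
by apply/funext => B; rewrite /partial_sum big_split.
Qed.

Lemma has_sumZ f s (a : C) : has_sum f s -> has_sum (fun i => a * f i) (a * s).
Proof.
rewrite /has_sum => Hf.
rewrite (_ : partial_sum _ = fun B => a * partial_sum f B).
  exact: cvgMr.
by apply/funext => B; rewrite /partial_sum mulr_sumr.
Qed.

Lemma has_sumN f s : has_sum f s -> has_sum (fun i => - f i) (- s).
Proof.
move=> /(has_sumZ (a := -1)); rewrite mulN1r.
by under eq_fun do rewrite mulN1r.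
Qed.

(** Turns an unordered sum into the limit of a sequence, which can be telescoped or compared with
    symmetric partial sums. *)
Lemma has_sum_exhaust f s (A : nat -> {fset I}) :
  (forall i, \forall n \near \oo, i \in A n) -> has_sum f s ->
  (fun n => partial_sum f (A n)) @ \oo --> s.
Proof.
move=> HA; apply: cvg_comp => P /near_finsetsP[B HB].
suff : \forall n \near \oo, (B `<=` A n)%fset by apply: filterS => n /HB.
have : forall s : seq I, \forall n \near \oo, {subset s <= A n}.
  elim=> [|i r IH]; first by apply: nearW => n j.
  apply: filterS2 (HA i) IH => n hi hr j; rewrite inE => /orP[/eqP->//|].
  exact: hr.
by move=> /(_ B); apply: filterS => n Hn; apply/fsubsetP => j /Hn.
Qed.

End OneIndex.

Lemma abs_bound_inj (I J : choiceType) (h : I -> J) (f : J -> C) M :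
  injective h -> abs_bound f M -> abs_bound (f \o h) M.
Proof.
move=> hi HM B; apply: le_trans (HM [fset h i | i in B]%fset).
by rewrite big_imfset //= => i j _ _ /hi.
Qed.

Lemma has_sum_bij (I J : choiceType) (h : I -> J) (h' : J -> I) (f : J -> C) s :
  cancel h h' -> cancel h' h -> has_sum f s -> has_sum (f \o h) s.
Proof.
move=> hK h'K /has_sumP H; apply/has_sumP => e /H[A HA].
exists [fset h' j | j in A]%fset => B AB.
have -> : partial_sum (f \o h) B = partial_sum f [fset h i | i in B]%fset.
  by rewrite /partial_sum big_imfset //= => i j _ _ /(can_inj hK).
apply: HA; apply/fsubsetP => j jA; apply/imfsetP; exists (h' j) => //=.
by apply: (fsubsetP AB); apply/imfsetP; exists j.
Qed.

Lemma sum_fset_pair (V : zmodType) (I J : choiceType) (A : {fset I}) (B : {fset J})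
    (f : I * J -> V) :
  \sum_(k <- (A `*` B)%fset) f k = \sum_(i <- A) \sum_(j <- B) f (i, j).
Proof.
rewrite big_imfset2 //= => -[i j] [i' j'] _ _ /= [-> E].
by rewrite E.
Qed.

(** For finitely many rows one finite set of columns approximates all row sums at once. Enlarged
    until the product contains [A], it compares the sum of the rows with [s]. *)
Lemma has_sum_rows (I J : choiceType) (f : I * J -> C) (r : I -> C) s :
  has_sum f s -> (forall i, has_sum (fun j => f (i, j)) (r i)) -> has_sum r s.
Proof.
move=> /has_sumP H Hr; apply/has_sumP => e e0.
have e2 : 0 < e / 2 by rewrite divr_gt0.
have [A HA] := H _ e2.
exists [fset k.1 | k in A]%fset => B AB.
have Hc : (fun D => \sum_(i <- B) partial_sum (fun j => f (i, j)) D)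
    @ @finsets_to_top J --> partial_sum r B.
  rewrite /partial_sum; elim: (B : seq I) => [|i l IH].
    rewrite big_nil; under eq_fun do rewrite big_nil; exact: cvg_cst.
  rewrite big_cons; under eq_fun do rewrite big_cons.
  by apply: cvgD IH; exact: Hr.
have /cvg_nrmP/(_ _ e2)/near_finsetsP[D HD] := Hc.
pose D' := (D `|` [fset k.2 | k in A])%fset.
have := HD D' (fsubsetUl _ _).
have -> : \sum_(i <- B) partial_sum (fun j => f (i, j)) D' =
    partial_sum f (B `*` D')%fset.
  by rewrite /partial_sum sum_fset_pair.
move=> H1; have H2 : nrm (partial_sum f (B `*` D')%fset - s) < e / 2.
  apply: HA; apply/fsubsetP => -[i j] ij; rewrite in_fsetM /=; apply/andP; split.
    by apply: (fsubsetP AB); apply/imfsetP; exists (i, j).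
  by rewrite inE; apply/orP; right; apply/imfsetP; exists (i, j).
rewrite nrmC in H1.
by apply: le_lt_trans (nrm_tri _ _ _) _; rewrite [ltRHS]splitr; apply: ltrD H1 H2.
Qed.

Lemma abs_bound_row (I J : choiceType) (f : I * J -> C) M i :
  abs_bound f M -> abs_bound (fun j => f (i, j)) M.
Proof. by move=> H; apply: (abs_bound_inj (h := fun j => (i, j))) H => j j' []. Qed.

Lemma abs_rows (I J : choiceType) (f : I * J -> C) M : abs_bound f M ->
  has_sum (fun i => usum (fun j => f (i, j))) (usum f).
Proof.
move=> H; apply: has_sum_rows (abs_has_sum H) _ => i.
exact: abs_has_sum (abs_bound_row i H).
Qed.

End Summation.

(** * Exhausting sequences of finite sets *)

Section Exhaustion.
Variable I : choiceType.

Lemma near_fsubset (A : nat -> {fset I}) (B : {fset I}) :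
  (forall i, \forall n \near \oo, i \in A n) -> \forall n \near \oo, (B `<=` A n)%fset.
Proof.
move=> HA; have : forall s : seq I, \forall n \near \oo, {subset s <= A n}.
  elim=> [|i r IH]; first by apply: nearW => n j.
  apply: filterS2 (HA i) IH => n hi hr j; rewrite inE => /orP[/eqP->//|].
  exact: hr.
by move=> /(_ B); apply: filterS => n Hn; apply/fsubsetP => j /Hn.
Qed.

Lemma exhaust_cvg (A : nat -> {fset I}) :
  (forall i, \forall n \near \oo, i \in A n) -> A @ \oo --> @finsets_to_top I.
Proof.
move=> HA P /near_finsetsP[B HB].
by have := near_fsubset B HA; apply: filterS => n /HB.
Qed.

Lemma exhaust_sum_le (K : numDomainType) (A : nat -> {fset I}) (u : I -> K) (M : K) :
  (forall i, \forall n \near \oo, i \in A n) -> (forall i, 0 <= u i) ->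
  (forall n, \sum_(i <- A n) u i <= M) ->
  forall B : {fset I}, \sum_(i <- B) u i <= M.
Proof.
move=> HA u0 HM B; have [n BA] := filter_ex (near_fsubset B HA).
exact: le_trans (sum_fset_le u0 BA) (HM n).
Qed.

End Exhaustion.

Fixpoint nat_fset (N : nat) : {fset nat} :=
  if N is n.+1 then (n |` nat_fset n)%fset else fset0.

Lemma in_nat_fset N i : (i \in nat_fset N) = (i < N)%N.
Proof.
by elim: N => [|N IH] //=; rewrite in_fset1U IH ltnS (leq_eqVlt i).
Qed.

Lemma near_nat_fset i : \forall n \near \oo, i \in nat_fset n.
Proof. by exists i.+1 => // n /= h; rewrite in_nat_fset. Qed.

Lemma sum_nat_fset (V : zmodType) (f : nat -> V) N :
  \sum_(i <- nat_fset N) f i = \sum_(0 <= i < N) f i.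
Proof.
elim: N => [|N IH]; first by rewrite big_geq // big_seq_fset0.
by rewrite /= big_fsetU1 ?in_nat_fset ?ltnn //= IH big_nat_recr //= addrC.
Qed.

(** The integers from [- N] to [N]. Symmetric windows pair [k] with [- k], as is required for the
    conditionally convergent sum of [(z - k)^-1]. *)
Fixpoint sym_fset (N : nat) : {fset int} :=
  if N is n.+1 then (n.+1%:Z |` (- n.+1%:Z |` sym_fset n))%fset else [fset 0]%fset.

Lemma in_sym_fset N (k : int) : (k \in sym_fset N) = (`|k| <= N)%N.
Proof.
elim: N => [|N IH] /=; first by rewrite inE leqn0 absz_eq0.
rewrite !in_fset1U IH; apply/idP/idP => [/orP[/eqP->|/orP[/eqP->|]]|].
- by rewrite absz_nat.
- by rewrite abszN absz_nat.
- by move/leqW.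
rewrite leq_eqVlt => /orP[/eqP E|]; last by rewrite ltnS => ->; rewrite !orbT.
have [-> | ->] : k = N.+1%:Z \/ k = - N.+1%:Z by lia.
  by rewrite eqxx.
by rewrite eqxx orbT.
Qed.

Lemma near_sym_fset k : \forall n \near \oo, k \in sym_fset n.
Proof. by exists `|k|%N => // n /= h; rewrite in_sym_fset. Qed.

Lemma sum_sym_fset (V : zmodType) (f : int -> V) N :
  \sum_(k <- sym_fset N) f k =
  f 0 + \sum_(1 <= n < N.+1) (f n%:Z + f (- n%:Z)).
Proof.
elim: N => [|N IH]; first by rewrite big_geq //= big_seq_fset1 addr0.
rewrite /= big_fsetU1; last first.
  rewrite in_fset1U in_sym_fset absz_nat ltnn orbF.
  by apply/eqP; lia.
rewrite big_fsetU1 ?in_sym_fset ?abszN ?absz_nat ?ltnn //= IH.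
by rewrite [in RHS]big_nat_recr //= !addrA; rewrite addrC addrA addrC !addrA.
Qed.

(** * Summable weights for comparison *)

Section Weights.
Variable R : realType.

(* A summable weight on nat whose products dominate max(k, l)^-3. *)
Definition wgt (n : nat) : R := (Num.sqrt n.+1%:R) ^- 3.

Lemma wgt_gt0 n : 0 < wgt n.
Proof. by rewrite invr_gt0 exprn_gt0 // sqrtr_gt0 ltr0n. Qed.

(** With [x] and [y] the roots of n + 1 and n + 2, clearing denominators leaves
    [y (x + y) <= 4 x^2], where [y^2 = x^2 + 1] and [x^2 >= 1]. *)
Lemma wgt_telescope n :
  wgt n <= 4 * ((Num.sqrt n.+1%:R)^-1 - (Num.sqrt n.+2%:R)^-1).
Proof.
rewrite /wgt; set x := Num.sqrt n.+1%:R; set y := Num.sqrt n.+2%:R.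
have x2 : x ^+ 2 = n.+1%:R by rewrite sqr_sqrtr.
have y2 : y ^+ 2 = x ^+ 2 + 1 by rewrite x2 sqr_sqrtr // -natr1.
have x0 : 0 < x by rewrite sqrtr_gt0 ltr0n.
have y0 : 0 < y by rewrite sqrtr_gt0 ltr0n.
have x1 : 1 <= x ^+ 2 by rewrite x2 ler1n.
rewrite -(ler_pM2r (_ : 0 < x ^+ 3 * y * (x + y))); last first.
  by rewrite !mulr_gt0 ?exprn_gt0 ?addr_gt0.
have -> : x ^- 3 * (x ^+ 3 * y * (x + y)) = y * (x + y).
  by field; rewrite gt_eqF.
have -> : 4 * (x^-1 - y^-1) * (x ^+ 3 * y * (x + y)) = 4 * x ^+ 2 * (y ^+ 2 - x ^+ 2).
  by field; rewrite !gt_eqF.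
have -> : y ^+ 2 - x ^+ 2 = 1 by rewrite y2; ring.
have : 0 <= (x - y) ^+ 2 by rewrite sqr_ge0.
nra.
Qed.

Lemma wgt_sum_nat N : \sum_(0 <= n < N) wgt n <= 4.
Proof.
have : \sum_(0 <= n < N) wgt n <= 4 * (1 - (Num.sqrt N.+1%:R)^-1).
  elim: N => [|N IH]; first by rewrite big_geq // sqrtr1 invr1 subrr mulr0.
  by rewrite big_nat_recr //=; have := wgt_telescope N; lra.
move=> H; apply: le_trans H _.
have : 0 <= (Num.sqrt N.+1%:R)^-1 :> R by rewrite invr_ge0 sqrtr_ge0.
lra.
Qed.

Lemma wgt_sum_fset (B : {fset nat}) : \sum_(n <- B) wgt n <= 4.
Proof.
apply: (exhaust_sum_le near_nat_fset) => [n|N]; first exact/ltW/wgt_gt0.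
by rewrite sum_nat_fset wgt_sum_nat.
Qed.

Lemma wgt_sum_int (B : {fset int}) : \sum_(k <- B) wgt `|k|%N <= 8.
Proof.
apply: (exhaust_sum_le near_sym_fset) => [n|N]; first exact/ltW/wgt_gt0.
rewrite sum_sym_fset absz0.
have -> : \sum_(1 <= n < N.+1) (wgt `|n%:Z|%N + wgt `|(- n%:Z)%R|%N) =
    2 * \sum_(1 <= n < N.+1) wgt n.
  rewrite mulr_sumr; apply: eq_bigr => n _.
  by rewrite abszN absz_nat mulr_natl mulr2n.
have := wgt_sum_nat N.+1; rewrite big_nat_recl // big_add1 /=.
have := wgt_gt0 0; lra.
Qed.

Lemma wgt_sum_pair (I J : choiceType) (u : I -> R) (v : J -> R) (M N : R)
    (B : {fset I * J}) : (forall i, 0 <= u i) -> (forall j, 0 <= v j) ->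
  (forall A : {fset I}, \sum_(i <- A) u i <= M) ->
  (forall A : {fset J}, \sum_(j <- A) v j <= N) ->
  \sum_(k <- B) u k.1 * v k.2 <= M * N.
Proof.
move=> u0 v0 HM HN.
have BB : (B `<=` [fset k.1 | k in B] `*` [fset k.2 | k in B])%fset.
  apply/fsubsetP => -[i j] ij; rewrite in_fsetM /=.
  by apply/andP; split; apply/imfsetP; exists (i, j).
apply: le_trans (sum_fset_le _ BB) _ => [k|]; first by rewrite mulr_ge0.
rewrite sum_fset_pair /=.
under eq_bigr do rewrite -mulr_sumr.
by rewrite -mulr_suml ler_pM ?sumr_ge0.
Qed.

Lemma wgt_inv_sqr n : (n.+1%:R : R) ^- 2 <= wgt n.
Proof.
rewrite /wgt; set x := Num.sqrt n.+1%:R.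
have x2 : x ^+ 2 = n.+1%:R by rewrite sqr_sqrtr.
have x0 : 0 < x by rewrite sqrtr_gt0 ltr0n.
have x1 : 1 <= x by rewrite -sqrtr1 ler_wsqrtr // ler1n.
rewrite -x2 -exprM lef_pV2 ?posrE ?exprn_gt0 //.
by rewrite ler_weXn2l.
Qed.

Lemma wgt_inv_cube (k l n : nat) : (k < n)%N -> (l < n)%N ->
  (n%:R : R) ^- 3 <= wgt k * wgt l.
Proof.
move=> kn ln; rewrite /wgt -invfM -exprMn.
have n0 : 0 < n%:R :> R by rewrite ltr0n; lia.
have ss : Num.sqrt k.+1%:R * Num.sqrt l.+1%:R <= n%:R :> R.
  have -> : n%:R = Num.sqrt n%:R * Num.sqrt n%:R :> R by rewrite -expr2 sqr_sqrtr // ltW.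
  by rewrite ler_pM ?sqrtr_ge0 // ler_wsqrtr // ler_nat.
rewrite lef_pV2 ?posrE ?exprn_gt0 ?mulr_gt0 ?sqrtr_gt0 //.
by rewrite lerXn2r // nnegrE ?mulr_ge0 ?sqrtr_ge0 // ltW.
Qed.

End Weights.

(** * The M-test for holomorphic sums *)

Section HolomorphicSums.
Variable R : realType.
Local Notation C := (Cx R).

Lemma abs_bound_wgt (f : nat -> C) (c : R) : 0 <= c ->
  (forall n, nrm (f n) <= c * wgt R n) -> abs_bound f (c * 4).
Proof.
move=> c0 H B; apply: le_trans (ler_sum _ (fun i _ => H i)) _.
by rewrite -mulr_sumr ler_wpM2l // wgt_sum_fset.
Qed.

Lemma series_cvg (f : nat -> C) s : has_sum f s -> series f @ \oo --> s.
Proof.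
move=> Hs; have := has_sum_exhaust near_nat_fset Hs.
by rewrite (_ : (fun n => _) = series f) //; apply/funext => n; exact: sum_nat_fset.
Qed.

Lemma series_lim (f : nat -> C) s : has_sum f s -> lim (series f @ \oo) = s.
Proof. by move=> /series_cvg H; apply: cvg_lim H; exact: norm_hausdorff. Qed.

Lemma abs_bound_tail (I : choiceType) (f : I -> C) (u : I -> R) (M : R)
    (A : {fset I}) : (forall i, 0 <= u i) ->
  (forall B : {fset I}, \sum_(i <- B) u i <= M) ->
  (forall i, i \notin A -> nrm (f i) <= u i) -> exists K, abs_bound f K.
Proof.
move=> u0 HM H; exists (\sum_(i <- A) nrm (f i) + M) => B.
rewrite (bigID (mem A)) /=; apply: lerD.
  rewrite big_fset_condE; apply: sum_fset_le => [i|]; first exact: nrm_ge0.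
  by apply/fsubsetP => i; rewrite !inE /= => /andP[].
apply: le_trans (HM B); rewrite [leRHS](bigID (mem A)) /= -[leLHS]add0r.
by apply: lerD; [exact: sumr_ge0 | exact: ler_sum].
Qed.

Variable X : normedModType C.
Implicit Types (p x : X).

Lemma hol_cvg_comp (T T' : Type) (F : set_system T) (F' : set_system T')
    {FF : ProperFilter F} (g : T' -> T) (f_ : T -> X -> C) f p :
  ProperFilter F' -> g @ F' --> F -> hol_cvg F f_ f p ->
  hol_cvg F' (fun t => f_ (g t)) f p.
Proof.
move=> PF gF [r [M [r0 H1 H2]]]; exists r, M; split=> //.
  exact: (gF _ H1).
move=> x xr; exact: cvg_comp gF (H2 x xr).
Qed.

(** The finitely many terms of [A] may have singularities inside the ball of radius [r], being only
    analytic at [p]; the radius is shrunk to serve them all. *)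
Lemma hol_usum (I : choiceType) (f_ : I -> X -> C) p r (u : I -> R) (M : R)
    (A : {fset I}) :
  0 < r -> (forall i, 0 <= u i) -> (forall B : {fset I}, \sum_(i <- B) u i <= M) ->
  (forall i, i \in A -> analytic_at (f_ i) p) ->
  (forall i, i \notin A -> bounded_hol (f_ i) p r (u i)) ->
  hol_cvg (@finsets_to_top I) (fun B x => partial_sum (f_ ^~ x) B)
    (fun x => usum (f_ ^~ x)) p /\ exists K, abs_bound (f_ ^~ p) K.
Proof.
move=> r0 u0 HM HA Hu.
have [r1 [k [r10 r1r k0 Hk]]] : exists (r1 : R) (k : I -> R),
    [/\ 0 < r1, r1 <= r, (forall i, 0 <= k i) &
      forall i, i \in A -> bounded_hol (f_ i) p r1 (k i)].
  have : forall s : seq I, {subset s <= A} -> exists (r1 : R) (k : I -> R),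
    [/\ 0 < r1, r1 <= r, (forall i, 0 <= k i) &
      forall i, i \in s -> bounded_hol (f_ i) p r1 (k i)].
    elim=> [|i s IH] sA; first by exists r, (fun=> 0).
    have [|r1 [k [r10 r1r k0 Hk]]] := IH.
      by move=> j js; apply: sA; rewrite inE js orbT.
    have /HA/analytic_atP[r2 [K [r20 H2]]] : i \in A by apply: sA; rewrite inE eqxx.
    have K0 := bounded_hol_ge0 r20 H2.
    exists (Num.min r1 r2), (fun j => if j == i then K else k j); split.
    - by rewrite lt_min r10.
    - by rewrite ge_min r1r.
    - by move=> j; case: ifP.
    move=> j; rewrite inE; case: eqP => [-> _|_ /= js].
      by apply: bounded_hol_sub H2; rewrite subrr nrm0 add0r ge_min lexx orbT.
    by apply: bounded_hol_sub (Hk j js); rewrite subrr nrm0 add0r ge_min lexx.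
  by move=> /(_ A); apply.
pose K := \sum_(i <- A) k i + M.
have bnd x : nrm (x - p) < r1 -> abs_bound (f_ ^~ x) K.
  move=> xr B; rewrite (bigID (mem A)) /=; apply: lerD.
    rewrite -big_filter.
    apply: (@le_trans _ _ (\sum_(i <- [seq i <- B | i \in A]) k i)).
      rewrite [leLHS]big_seq [leRHS]big_seq; apply: ler_sum => i.
      by rewrite mem_filter => /andP[iA _]; exact: (Hk i iA x xr).2.
    rewrite big_filter big_fset_condE; apply: sum_fset_le => //.
    by apply/fsubsetP => i; rewrite !inE /= => /andP[].
  apply: le_trans (HM B); rewrite [leRHS](bigID (mem A)) /=.
  apply: (@le_trans _ _ (\sum_(i <- B | i \notin A) u i)).
    by apply: ler_sum => i iA; apply: (Hu i iA x _).2; exact: lt_le_trans r1r.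
  by rewrite lerDr sumr_ge0.
split; last by exists K; apply: bnd; rewrite subrr nrm0.
exists r1, K; split=> //.
  apply: nearW => B x xr; split.
    apply: fdiff_sum => i _; case: (boolP (i \in A)) => iA.
      exact: (Hk i iA x xr).1.
    by apply: (Hu i iA x _).1; exact: lt_le_trans r1r.
  exact: le_trans (nrm_sum _ _ _) (bnd x xr B).
by move=> x xr; exact: abs_has_sum (bnd x xr).
Qed.

End HolomorphicSums.

(** * Derivatives in one complex variable *)

Section ComplexDerivative.
Variable R : realType.
Local Notation C := (Cx R).
Implicit Types (f g : C -> C) (z d e : C).

Definition cder f z d := differentiable f z /\ 'd f z 1 = d.

Lemma cder_diff f z d : cder f z d -> forall h, 'd f z h = d * h.
Proof.
move=> [_ <-] h.
rewrite -[h in LHS]mulr1 -[X in 'd f z X]/(_ *: (1 : C)) linearZ; exact: mulrC.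
Qed.

Lemma cder_D f z d : cder f z d -> 'D_1 f z = d.
Proof. by move=> [df <-]; exact: derive_diff. Qed.

Lemma cder_intro f z d :
  (forall e : R, 0 < e -> exists2 r : R, 0 < r &
    forall h, nrm h < r -> nrm (f (z + h) - f z - d * h) <= e * nrm h) ->
  cder f z d.
Proof.
move=> H; have dn (h : C) : nrm (d * h) <= nrm d * nrm h by rewrite nrmM.
have [df dE] := differentiable_intro (linear_mulr d) dn H.
split; first exact: df.
exact: etrans (congr1 (fun F : C -> C => F 1) dE) (mulr1 d).
Qed.

Lemma cder_cst (a : C) z : cder (fun _ => a) z 0.
Proof.
apply: cder_intro => e e0; exists 1 => // h _.
by rewrite mul0r subrr subr0 nrm0 mulr_ge0 ?nrm_ge0 // ltW.
Qed.

Lemma cder_id z : cder (fun x => x) z 1.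
Proof.
apply: cder_intro => e e0; exists 1 => // h _.
have -> : z + h - z - 1 * h = 0 by ring.
by rewrite nrm0 mulr_ge0 ?nrm_ge0 // ltW.
Qed.

Lemma cder_D2 f g z d e : cder f z d -> cder g z e ->
  cder (fun x => f x + g x) z (d + e).
Proof.
move=> [df <-] [dg <-]; split; first exact: fdiffD.
have E := congr1 (fun F : C -> C => F 1) (diffD df dg).
exact: E.
Qed.

Lemma cder_M f g z d e : cder f z d -> cder g z e ->
  cder (fun x => f x * g x) z (f z * e + g z * d).
Proof.
move=> [df <-] [dg <-]; split; first exact: fdiffM.
have E := congr1 (fun F : C -> C => F 1) (diffM df dg).
exact: E.
Qed.

Lemma cder_Ml (a : C) f z d : cder f z d -> cder (fun x => a * f x) z (a * d).
Proof. by move=> Hf; have := cder_M (cder_cst a z) Hf; rewrite mulr0 addr0. Qed.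

Lemma cder_N f z d : cder f z d -> cder (fun x => - f x) z (- d).
Proof.
move=> /(cder_Ml (-1)); rewrite mulN1r.
by under eq_fun do rewrite mulN1r.
Qed.

Lemma cder_B f g z d e : cder f z d -> cder g z e ->
  cder (fun x => f x - g x) z (d - e).
Proof. by move=> Hf Hg; apply: cder_D2 Hf (cder_N Hg). Qed.

Lemma cder_X f n z d : cder f z d ->
  cder (fun x => f x ^+ n.+1) z (n.+1%:R * f z ^+ n * d).
Proof.
move=> Hf; elim: n => [|n IH].
  by rewrite expr0 mulr1 mul1r; under eq_fun do rewrite expr1.
have := cder_M Hf IH; under eq_fun do rewrite -exprS.
rewrite (_ : f z * _ + _ = n.+2%:R * f z ^+ n.+1 * d) //.
by rewrite -[in RHS](natr1 n.+1) !exprS; ring.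
Qed.

Lemma cder_comp f g z d e : cder f z d -> cder g (f z) e ->
  cder (fun x => g (f x)) z (e * d).
Proof.
move=> [df fE] Hg; have [dg _] := Hg; split; first exact: fdiff_comp df dg.
have E := congr1 (fun F : C -> C => F 1) (diff_comp df dg).
apply: etrans E _; rewrite /= (cder_diff Hg); congr (_ * _); exact: fE.
Qed.

Lemma cder_inv z : z != 0 -> cder (fun x => x^-1) z (- z ^- 2).
Proof.
move=> z0; split; first by apply: fdiffV z0; exact: fdiff_id.
have := congr1 (fun F : C -> C => F 1) (diff_Rinv z0) => E; apply: etrans E _.
exact: mulr1.
Qed.

Lemma cder_cexp z : cder (@cexp R) z (cexp z).
Proof.
have [dc E] := differentiable_cexp z; split; first exact: dc.
exact: etrans (congr1 (fun F : C -> C => F 1) E) (mulr1 _).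
Qed.

Lemma cder_qexp z : cder (@qexp R) z (twopii R * qexp z).
Proof.
rewrite mulrC; apply: cder_comp (cder_cexp _).
by have := cder_Ml (twopii R) (cder_id z); rewrite mulr1.
Qed.

Lemma cder_sum (I : Type) (r : seq I) (f : I -> C -> C) (d : I -> C) z :
  (forall i, cder (f i) z (d i)) ->
  cder (fun x => \sum_(i <- r) f i x) z (\sum_(i <- r) d i).
Proof.
move=> H; elim: r => [|i r IH].
  by rewrite big_nil; under eq_fun do rewrite big_nil; exact: cder_cst.
by rewrite big_cons; under eq_fun do rewrite big_cons; exact: cder_D2.
Qed.

Lemma mean_value_cder f (h : C) (K : R) (d : C -> C) :
  (forall t : R, 0 <= t <= 1 -> cder f (ofR t * h) (d (ofR t * h)) /\
     nrm (d (ofR t * h)) <= K) ->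
  nrm (f h - f 0) <= 2 * (K * nrm h).
Proof.
move=> H; have := @mean_value_le R C f 0 h (K * nrm h).
rewrite add0r; apply => t /H[Hd HK]; rewrite add0r.
split; first exact: Hd.1.
have E : 'd f (ofR t *: h) h = d (ofR t * h) * h := cder_diff Hd h.
by rewrite E nrmM ler_wpM2r // nrm_ge0.
Qed.

(** The induction carries equality on the whole open set, since a derivative depends on a germ. *)
Lemma iter_D_on (U : set C) f (g : nat -> C -> C) :
  (forall z, U z -> \forall x \near z, U x) ->
  (forall z, U z -> f z = g 0%N z) ->
  (forall j z, U z -> cder (g j) z (g j.+1 z)) ->
  forall j z, U z -> iter j (fun F : C -> C => 'D_1 F) f z = g j z.
Proof.
move=> oU fg Hg; elim=> [|j IH] z Uz /=; first exact: fg.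
have H : same_germ z (iter j (fun F : C -> C => 'D_1 F) f) (g j).
  by apply: filterS (oU z Uz) => x; exact: IH.
have E := nbhs_singleton (@same_germ_derive R C _ _ z (1 : C) H).
by rewrite (cder_D (Hg j z Uz)) in E.
Qed.

Lemma hol_cvg_iterD (T : Type) (F : set_system T) {FF : ProperFilter F}
    (f_ : T -> C -> C) f z j : hol_cvg F f_ f z ->
  hol_cvg F (fun t => iter j (fun F : C -> C => 'D_1 F) (f_ t))
    (iter j (fun F : C -> C => 'D_1 F) f) z.
Proof. by move=> H; elim: j => [//|j IH] /=; exact: hol_cvg_D. Qed.

(** Each bound follows from the previous one by the mean value inequality, whose factor 2 doubles
    the constant every time. *)
Lemma cexp_expand (y : C) : nrm y <= 1 ->
  [/\ nrm (cexp y - 1) <= 2 * expR 1 * nrm y,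
      nrm (cexp y - 1 - y) <= 4 * expR 1 * nrm y ^+ 2 &
      nrm (cexp y - 1 - y - y ^+ 2 / 2) <= 8 * expR 1 * nrm y ^+ 3].
Proof.
have seg (x : C) (t : R) : 0 <= t <= 1 -> nrm (ofR t * x) <= nrm x.
  move=> /andP[t0 t1].
  by rewrite nrmM nrm_ofR ger0_norm // ler_piMl // nrm_ge0.
have S1 (x : C) : nrm x <= 1 -> nrm (cexp x - 1) <= 2 * expR 1 * nrm x.
  move=> x1; have := @mean_value_cder (@cexp R) x (expR 1) (@cexp R).
  rewrite cexp0 mulrA; apply => t tI; split; first exact: cder_cexp.
  rewrite nrm_cexp ler_expR (le_trans (ler_norm _)) // (le_trans (nrm_Re _)) //.
  exact: le_trans (seg _ _ tI) x1.
have e0 : 0 <= expR 1 :> R by exact: expR_ge0.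
have S2 (x : C) : nrm x <= 1 -> nrm (cexp x - 1 - x) <= 4 * expR 1 * nrm x ^+ 2.
  move=> x1; have := @mean_value_cder (fun y => cexp y - y) x
    (2 * expR 1 * nrm x) (fun y => cexp y - 1).
  rewrite cexp0 subr0.
  have -> : cexp x - x - 1 = cexp x - 1 - x by ring.
  have -> : 2 * (2 * expR 1 * nrm x * nrm x) = 4 * expR 1 * nrm x ^+ 2 by ring.
  apply => t tI; split; first by apply: cder_B (cder_cexp _) (cder_id _).
  apply: le_trans (S1 _ _) _; first exact: le_trans (seg _ _ tI) x1.
  by rewrite ler_wpM2l ?seg // mulr_ge0.
move=> y1; split; [exact: S1 | exact: S2 |].
have := @mean_value_cder (fun y => cexp y - y - 2^-1 * y ^+ 2) y
    (4 * expR 1 * nrm y ^+ 2) (fun y => cexp y - 1 - y).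
rewrite cexp0 expr0n mulr0 !subr0.
have -> : cexp y - y - 2^-1 * y ^+ 2 - 1 = cexp y - 1 - y - y ^+ 2 / 2 by ring.
have -> : 2 * (4 * expR 1 * nrm y ^+ 2 * nrm y) = 8 * expR 1 * nrm y ^+ 3 by ring.
apply => t tI; split.
  apply: cder_B; first by apply: cder_B (cder_cexp _) (cder_id _).
  have := cder_Ml 2^-1 (cder_X 1 (cder_id (ofR t * y))).
  by rewrite expr1 mulr1 mulrA mulVf ?mul1r // pnatr_eq0.
apply: le_trans (S2 _ _) _; first exact: le_trans (seg _ _ tI) y1.
by rewrite ler_wpM2l ?mulr_ge0 // lerXn2r ?nnegrE ?nrm_ge0 ?seg.
Qed.

End ComplexDerivative.

(** * The cotangent series *)

Section Cotangent.
Variable R : realType.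
Local Notation C := (Cx R).
Implicit Types (z : C) (l N : nat).

Definition nbound (x : R) : nat := Num.bound `|x|.

Lemma nboundP (x : R) : x < (nbound x)%:R.
Proof. exact: le_lt_trans (ler_norm x) (archi_boundP (normr_ge0 x)). Qed.

(** The poles at [l] and [- l] taken together give [2 z / (z^2 - l^2)], which is absolutely
    summable. *)
Definition epair (l : nat) (z : C) : C :=
  if l == 0%N then z^-1 else (z - l%:R)^-1 + (z + l%:R)^-1.

(** The partial fraction series of pi cot(pi z). *)
Definition Eone (z : C) : C := usum (fun l => epair l z).

Lemma partial_epair N z :
  partial_sum (fun l => epair l z) (nat_fset N.+1) =
  \sum_(k <- sym_fset N) (z - k%:~R)^-1.
Proof.
rewrite /partial_sum sum_nat_fset sum_sym_fset big_nat_recl // subr0.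
congr (_ + _); rewrite big_add1 /=; apply: eq_bigr => l _.
by rewrite /epair /= mulrNz opprK.
Qed.

Lemma nat_far (rho : R) l (z : C) : nrm z <= rho -> 2 * rho <= l%:R ->
  l%:R / 2 <= nrm (z - l%:R) /\ l%:R / 2 <= nrm (z + l%:R).
Proof.
move=> hz hl; have nl := nrm_nat R l.
split.
  have := nrmB z (z - l%:R); rewrite opprB addrC subrK nl; lra.
have := nrmB (z + l%:R) z; rewrite addrC addKr nl; lra.
Qed.

(** Both factors of the denominator [(y - l) (y + l)] have modulus at least [l / 2], which gives 8;
    another 4 passes from [l] to [l + 1] in the weight. *)
Lemma epair_le (rho : R) l y : nrm y <= rho -> 2 * rho <= l%:R -> (0 < l)%N ->
  differentiable (epair l) y /\ nrm (epair l y) <= 32 * nrm y * wgt R l.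
Proof.
move=> yr ly l_gt0; have l0 : 0 < l%:R :> R by rewrite ltr0n.
have lN0 : l == 0%N = false by apply/negbTE; rewrite -lt0n.
have [h1 h2] := nat_far yr ly.
have n1 : y - l%:R != 0 by rewrite -nrm_gt0; lra.
have n2 : y + l%:R != 0 by rewrite -nrm_gt0; lra.
split.
  by rewrite /epair lN0; apply: fdiffD; apply: fdiffV.
rewrite /epair lN0.
have -> : (y - l%:R)^-1 + (y + l%:R)^-1 = 2 * y / ((y - l%:R) * (y + l%:R)).
  by field; rewrite n1 n2.
rewrite nrmM nrmV !nrmM nrm_nat.
apply: (@le_trans _ _ (2 * nrm y * (l%:R / 2 * (l%:R / 2))^-1)).
  apply: ler_pM; rewrite ?invr_ge0 ?mulr_ge0 ?nrm_ge0 //.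
  have l2 : 0 < l%:R / 2 :> R by rewrite divr_gt0.
  rewrite lef_pV2 ?posrE ?mulr_gt0 //; [|lra|lra].
  by apply: ler_pM; rewrite ?(ltW l2).
have w1 := wgt_inv_sqr R l.
have -> : 2 * nrm y * (l%:R / 2 * (l%:R / 2))^-1 = 8 * nrm y * l%:R ^- 2.
  by field; rewrite gt_eqF.
have hl2 : (l%:R : R) ^- 2 <= 4 * l.+1%:R ^- 2.
  have -> : 4 * (l.+1%:R : R) ^- 2 = (l.+1%:R / 2) ^- 2.
    have : l.+1%:R != 0 :> R by rewrite pnatr_eq0.
    by move: (l.+1%:R : R) => x x0; field.
  rewrite lef_pV2 ?posrE ?exprn_gt0 ?divr_gt0 //.
  rewrite lerXn2r ?nnegrE ?divr_ge0 ?(ltW l0) //.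
  have : 1 <= l%:R :> R by rewrite ler1n.
  by rewrite -natr1; lra.
have hw : (l%:R : R) ^- 2 <= 4 * wgt R l.
  by apply: le_trans hl2 _; rewrite ler_pM2l.
have -> : 32 * nrm y * wgt R l = 8 * nrm y * (4 * wgt R l) by ring.
by rewrite ler_wpM2l // mulr_ge0 // nrm_ge0.
Qed.

Lemma epair_tail p : exists n0 (c : R), [/\ (0 < n0)%N, 0 <= c &
  forall l, (n0 <= l)%N -> bounded_hol (epair l) p 1 (c * wgt R l)].
Proof.
pose rho := nrm p + 1; have rho1 : 1 <= rho by rewrite lerDr nrm_ge0.
exists (nbound (2 * rho)).+1, (32 * rho); split => //; first by lra.
move=> l hl y hy.
have ly : 2 * rho <= l%:R.
  apply/ltW/(lt_le_trans (nboundP (2 * rho))); rewrite ler_nat; lia.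
have yr : nrm y <= rho.
  by rewrite -(subrK p y) (le_trans (nrmD _ _)) // /rho addrC lerD2l ltW.
have [|dy Hy] := epair_le yr ly; first by lia.
split; first exact: dy.
apply: le_trans Hy _; rewrite ler_wpM2r ?(ltW (wgt_gt0 _ _)) //.
by rewrite ler_wpM2l.
Qed.

Definition not_int z := forall k : int, z != k%:~R.

Lemma epair_analytic l z : (l == 0%N -> z != 0) -> z != l%:R -> z != - l%:R ->
  analytic_at (epair l) z.
Proof.
move=> z0 zl zl'.
have opn (a : C) : z != a -> \forall x \near z, x != a.
  move=> za; apply/near_nrmP; exists (nrm (z - a)).
    by rewrite nrm_gt0 subr_eq0.
  by move=> x h; apply/eqP => xa; move: h; rewrite xa nrmC ltxx.
rewrite /analytic_at /epair; case l0: (l == 0%N).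
  by apply: filterS (opn 0 (z0 l0)) => x x0; apply: fdiffV => //; exact: fdiff_id.
apply: filterS2 (opn _ zl) (opn _ zl') => x x1 x2.
apply: fdiffD; apply: fdiffV.
- by apply: fdiffB; [exact: fdiff_id|exact: fdiff_cst].
- by rewrite subr_eq0.
- by apply: fdiffD; [exact: fdiff_id|exact: fdiff_cst].
- by rewrite addr_eq0.
Qed.

Lemma Eone_hol z : not_int z ->
  hol_cvg (@finsets_to_top nat) (fun B x => partial_sum (epair ^~ x) B) Eone z.
Proof.
move=> zi; have [n0 [c [n00 c0 H]]] := epair_tail z.
have K := @hol_usum R C nat epair z 1 (fun l => c * wgt R l) (c * 4) (nat_fset n0).
apply: (K _ _ _ _ _).1 => // [l|B|l _|l].
- by rewrite mulr_ge0 // ltW // wgt_gt0.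
- by rewrite -mulr_sumr ler_wpM2l // wgt_sum_fset.
- apply: epair_analytic; first by move=> _; exact: zi 0.
    exact: zi l.
  by have := zi (- l%:Z); rewrite mulrNz.
by rewrite in_nat_fset -leqNgt; exact: H.
Qed.

Lemma epair_abs z : exists K, abs_bound (fun l => epair l z) K.
Proof.
have [n0 [c [n00 c0 H]]] := epair_tail z.
apply: (@abs_bound_tail R nat _ (fun l => c * wgt R l) (c * 4) (nat_fset n0)).
- by move=> l; rewrite mulr_ge0 // ltW // wgt_gt0.
- by move=> B; rewrite -mulr_sumr ler_wpM2l // wgt_sum_fset.
move=> l; rewrite in_nat_fset -leqNgt => hl.
by apply: (H l hl z _).2; rewrite subrr nrm0.
Qed.

Lemma Eone_has_sum z : has_sum (fun l => epair l z) (Eone z).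
Proof. by have [K HK] := epair_abs z; exact: abs_has_sum HK. Qed.

Lemma near_nat_fsetS i : \forall n \near \oo, i \in nat_fset n.+1.
Proof. by exists i => // n h; rewrite in_nat_fset ltnS; exact: h. Qed.

Lemma Eone_cvg z : (fun N => \sum_(k <- sym_fset N) (z - k%:~R)^-1) @ \oo --> Eone z.
Proof.
have := has_sum_exhaust near_nat_fsetS (@Eone_has_sum z).
by under eq_fun do rewrite partial_epair.
Qed.

Lemma inv_far_cvg0 (a b : C) : (fun N : nat => (a + b * N%:R)^-1) @ \oo --> (0 : C) \/ b = 0.
Proof.
have [->|b0] := eqVneq b 0; [by right|left]; apply/cvg_nrmP => e e0.
have nb : 0 < nrm b by rewrite nrm_gt0.
exists (nbound ((nrm a + e^-1) / nrm b)).+1 => // N /= hN.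
rewrite subr0 nrmV -[ltRHS]invrK ltf_pV2 ?posrE ?invr_gt0 //.
  have : (nrm a + e^-1) / nrm b < N%:R.
    by apply: lt_trans (nboundP _) _; rewrite ltr_nat.
  rewrite ltr_pdivrMr // => h.
  have := nrmB (a + b * N%:R) a; rewrite addrC addKr nrmM nrm_nat; lra.
have : (nrm a + e^-1) / nrm b < N%:R.
  by apply: lt_trans (nboundP _) _; rewrite ltr_nat.
rewrite ltr_pdivrMr // => h.
have e1 : 0 < e^-1 by rewrite invr_gt0.
have := nrmB (a + b * N%:R) a; rewrite addrC addKr nrmM nrm_nat; lra.
Qed.

Lemma cvgC_unique (u : nat -> C) (a b : C) : u @ \oo --> a -> u @ \oo --> b -> a = b.
Proof. exact: lim_unique_nrm. Qed.

Lemma sum_sym_shift (f : int -> C) N :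
  \sum_(k <- sym_fset N) f (k - 1) = \sum_(k <- sym_fset N) f k
   + f (- N.+1%:Z) - f N%:Z.
Proof.
rewrite !sum_sym_fset; elim: N => [|N IH].
  by rewrite !big_geq // !addr0 sub0r; ring.
rewrite big_nat_recr //= addrA IH [in RHS]big_nat_recr //=.
have -> : N.+1%:Z - 1 = N%:Z by lia.
have -> : - N.+1%:Z - 1 = - N.+2%:Z by lia.
ring.
Qed.

(** Shifting the symmetric window by one changes the partial sums by two end terms that tend to
    0. *)
Lemma Eone_periodic z : Eone (z + 1) = Eone z.
Proof.
apply: cvgC_unique (@Eone_cvg (z + 1)) _.
have -> : (fun N => \sum_(k <- sym_fset N) (z + 1 - k%:~R)^-1) =
   (fun N => \sum_(k <- sym_fset N) (z - k%:~R)^-1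
     + ((z + 1) + 1 * N%:R)^-1 - (z + (-1) * N%:R)^-1).
  apply/funext => N.
  have -> : \sum_(k <- sym_fset N) (z + 1 - k%:~R)^-1 =
            \sum_(k <- sym_fset N) (z - (k - 1)%:~R)^-1.
    by apply: eq_bigr => k _; rewrite rmorphB /= opprB addrA addrAC.
  rewrite (sum_sym_shift (fun k => (z - k%:~R)^-1)) mulrNz opprK.
  by rewrite -[N.+1%:~R]/(N.+1%:R) -natr1; congr (_ + _^-1 - _^-1); ring.
rewrite -[X in _ --> X]addr0 -[X in _ --> X]subr0.
apply: cvgB; first apply: cvgD; first exact: @Eone_cvg.
  by case: (inv_far_cvg0 (z + 1) 1) => // /eqP; rewrite oner_eq0.
by case: (inv_far_cvg0 z (-1)) => // /eqP; rewrite oppr_eq0 oner_eq0.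
Qed.

Lemma sum_sym_double (f : int -> C) N :
  \sum_(k <- sym_fset N) (f (2 * k) + f (2 * k - 1)) =
  \sum_(k <- sym_fset (2 * N)) f k + f (- (2 * N).+1%:Z).
Proof.
rewrite !sum_sym_fset; elim: N => [|N IH].
  by rewrite !big_geq // !addr0 mulr0 muln0 sub0r.
rewrite big_nat_recr //= addrA IH.
have -> : (2 * N.+1 = (2 * N).+2)%N by lia.
rewrite [in RHS]big_nat_recr //= [in RHS]big_nat_recr //=.
have -> : 2 * N.+1%:Z = (2 * N).+2%:Z by lia.
have -> : (2 * N).+2%:Z - 1 = (2 * N).+1%:Z by lia.
have -> : 2 * - N.+1%:Z = - (2 * N).+2%:Z by lia.
have -> : - (2 * N).+2%:Z - 1 = - (2 * N).+3%:Z by lia.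
ring.
Qed.

Lemma cvg_double (u : nat -> C) (a : C) : u @ \oo --> a -> (fun N => u (2 * N)%N) @ \oo --> a.
Proof.
apply: cvg_comp => P [N _ HN]; exists N => // n /= h; apply: HN => /=; lia.
Qed.

(** The two series on the left are twice the parts of the series at [z] over the even and the odd
    integers. *)
Lemma Eone_double z : Eone (z / 2) + Eone ((z + 1) / 2) = 2 * Eone z.
Proof.
have H : (fun N => \sum_(k <- sym_fset N) (z / 2 - k%:~R)^-1 +
   \sum_(k <- sym_fset N) ((z + 1) / 2 - k%:~R)^-1) @ \oo -->
   Eone (z / 2) + Eone ((z + 1) / 2).
  by apply: cvgD; exact: @Eone_cvg.
apply: cvgC_unique H _.
have h2 (a b : C) : a = b / 2 -> a^-1 = 2 * b^-1.
  by move=> ->; rewrite invfM invrK mulrC.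
have two : (2 : C) != 0 by rewrite pnatr_eq0.
have -> : (fun N => \sum_(k <- sym_fset N) (z / 2 - k%:~R)^-1 +
   \sum_(k <- sym_fset N) ((z + 1) / 2 - k%:~R)^-1) =
  (fun N => 2 * (\sum_(k <- sym_fset (2 * N)) (z - k%:~R)^-1
     + ((z + 1) + 2 * N%:R)^-1)).
  apply/funext => N; rewrite -big_split /=.
  have -> : (z + 1 + 2 * N%:R)^-1 = (z - (- (2 * N).+1%:Z)%:~R)^-1.
    congr (_^-1); rewrite mulrNz opprK -[(2 * N).+1%:~R]/((2 * N).+1%:R).
    by rewrite -(natr1 (2 * N)) natrM; ring.
  rewrite -(sum_sym_double (fun k => (z - k%:~R)^-1)) mulr_sumr.
  apply: eq_bigr => k _; rewrite mulrDr; congr (_ + _); apply: h2.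
    by rewrite intrM; field.
  by rewrite rmorphB /= intrM; field.
apply: cvgMr; rewrite -[X in _ --> X]addr0.
apply: cvgD; first exact: (cvg_double (@Eone_cvg z)).
by case: (inv_far_cvg0 (z + 1) 2) => // /eqP; rewrite (negbTE two).
Qed.

(** The function pi cot(pi z), with value 0 at the integers. *)
Definition cotz (z : C) : C := twopii R / 2 * (qexp z + 1) / (qexp z - 1).

Lemma qexpD (a b : C) : qexp (a + b) = qexp a * qexp b.
Proof. by rewrite /qexp mulrDr cexpD. Qed.

Lemma qexp1 : qexp (1 : C) = 1.
Proof. by rewrite /qexp mulr1 cexp_twopii. Qed.

Lemma qexp_half : qexp (2^-1 : C) = -1.
Proof.
have : qexp (2^-1 : C) ^+ 2 = 1.
  rewrite expr2 -qexpD -[X in qexp (X + _)]mul1r -[X in qexp (_ + X)]mul1r.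
  by rewrite -mulrDl -[_ / 2]/((1 + 1) / 2) divff ?qexp1 // pnatr_eq0.
move=> /eqP; rewrite sqrf_eq1 => /orP[|/eqP //].
rewrite /qexp; have -> : twopii R * 2^-1 = Complex 0 pi.
  have -> : twopii R = Complex 0 (2 * pi) by rewrite Complex_ii ofR0 add0r.
  apply: (mulIf (_ : (2 : C) != 0)); rewrite ?pnatr_eq0 // mulfVK ?pnatr_eq0 //.
  by rewrite mulr_natr; apply: eqC; rewrite mulr2n ?cReD ?cImD /=; ring.
by move=> /eqP /(congr1 (@cRe R)) /=; rewrite expR0 mul1r cospi => h; exfalso; lra.
Qed.

Lemma cotz_periodic z : cotz (z + 1) = cotz z.
Proof. by rewrite /cotz qexpD qexp1 mulr1. Qed.

Lemma cotz_double z : cotz (z / 2) + cotz ((z + 1) / 2) = 2 * cotz z.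
Proof.
rewrite /cotz mulrDl (qexpD (z / 2)) div1r qexp_half mulrN1.
have -> : qexp z = qexp (z / 2) ^+ 2.
  by rewrite expr2 -qexpD; congr qexp; field.
set v := qexp (z / 2).
(* The values 1 and -1 of [v] belong to the even and the odd integers [z], where [0^-1 = 0] makes
   both sides vanish. *)
have [->|v1] := eqVneq v 1.
  by rewrite expr1n subrr invr0 !mulr0 addNr mulr0 mul0r addr0.
have [->|v2] := eqVneq v (-1).
  by rewrite sqrrN expr1n opprK subrr invr0 !mulr0 addNr mulr0 mul0r addr0.
have n1 : v - 1 != 0 by rewrite subr_eq0.
have n2 : v + 1 != 0 by rewrite addr_eq0.
have n3 : - v - 1 != 0 by rewrite -opprD oppr_eq0.
have n4 : v ^+ 2 - 1 != 0.
  have -> : v ^+ 2 - 1 = (v - 1) * (v + 1) by ring.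
  by rewrite mulf_neq0.
by field; rewrite n1 n3 n4.
Qed.

End Cotangent.

(** * Herglotz' proof of the cotangent expansion *)

Section Herglotz.
Variable R : realType.
Local Notation C := (Cx R).
Implicit Types (z : C).

Lemma periodic_int (T : Type) (f : C -> T) : (forall z, f (z + 1) = f z) ->
  forall (k : int) z, f (z + k%:~R) = f z.
Proof.
move=> f1; have fn (n : nat) z : f (z + n%:R) = f z.
  by elim: n => [|n IH]; rewrite ?addr0 // -natr1 addrA f1.
case=> n z; first exact: fn.
rewrite NegzE mulrNz -[in RHS](subrK (n.+1%:R : C) z) fn //.
Qed.

Lemma floor_period z : exists k : int, 0 <= cRe (z + k%:~R) < 1 /\
  cIm (z + k%:~R) = cIm z.
Proof.
exists (- Num.floor (cRe z)).
have /andP[h1 h2] := floor_itv (cRe z); rewrite intrD in h2.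
rewrite cReD cImD -ofR_int /= addr0 mulrNz; split => //; lra.
Qed.

(** After a translation to [0 <= Re < 1], the modulus forces a real argument x, and cos(2 pi x) = 1
    gives sin(pi x) = 0, which excludes 0 < x < 1. *)
Lemma qexp_eq1 z : qexp z = 1 -> exists k : int, z = k%:~R.
Proof.
move=> Ez; have [k [/andP[y0 y1] imy]] := floor_period z.
have q1 w : qexp (w + 1) = qexp w :> C by rewrite qexpD qexp1 mulr1.
move: Ez; rewrite -(periodic_int q1 k); set w := z + k%:~R in y0 y1 imy *.
suff H : qexp w = 1 -> w = 0.
  move=> /H /eqP; rewrite addr_eq0 -mulrNz => /eqP ->; by exists (- k).
have tw : twopii R * w = Complex (- (2 * pi * cIm w)) (pi * cRe w *+ 2).
  by apply: eqC; rewrite ?(cReM, cImM) /twopii /= ?(cReM, cImM) /=; ring.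
rewrite /qexp tw => E.
have pi0 : 0 < pi :> R := pi_gt0 R.
have im0 : cIm w = 0.
  have := congr1 (@nrm R C) E; rewrite nrm_cexp nrm1 -[RHS]expR0 /= => /expR_inj h.
  have : (2 * pi) * cIm w = 0 by lra.
  by move/eqP; rewrite mulf_eq0 gt_eqF ?mulr_gt0 //= => /eqP.
have := congr1 (@cRe R) E; rewrite /= im0 mulr0 oppr0 expR0 mul1r cos_mulr2n => Ec.
have s0 : sin (pi * cRe w) = 0.
  have {}Ec : cos (pi * cRe w) ^+ 2 *+ 2 - 1 = 1 by exact: Ec.
  apply/eqP; rewrite -sqrf_eq0 sin2cos2; apply/eqP; lra.
apply: eqC; last exact: im0.
apply/eqP; rewrite eq_le y0 andbT leNgt; apply/negP => yp.
have : 0 < sin (pi * cRe w).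
  by apply: sin_gt0_pi; rewrite mulr_gt0 //= -[ltRHS]mulr1 ltr_pM2l.
by rewrite s0 ltxx.
Qed.

Lemma cotz_diff z : not_int z -> differentiable (@cotz R) z.
Proof.
move=> zi.
have dq (a : C) : differentiable (fun x : C => qexp x + a) z.
  by apply: fdiffD; [exact: (cder_qexp z).1 | exact: fdiff_cst].
apply: fdiffM; first by apply: fdiffMl; exact: dq.
apply: fdiffV; first exact: dq.
by rewrite subr_eq0; apply/eqP => /qexp_eq1[k /eqP]; apply/negP; exact: zi.
Qed.

Lemma Eone_near0 z : nrm z <= 1 / 2 -> nrm (Eone z - z^-1) <= 128 * nrm z.
Proof.
move=> z1.
have Hc : (fun N => partial_sum (fun l => epair l z) (nat_fset N.+1) - z^-1) @ \oo
    --> Eone z - z^-1.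
  by apply: cvgB; [exact: has_sum_exhaust (@near_nat_fsetS) (@Eone_has_sum R z) | exact: cvg_cst].
apply: nrm_lim_le Hc _; apply: nearW => N.
rewrite /partial_sum sum_nat_fset big_nat_recl // addrC addKr.
apply: le_trans (nrm_sum _ _ _) _.
apply: (@le_trans _ _ (\sum_(0 <= l < N) 32 * nrm z * wgt R l.+1)).
  apply: ler_sum => l _; apply: (epair_le z1 _ _).2 => //.
  have : 0 <= l%:R :> R by rewrite ler0n.
  by rewrite -(natr1 l); lra.
rewrite -mulr_sumr.
have := wgt_sum_nat R N.+1; rewrite big_nat_recl // => H.
have w0 := wgt_gt0 R 0; have z0 := nrm_ge0 z.
have : \sum_(0 <= l < N) wgt R l.+1 <= 4 by lra.
move=> h; have -> : 128 * nrm z = 32 * nrm z * 4 by ring.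
by rewrite ler_wpM2l // mulr_ge0.
Qed.

(** For [x = 2 pi i z] and [r] the remainder of [cexp x] after its quadratic term, the terms of
    order 1 and 2 in the numerator cancel. What remains is cubic over a denominator of size at least
    [nrm x ^+ 2 / 2]. *)
Lemma cotz_near0 : exists2 d : R, 0 < d & exists2 K : R, 0 <= K &
  forall z, z != 0 -> nrm z < d -> nrm (cotz z - z^-1) <= K * nrm z.
Proof.
set B : R := expR 1; have B1 : 1 <= B by rewrite -expR0 ler_expR.
pose t := nrm (twopii R); have t0 : 0 < t by rewrite nrm_gt0 twopii_neq0.
(* This radius gives [nrm x <= 1 / (8 * B)], whence [E - 1] has modulus at least half that of
   [x]. *)
exists (1 / (8 * B * t)); first by rewrite divr_gt0 // !mulr_gt0 //; lra.
exists (26 * B * t ^+ 2); first by rewrite mulr_ge0 ?exprn_ge0 ?ltW //; lra.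
move=> z z0 hz; set x := twopii R * z.
have x0 : x != 0 by rewrite mulf_neq0 ?twopii_neq0.
have nx : nrm x = t * nrm z by rewrite nrmM.
have hx : nrm x <= 1 / (8 * B).
  move: hz; rewrite ltr_pdivlMr; last by rewrite !mulr_gt0 //; lra.
  by rewrite ler_pdivlMr ?mulr_gt0 //; [rewrite nx; nra | lra].
have x1 : nrm x <= 1.
  apply: le_trans hx _; rewrite ler_pdivrMr ?mulr_gt0 //; lra.
have [_ S2 S3] := cexp_expand x1.
rewrite -/B in S2 S3.
set E := cexp x in S2 S3; set r := E - 1 - x - x ^+ 2 / 2 in S3.
have nx0 : 0 < nrm x by rewrite nrm_gt0.
have lowE : nrm x / 2 <= nrm (E - 1).
  have : nrm (E - 1 - x) <= nrm x / 2.
    apply: le_trans S2 _; rewrite expr2 mulrA [leRHS]mulrC ler_wpM2r ?(ltW nx0) //.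
    move: hx; rewrite ler_pdivlMr ?mulr_gt0 //; [nra|lra].
  have := nrmB (E - 1) (E - 1 - x).
  have -> : E - 1 - (E - 1 - x) = x by ring.
  lra.
have E0 : E - 1 != 0 by rewrite -nrm_gt0; lra.
have -> : cotz z - z^-1 =
    twopii R * (x ^+ 3 / 4 + x * r / 2 - r) / (x * (E - 1)).
  rewrite /cotz /qexp -/x -/E /r.
  have -> : z^-1 = twopii R / x by rewrite /x; field; rewrite z0 twopii_neq0.
  by field; rewrite x0 E0.
rewrite (nrmM (twopii R * _)) (nrmM (twopii R)) nrmV (nrmM x (E - 1)) -/t.
(* The three terms contribute 1/4, 4 and 8 times [B]. *)
have num : nrm (x ^+ 3 / 4 + x * r / 2 - r) <= 13 * B * nrm x ^+ 3.
  apply: le_trans (nrmB _ _) _.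
  apply: le_trans (lerD (nrmD _ _) (lexx _)) _.
  rewrite [nrm (x ^+ 3 / 4)]nrmM nrmX [nrm (x * r / 2)]nrmM [nrm (x * r)]nrmM.
  rewrite !nrmV !nrm_nat.
  have r0 := nrm_ge0 r.
  have x3 : 0 <= nrm x ^+ 3 by rewrite exprn_ge0 // ltW.
  have : nrm x * nrm r <= nrm r by rewrite ler_piMl.
  have : nrm x ^+ 3 <= B * nrm x ^+ 3 by rewrite ler_peMl.
  lra.
have den : nrm x * (nrm x / 2) <= nrm x * nrm (E - 1) by rewrite ler_pM2l.
have den0 : 0 < nrm x * (nrm x / 2) by rewrite !mulr_gt0 // divr_gt0.
apply: (@le_trans _ _ (t * (13 * B * nrm x ^+ 3) / (nrm x * (nrm x / 2)))).
  apply: ler_pM; rewrite ?invr_ge0 ?mulr_ge0 ?nrm_ge0 ?(ltW t0) //.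
    by rewrite ler_pM2l.
  by rewrite lef_pV2 ?posrE // (lt_le_trans den0).
have -> : t * (13 * B * nrm x ^+ 3) / (nrm x * (nrm x / 2)) = 26 * B * t * nrm x.
  by field; rewrite gt_eqF.
by rewrite nx le_eqVlt; apply/orP; left; apply/eqP; ring.
Qed.

(* At the integers [0^-1 = 0] removes the polar parts of both functions, so that the
   period and the duplication formula hold there too. *)
Definition Hdiff (z : C) : C := Eone z - cotz z.

Lemma Hdiff_periodic z : Hdiff (z + 1) = Hdiff z.
Proof. by rewrite /Hdiff Eone_periodic cotz_periodic. Qed.

Lemma Hdiff_double z : Hdiff (z / 2) + Hdiff ((z + 1) / 2) = 2 * Hdiff z.
Proof. by rewrite /Hdiff addrACA -opprD Eone_double cotz_double mulrBr. Qed.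

Lemma Hdiff0 : Hdiff 0 = 0.
Proof.
have /nrm_lim_le := @Eone_has_sum R 0.
rewrite /Hdiff /cotz /qexp mulr0 cexp0 subrr invr0 mulr0 subr0 => H.
apply/eqP; rewrite -nrm_eq0 eq_le nrm_ge0 andbT; apply: (H 0).
apply: nearW => B; rewrite /partial_sum big1 ?nrm0 // => l _.
by rewrite /epair; case: ifP => _; rewrite ?invr0 // sub0r add0r invrN addNr.
Qed.

Lemma Hdiff_cont0 (e : R) : 0 < e -> exists2 d : R, 0 < d &
  forall z, nrm z < d -> nrm (Hdiff z) <= e.
Proof.
move=> e0; have [d d0 [K K0 HK]] := cotz_near0.
have Kp : 0 < 128 + K by lra.
exists (Num.min (1 / 2) (Num.min d (e / (128 + K)))).
  by rewrite !lt_min d0 divr_gt0 //= divr_gt0.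
move=> z; rewrite !lt_min => /and3P[h1 h2 h3].
have [->|z0] := eqVneq z 0; first by rewrite Hdiff0 nrm0 ltW.
have -> : Hdiff z = (Eone z - z^-1) - (cotz z - z^-1) by rewrite /Hdiff; ring.
apply: le_trans (nrmB _ _) _.
apply: le_trans (lerD (Eone_near0 (ltW h1)) (HK z z0 h2)) _.
rewrite -mulrDl; move: h3; rewrite ltr_pdivlMr // mulrC; exact: ltW.
Qed.

(** Off the integers both functions are differentiable; at an integer the continuity at 0 is carried
    over by the period. *)
Lemma Hdiff_cont z (e : R) : 0 < e -> exists2 d : R, 0 < d &
  forall w, nrm (w - z) < d -> nrm (Hdiff w - Hdiff z) <= e.
Proof.
move=> e0; have [zi|] := pselect (not_int z).
  have cz : {for z, continuous Hdiff}.
    apply: differentiable_continuous; apply: fdiffB (cotz_diff zi).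
    exact: analytic_at_diff (hol_cvg_analytic (Eone_hol zi)).
  have /cvg_nrmP/(_ e e0)/near_nrmP[d d0 Hd] := cz.
  by exists d => // w /Hd /ltW.
move=> /existsNP[k /negP/negPn/eqP ->].
have [d d0 Hd] := Hdiff_cont0 e0; exists d => // w /Hd.
rewrite -[w - _]/(w + - _) -mulrNz (periodic_int Hdiff_periodic).
by rewrite -[k%:~R]add0r (periodic_int Hdiff_periodic) Hdiff0 subr0.
Qed.

(* Herglotz: by the duplication formula a maximum of the modulus at w is also attained
   at w / 2, and hence at 0. *)
Lemma Hdiff_eq0 z : Hdiff z = 0.
Proof.
(* The strip of this height is stable under [u / 2] and [(u + 1) / 2], and by periodicity its
   maximum is that of a compact rectangle. *)
pose M := `|cIm z|.
pose A : set (R * R) := [set` `[0, 1]] `*` [set` `[- M, M]].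
pose f (p : R * R) := nrm (Hdiff (cplx p.1 p.2)).
have M0 : 0 <= M by exact: normr_ge0.
have cA : compact A by apply: compact_setX; exact: segment_compact.
have A0 : A !=set0.
  by exists (0, 0); split; rewrite /= in_itv /= ?lexx ?ler01 ?oppr_le0 ?M0.
have cf : {within A, continuous f}.
  apply: continuous_subspaceT => p; apply/cvgrPdist_le => e e0.
  have [d d0 Hd] := Hdiff_cont (cplx p.1 p.2) e0.
  have d2 : 0 < d / 2 by rewrite divr_gt0.
  near=> q.
  rewrite /f; have : nrm (Hdiff (cplx q.1 q.2) - Hdiff (cplx p.1 p.2)) <= e.
    apply: Hd; apply: le_lt_trans (nrm_le_ReIm _) _.
    rewrite cReB cImB !cplx_Re !cplx_Im [ltRHS]splitr; apply: ltrD.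
      rewrite distrC; near: q; apply: cvgr_dist_lt d2; exact: cvg_fst.
    rewrite distrC; near: q; apply: cvgr_dist_lt d2; exact: cvg_snd.
  set a := Hdiff _; set b := Hdiff _ => H.
  have h1 := nrmD (a - b) b; have h2 := nrmB a (a - b).
  rewrite subrK in h1; rewrite opprB addrC subrK in h2.
  by rewrite ler_norml; lra.
have [[x0 y0] + Hmax] := compact_EVT_max A0 cA cf.
rewrite inE => -[/= xI yI].
set w := cplx x0 y0 in Hmax; pose m := nrm (Hdiff w).
have bnd u : `|cIm u| <= M -> nrm (Hdiff u) <= m.
  move=> hu; have [k [/andP[h1 h2] hi]] := floor_period u.
  rewrite -(periodic_int Hdiff_periodic k) [u + _]CE.
  apply: (Hmax (cRe (u + k%:~R), cIm (u + k%:~R))); rewrite inE; split => /=.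
    by rewrite in_itv /= h1 ltW.
  by rewrite in_itv /= hi -ler_norml.
have halfM u : `|cIm u| <= M -> `|cIm (u / 2)| <= M /\ `|cIm ((u + 1) / 2)| <= M.
  have E (v : C) : cIm (v / 2) = cIm v / 2.
    by rewrite -[2%:R : C]ofR_nat -ofRV cImM /= mulr0 add0r.
  have n2 (v : R) : `|v / 2| = `|v| / 2.
    by rewrite normrM [X in _ * X]ger0_norm ?invr_ge0.
  rewrite !E cImD /= addr0 n2 => hu.
  have := normr_ge0 (cIm u); lra.
have eqm n : nrm (Hdiff (w / 2 ^+ n)) = m /\ `|cIm (w / 2 ^+ n)| <= M.
  elim: n => [|n [IH IM]].
    rewrite expr0 divr1; split => //; rewrite /w cplx_Im.
    by move: yI; rewrite in_itv /= -ler_norml.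
  have [hM1 hM2] := halfM _ IM.
  have -> : w / 2 ^+ n.+1 = w / 2 ^+ n / 2 by rewrite exprSr invfM mulrA.
  split => //; apply/eqP; rewrite eq_le bnd //=.
  (* Two numbers of modulus at most [m] whose sum has modulus [2 m] both have modulus [m]. *)
  have := congr1 (@nrm R C) (Hdiff_double (w / 2 ^+ n)).
  rewrite nrmM nrm_nat IH => E.
  have := nrmD (Hdiff (w / 2 ^+ n / 2)) (Hdiff ((w / 2 ^+ n + 1) / 2)).
  have := bnd _ hM2; rewrite E; lra.
have m0 : m <= 0.
  apply/ler_addgt0Pr => e e0; rewrite add0r.
  have [d d0 Hd] := Hdiff_cont0 e0.
  have [n Hn] := pow2_lt (nrm w) d0.
  have [<- _] := eqm n; apply: Hd.
  by rewrite nrmM nrmV nrmX nrm_nat.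
have nz : nrm (Hdiff z) == 0.
  by rewrite eq_le nrm_ge0 andbT; apply: le_trans m0; apply: bnd.
by apply/eqP; rewrite nrm_eq0 in nz.
Unshelve. all: by end_near.
Qed.

Theorem Eone_cotz z : Eone z = cotz z.
Proof. by apply/eqP; rewrite -subr_eq0; apply/eqP; exact: Hdiff_eq0. Qed.

End Herglotz.

(** * Lipschitz' formula *)

Section Lipschitz.
Variable R : realType.
Local Notation C := (Cx R).
Implicit Types (z w : C).

(** The inequality [u <= expR u] at [u = n y / m], raised to the power [m]. *)
Lemma pow_exp_le (m n : nat) (y : R) : (0 < m)%N -> 0 < y ->
  n%:R ^+ m * expR (- (n%:R * y)) <= (m%:R / y) ^+ m.
Proof.
move=> m0 y0; have mp : 0 < m%:R :> R by rewrite ltr0n.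
have E : expR (n%:R * y) = expR (n%:R * y / m%:R) ^+ m.
  by rewrite -expRM_natl; congr expR; field; rewrite gt_eqF.
have le : (n%:R * y / m%:R) ^+ m <= expR (n%:R * y).
  rewrite E lerXn2r ?nnegrE ?expR_ge0 ?divr_ge0 ?mulr_ge0 ?(ltW y0) //.
  by apply: le_trans (expR_ge1Dx _); rewrite lerDr.
rewrite expRN ler_pdivrMr ?expR_gt0 //.
have -> : n%:R ^+ m = (m%:R / y) ^+ m * (n%:R * y / m%:R) ^+ m :> R.
  by rewrite -exprMn; congr (_ ^+ m); field; rewrite !gt_eqF.
by rewrite ler_wpM2l // exprn_ge0 // divr_ge0 // ltW.
Qed.

(** The exponential absorbs the power [j + 2] of [(k + 1) l]: [j] factors dominate [l^j], and the
    two others leave an inverse square. *)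
Lemma exp_wgt (j : nat) (y : R) : 0 < y -> exists2 c : R, 0 <= c &
  forall k l : nat, (0 < l)%N ->
    l%:R ^+ j * expR (- ((k.+1 * l)%:R * y)) <= c * (wgt R k * wgt R l).
Proof.
move=> y0; pose c0 : R := (j.+2%:R / y) ^+ j.+2.
have c00 : 0 <= c0 by rewrite exprn_ge0 // divr_ge0 // ltW.
exists (4 * c0); first by rewrite mulr_ge0.
move=> k l l0; set n := (k.+1 * l)%N.
have n0 : 0 < n%:R :> R by rewrite ltr0n /n muln_gt0.
have l0R : 0 < l%:R :> R by rewrite ltr0n.
have H : n%:R ^+ j.+2 * expR (- (n%:R * y)) <= c0 by exact: pow_exp_le.
have H1 : l%:R ^+ j * expR (- (n%:R * y)) <= c0 * n%:R ^- 2.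
  rewrite ler_pdivlMr ?exprn_gt0 // mulrAC.
  apply: le_trans H; rewrite -[j.+2]addn2 exprD ler_wpM2r ?expR_ge0 //.
  rewrite ler_wpM2r ?exprn_ge0 // lerXn2r ?nnegrE // ler_nat /n.
  exact: leq_pmull.
apply: le_trans H1 _.
have -> : 4 * c0 * (wgt R k * wgt R l) = c0 * (wgt R k * (4 * wgt R l)) by ring.
rewrite ler_wpM2l // /n natrM exprMn invfM.
apply: ler_pM; rewrite ?invr_ge0 ?exprn_ge0 //; first exact: wgt_inv_sqr.
apply: (@le_trans _ _ (4 * l.+1%:R ^- 2)); last first.
  by rewrite ler_pM2l // wgt_inv_sqr.
have -> : 4 * (l.+1%:R : R) ^- 2 = (l.+1%:R / 2) ^- 2.
  have : l.+1%:R != 0 :> R by rewrite pnatr_eq0.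
  by move: (l.+1%:R : R) => x x0; field.
rewrite lef_pV2 ?posrE ?exprn_gt0 ?divr_gt0 //.
rewrite lerXn2r ?nnegrE ?divr_ge0 ?(ltW l0R) //.
have : 1 <= l%:R :> R by rewrite ler1n.
by rewrite -(natr1 l); lra.
Qed.

Lemma nrm_qexp z : nrm (qexp z) = expR (- (2 * pi * cIm z)).
Proof.
rewrite /qexp nrm_cexp; congr expR.
by rewrite /twopii !(cReM, cImM) /=; ring.
Qed.

Lemma nrm_qexpX z n : nrm (qexp z ^+ n) = expR (- (n%:R * (2 * pi * cIm z))).
Proof. by rewrite nrmX nrm_qexp -expRM_natl mulrN. Qed.

(** Since [0 ^+ 0 = 1], the index [l = 0] contributes 1 for [j = 0], completing the geometric
    series, and 0 for [j > 0]. *)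
Definition qpow (j l : nat) z : C := l%:R ^+ j * qexp z ^+ l.

Lemma qpow_wgt j (y : R) : 0 < y -> exists2 c : R, 0 <= c &
  forall l z, y <= cIm z -> nrm (qpow j l z) <= c * wgt R l.
Proof.
move=> y0; have py : 0 < 2 * pi * y by rewrite !mulr_gt0 ?pi_gt0.
have [c c0 H] := exp_wgt j py.
exists (c + 1) => [|l z hz]; first by lra.
have w0 := wgt_gt0 R.
rewrite /qpow nrmM nrmX nrm_nat nrm_qexpX.
case: l => [|l].
  rewrite mul0r oppr0 expR0 mulr1.
  have wg0 : wgt R 0 = 1 by rewrite /wgt sqrtr1 expr1n invr1.
  rewrite wg0 mulr1 (@le_trans _ _ 1) ?lerDr // expr0n.
  by case: (j == 0%N).
have wg0 : wgt R 0 = 1 by rewrite /wgt sqrtr1 expr1n invr1.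
apply: (@le_trans _ _ (l.+1%:R ^+ j * expR (- ((1 * l.+1)%:R * (2 * pi * y))))).
  rewrite ler_wpM2l ?exprn_ge0 // ler_expR lerN2 mul1n ler_wpM2l //.
  by rewrite ler_wpM2l // mulr_ge0 // pi_ge0.
apply: le_trans (H 0%N l.+1 _) _ => //.
by rewrite wg0 mul1r ler_wpM2r ?(ltW (w0 _)) // lerDl.
Qed.

Lemma qpow_abs j z : 0 < cIm z -> exists K, abs_bound (fun l => qpow j l z) K.
Proof.
move=> hz; have [c c0 H] := qpow_wgt j hz.
by exists (c * 4); apply: abs_bound_wgt => // l; exact: H.
Qed.

Lemma geometric_usum z : 0 < cIm z ->
  (1 - qexp z) * usum (fun l => qpow 0 l z) = 1.
Proof.
move=> hz; have [K HK] := qpow_abs 0 hz.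
have Hs := series_cvg (abs_has_sum HK).
set S := usum _ in Hs *.
have H1 : (fun N => series (fun l => qpow 0 l z) N.+1) @ \oo --> S.
  by rewrite cvg_shiftS.
have H2 : (fun N => series (fun l => qpow 0 l z) N.+1) @ \oo --> 1 + qexp z * S.
  rewrite (_ : (fun N => _) = fun N => 1 + qexp z * series (fun l => qpow 0 l z) N).
    by apply: cvgD; [exact: cvg_cst | exact: cvgMr].
  apply/funext => N; rewrite /series /= big_nat_recl // mulr_sumr.
  congr (_ + _); first by rewrite /qpow !expr0 mulr1.
  by apply: eq_bigr => l _; rewrite /qpow !expr0 !mul1r exprS.
have E := cvgC_unique H1 H2.
by rewrite mulrBl mul1r {1}E addrK.
Qed.

Lemma Eone_qexp z : 0 < cIm z ->
  Eone z = twopii R / 2 - twopii R * usum (fun l => qpow 0 l z).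
Proof.
move=> hz; rewrite Eone_cotz /cotz.
have G := geometric_usum hz.
have q1 : 1 - qexp z != 0.
  by apply: contra_eq_neq G => ->; rewrite mul0r eq_sym oner_eq0.
have q2 : qexp z - 1 != 0 by rewrite -opprB oppr_eq0.
have -> : usum (fun l => qpow 0 l z) = (1 - qexp z)^-1.
  by apply: (mulfI q1); rewrite G divff.
by field; rewrite q1 q2.
Qed.

Lemma not_int_Im z : 0 < cIm z -> not_int z.
Proof.
move=> hz k; apply: contraTneq hz => ->.
by rewrite -ofR_int /= ltxx.
Qed.

Lemma near_Im z (y : R) : y < cIm z -> \forall x \near z, y < cIm x.
Proof.
move=> hy; apply/near_nrmP; exists (cIm z - y); first by rewrite subr_gt0.
move=> x hx; have := le_lt_trans (nrm_Im (x - z)) hx.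
by rewrite cImB ltr_norml => /andP[]; lra.
Qed.

Let t := twopii R.

Lemma Eone_hol_sym z : not_int z ->
  hol_cvg \oo (fun N (x : C) => \sum_(k <- sym_fset N) (x - k%:~R)^-1) (@Eone R) z.
Proof.
move=> zi; have -> : (fun N (x : C) => \sum_(k <- sym_fset N) (x - k%:~R : C)^-1) =
    (fun N x => partial_sum (fun l => epair l x) (nat_fset N.+1)).
  by apply/funext => N; apply/funext => x; rewrite partial_epair.
apply: (hol_cvg_comp (g := fun N => nat_fset N.+1)) (Eone_hol zi).
exact: exhaust_cvg near_nat_fsetS.
Qed.

Lemma Eone_hol_q z : 0 < cIm z ->
  hol_cvg \oo (fun N x => t / 2 - t * \sum_(0 <= l < N) qpow 0 l x) (@Eone R) z.
Proof.
move=> hz; have y0 : 0 < cIm z / 2 by rewrite divr_gt0.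
have [c c0 H] := qpow_wgt 0 y0.
have im x : nrm (x - z) < cIm z / 2 -> cIm z / 2 <= cIm x.
  move=> hx; have := le_lt_trans (nrm_Im (x - z)) hx.
  by rewrite cImB ltr_norml => /andP[]; lra.
exists (cIm z / 2), (nrm (t / 2) + nrm t * (c * 4)); split => //.
  apply: nearW => N x hx; split.
    apply: fdiffB; first exact: fdiff_cst.
    apply: fdiffMl; apply: fdiff_sum => l _; apply: fdiffMl; apply: fdiffX.
    exact: (cder_qexp x).1.
  apply: le_trans (nrmB _ _) _; rewrite lerD2l nrmM ler_wpM2l ?nrm_ge0 //.
  apply: le_trans (nrm_sum _ _ _) _.
  apply: (@le_trans _ _ (\sum_(0 <= l < N) c * wgt R l)).
    by apply: ler_sum => l _; apply: H; exact: im.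
  by rewrite -mulr_sumr ler_wpM2l // wgt_sum_nat.
move=> x hx; have hx0 : 0 < cIm x by apply: lt_le_trans (im x hx).
rewrite (Eone_qexp hx0); apply: cvgB; first exact: cvg_cst.
apply: cvgMr; have [K HK] := qpow_abs 0 hx0.
exact: series_cvg (abs_has_sum HK).
Qed.

Lemma sym_pow_D j z N : not_int z ->
  iter j (fun F : C -> C => 'D_1 F) (fun x : C => \sum_(k <- sym_fset N) (x - k%:~R)^-1) z
  = (-1) ^+ j * (j`!)%:R * \sum_(k <- sym_fset N) (z - k%:~R) ^- j.+1.
Proof.
pose g j (x : C) := (-1) ^+ j * (j`!)%:R * \sum_(k <- sym_fset N) (x - k%:~R) ^- j.+1.
pose U := [set z : C | forall k, k \in sym_fset N -> z != k%:~R].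
move=> zi; apply: (@iter_D_on R U _ g) => //.
- move=> x Ux; rewrite /U /=.
  have : forall s : seq int, {subset s <= sym_fset N} ->
      \forall y \near x, forall k, k \in s -> y != k%:~R.
    elim=> [|i s IH] hs; first by apply/near_nrmP; exists 1 => // y _ k; rewrite in_nil.
    have xi : x != i%:~R by apply: Ux; apply: hs; rewrite inE eqxx.
    have h1 : \forall y \near x, y != i%:~R.
      apply/near_nrmP; exists (nrm (x - i%:~R)); first by rewrite nrm_gt0 subr_eq0.
      by move=> y h; apply/eqP => yi; move: h; rewrite yi nrmC ltxx.
    have h2 : {subset s <= sym_fset N} by move=> k ks; apply: hs; rewrite inE ks orbT.
    apply: filterS2 h1 (IH h2) => y y1 y2 k; rewrite inE => /orP[/eqP ->//|].
    exact: y2.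
  by move=> /(_ (sym_fset N)); apply.
- by move=> x Ux; rewrite /g expr0 fact0 !mul1r; apply: eq_bigr => k _; rewrite expr1.
- move=> i x Ux; rewrite /g.
  have -> : (-1) ^+ i.+1 * (i.+1`!)%:R * \sum_(k <- sym_fset N) (x - k%:~R) ^- i.+2 =
    (-1) ^+ i * (i`!)%:R * \sum_(k <- sym_fset N) (- (i.+1%:R * (x - k%:~R) ^- i.+2)).
    by rewrite exprS factS natrM sumrN -mulr_sumr; ring.
  apply: cder_Ml; rewrite big_seq.
  under eq_fun do rewrite big_seq.
  have : forall s : seq int, {subset s <= sym_fset N} ->
    cder (fun y : C => \sum_(k <- s | k \in s) (y - k%:~R) ^- i.+1) x
     (\sum_(k <- s | k \in s) - (i.+1%:R * (x - k%:~R) ^- i.+2)).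
    move=> s hs; rewrite -big_seq; under eq_fun do rewrite -big_seq.
    elim: s hs => [|k s IH] hs.
      by rewrite big_nil; under eq_fun do rewrite big_nil; exact: cder_cst.
    rewrite big_cons; under eq_fun do rewrite big_cons.
    apply: cder_D2; last by apply: IH => k' hk; apply: hs; rewrite inE hk orbT.
    have xk : x - k%:~R != 0 by rewrite subr_eq0; apply: Ux; apply: hs; rewrite inE eqxx.
    have h1 : cder (fun y : C => y - k%:~R) x 1.
      by have := cder_B (cder_id x) (cder_cst (k%:~R : C) x); rewrite subr0.
    have h2 := cder_X i (cder_comp h1 (cder_inv xk)).
    have := h2; under eq_fun do rewrite exprVn.
    rewrite (_ : _ * _ = - (i.+1%:R * (x - k%:~R) ^- i.+2)) //.
    rewrite mulr1 exprVn -[i.+2]addn2 exprD (invfM (_ ^+ i)); ring.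
  by move=> /(_ (sym_fset N)); apply.
Qed.

Lemma qseries_D j z N :
  iter j (fun F : C -> C => 'D_1 F)
    (fun x => t / 2 - t * \sum_(0 <= l < N) qpow 0 l x) z
  = (if j == 0%N then t / 2 else 0) - t ^+ j.+1 * \sum_(0 <= l < N) qpow j l z.
Proof.
pose g j (x : C) := (if j == 0%N then t / 2 else 0) -
  t ^+ j.+1 * \sum_(0 <= l < N) qpow j l x.
apply: (@iter_D_on R setT _ g) => // [x _|i x _]; first exact: filterT.
rewrite /g /= -[X in cder _ _ X]/(0 - _); apply: cder_B; first exact: cder_cst.
rewrite (exprSr t i.+1) -mulrA; apply: cder_Ml; rewrite mulr_sumr.
apply: cder_sum => l; case: l => [|l].
  rewrite /qpow exprS mul0r mul0r mulr0.
  by under eq_fun do rewrite expr0; exact: cder_cst.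
have := cder_Ml (l.+1%:R ^+ i : C) (cder_X l (cder_qexp x)).
rewrite (_ : _ * _ = t * qpow i.+1 l.+1 x) //.
by rewrite /qpow /t !exprS; ring.
Qed.

Lemma cvgC_Ml (u : nat -> C) (a l : C) :
  u @ \oo --> l -> (fun n => a * u n) @ \oo --> a * l.
Proof. exact: cvgMr. Qed.

(** On the upper half plane [Eone] is the limit both of partial fractions and of a series in q. Both
    are differentiated [j] times, and the limits agree. *)
Theorem Lipschitz_formula j z : (0 < j)%N -> 0 < cIm z ->
  (fun N => \sum_(k <- sym_fset N) (z - k%:~R) ^- j.+1) @ \oo -->
  (-1) ^+ j.+1 * t ^+ j.+1 / (j`!)%:R * usum (fun l => qpow j l z).
Proof.
move=> j0 hz.
have zi := not_int_Im hz.
have H1 := hol_cvg_cvg (hol_cvg_iterD (FF := eventually_filter) j (Eone_hol_sym zi)).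
have H2 := hol_cvg_cvg (hol_cvg_iterD (FF := eventually_filter) j (Eone_hol_q hz)).
set L := iter j _ _ z in H1 H2.
have [K HK] := qpow_abs j hz.
have H3 : (fun N => iter j (fun F : C -> C => 'D_1 F)
    (fun x => t / 2 - t * \sum_(0 <= l < N) qpow 0 l x) z) @ \oo -->
    - (t ^+ j.+1 * usum (fun l => qpow j l z)).
  under eq_fun do rewrite qseries_D (gtn_eqF j0) sub0r.
  apply: cvgN; apply: cvgMr; exact: series_cvg (abs_has_sum HK).
have EL := cvgC_unique H2 H3.
have f0 : (j`!)%:R != 0 :> C by rewrite pnatr_eq0 -lt0n fact_gt0.
have := cvgC_Ml (a := (-1) ^+ j / (j`!)%:R) H1.
rewrite EL.
have -> : (-1) ^+ j / (j`!)%:R * - (t ^+ j.+1 * usum (fun l => qpow j l z)) =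
  (-1) ^+ j.+1 * t ^+ j.+1 / (j`!)%:R * usum (fun l => qpow j l z).
  by rewrite (exprS (-1)); ring.
rewrite (_ : (fun N => _) = fun N => \sum_(k <- sym_fset N) (z - k%:~R) ^- j.+1) //.
apply/funext => N; rewrite sym_pow_D //.
have s2 : (-1) ^+ j * (-1) ^+ j = 1 :> C by rewrite -expr2 sqrr_sign.
have -> : (-1) ^+ j / (j`!)%:R * ((-1) ^+ j * (j`!)%:R *
   \sum_(k <- sym_fset N) (z - k%:~R) ^- j.+1) =
   ((-1) ^+ j * (-1) ^+ j) * \sum_(k <- sym_fset N) (z - k%:~R) ^- j.+1.
  by field.
by rewrite s2 mul1r.
Qed.

End Lipschitz.

(** * Lattice sums and modular transformations *)

Section Lattice.
Variable R : realType.
Local Notation C := (Cx R).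
Implicit Types (z tau : C) (kl : int * int).

Definition lat tau kl : C := kl.1%:~R * tau + kl.2%:~R.

(* The summand at the origin is [z^-1], because [0^-1 = 0]. *)
Definition zterm tau z kl : C :=
  (z - lat tau kl)^-1 + (lat tau kl)^-1 + z / lat tau kl ^+ 2.

Definition box kl : nat := maxn `|kl.1| `|kl.2|.

Lemma nrm_absz (k : int) : nrm (k%:~R : C) = (`|k|%N)%:R.
Proof. by rewrite nrm_int pmulrn abszE -intr_norm. Qed.

(** The imaginary part of the lattice point controls [k], and then the triangle inequality controls
    [l]. The constant serves a neighbourhood of [tau0], as analyticity in tau requires. *)
Lemma lat_ge (tau0 : C) : 0 < cIm tau0 -> exists c r : R, [/\ 0 < c, 0 < r &
  forall tau, nrm (tau - tau0) < r -> 0 < cIm tau /\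
    forall kl, c * (box kl)%:R <= nrm (lat tau kl)].
Proof.
move=> h0; pose y := cIm tau0 / 2; have y0 : 0 < y by rewrite divr_gt0.
pose T := nrm tau0 + y; have T0 : 0 <= T by rewrite addr_ge0 ?nrm_ge0 ?ltW.
pose c := Num.min y (1 + T / y)^-1.
have T1 : 0 < 1 + T / y by rewrite ltr_pwDl // divr_ge0 // ltW.
have c0 : 0 < c by rewrite lt_min y0 invr_gt0.
exists c, y; split=> // tau ht.
have im : y <= cIm tau.
  have := le_lt_trans (nrm_Im _) ht.
  by rewrite cImB ltr_norml => /andP[]; rewrite /y; lra.
have hT : nrm tau <= T.
  by rewrite -(subrK tau0 tau) (le_trans (nrmD _ _)) // /T addrC lerD2l ltW.
split; first by apply: lt_le_trans im.
case=> k l; rewrite /lat /=; set a := _ + _.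
have hk : y * (`|k|%N)%:R <= nrm a.
  apply: le_trans (nrm_Im a); rewrite /a cImD cImM -!ofR_int /= mul0r !addr0.
  rewrite normrM -nrm_ofR ofR_int nrm_absz mulrC ler_wpM2l // ler_normr.
  by rewrite im.
have hl : (1 + T / y)^-1 * (`|l|%N)%:R <= nrm a.
  rewrite mulrC ler_pdivrMr //.
  have : nrm (l%:~R : C) <= nrm a + nrm (k%:~R * tau).
    have -> : l%:~R = a - k%:~R * tau by rewrite /a addrC addKr.
    exact: nrmB.
  rewrite nrmM !nrm_absz => h; apply: le_trans h _.
  have hk' : (`|k|%N)%:R <= nrm a / y by rewrite ler_pdivlMr // mulrC.
  have -> : nrm a * (1 + T / y) = nrm a + nrm a / y * T by ring.
  by rewrite lerD2l ler_pM // nrm_ge0.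
rewrite /box /=; have [kl|lk] := leqP `|k| `|l|.
  by apply: le_trans hl; rewrite ler_wpM2r // /c ge_min lexx orbT.
by apply: le_trans hk; rewrite ler_wpM2r // /c ge_min lexx.
Qed.

Definition big_box (n : nat) : {fset int * int} := (sym_fset n `*` sym_fset n)%fset.

Lemma in_big_box n kl : (kl \in big_box n) = (box kl <= n)%N.
Proof. by rewrite in_fsetM !in_sym_fset /box geq_max. Qed.

Definition wbox kl : R := wgt R `|kl.1|%N * wgt R `|kl.2|%N.

Lemma wbox_ge0 kl : 0 <= wbox kl.
Proof. by rewrite mulr_ge0 // ltW // wgt_gt0. Qed.

Lemma wbox_sum (B : {fset int * int}) : \sum_(kl <- B) wbox kl <= 64.
Proof.
have -> : 64 = 8 * 8 :> R by ring.
apply: (@wgt_sum_pair R int int (fun k => wgt R `|k|%N) (fun k => wgt R `|k|%N)).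
- by move=> k; rewrite ltW // wgt_gt0.
- by move=> k; rewrite ltW // wgt_gt0.
- exact: wgt_sum_int.
- exact: wgt_sum_int.
Qed.

Lemma wbox_cube kl : (0 < box kl)%N -> ((box kl)%:R : R) ^- 3 <= 8 * wbox kl.
Proof.
move=> b0; have b0R : 0 < (box kl)%:R :> R by rewrite ltr0n.
apply: (@le_trans _ _ (8 * ((box kl).+1%:R ^- 3))); last first.
  by rewrite ler_pM2l //; apply: wgt_inv_cube; rewrite /box ltnS ?leq_maxl ?leq_maxr.
have -> : 8 * ((box kl).+1%:R : R) ^- 3 = ((box kl).+1%:R / 2) ^- 3.
  have : (box kl).+1%:R != 0 :> R by rewrite pnatr_eq0.
  by move: ((box kl).+1%:R : R) => x x0; field.
rewrite lef_pV2 ?posrE ?exprn_gt0 ?divr_gt0 //.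
rewrite lerXn2r ?nnegrE ?divr_ge0 ?(ltW b0R) //.
have : 1 <= (box kl)%:R :> R by rewrite ler1n.
by rewrite -(natr1 (box kl)); lra.
Qed.

(** The three summands combine to [z^2 / (a^2 (z - a))], which decays like a cube. In the constant
    16, a factor 2 comes from [nrm (z - a) >= nrm a / 2] and 8 from [wbox_cube]. *)
Lemma zterm_le (c rho : R) tau z kl : 0 < c -> 0 < rho -> nrm z <= rho ->
  c * (box kl)%:R <= nrm (lat tau kl) -> 2 * rho <= c * (box kl)%:R ->
  [/\ z - lat tau kl != 0, lat tau kl != 0 &
      nrm (zterm tau z kl) <= 16 * rho ^+ 2 / c ^+ 3 * wbox kl].
Proof.
move=> c0 r0 hz ha hb; set a := lat tau kl in ha *.
have a0 : 0 < nrm a by lra.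
have za : nrm a / 2 <= nrm (z - a).
  by have := nrmB z (z - a); rewrite opprB addrC subrK; lra.
have an : a != 0 by rewrite -nrm_gt0.
have zan : z - a != 0 by rewrite -nrm_gt0; lra.
split=> //.
have -> : zterm tau z kl = z ^+ 2 / (a ^+ 2 * (z - a)).
  by rewrite /zterm -/a; field; rewrite an zan.
rewrite nrmM nrmV (nrmM (a ^+ 2)) !nrmX.
have b0 : 0 < c * (box kl)%:R by lra.
have b0' : (0 < box kl)%N by move: b0; rewrite pmulr_rgt0 // ltr0n.
have wc := wbox_cube b0'.
have bb : 0 < (box kl)%:R :> R by rewrite ltr0n.
set b : R := (box kl)%:R in ha hb b0 wc bb *.
apply: (@le_trans _ _ (rho ^+ 2 * ((c * b) ^+ 2 * (c * b / 2))^-1)).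
  apply: ler_pM; rewrite ?invr_ge0 ?mulr_ge0 ?exprn_ge0 ?nrm_ge0 //.
    by rewrite lerXn2r ?nnegrE ?nrm_ge0 ?(ltW r0).
  rewrite lef_pV2 ?posrE ?mulr_gt0 ?exprn_gt0 ?divr_gt0 //; last by lra.
  apply: ler_pM; rewrite ?exprn_ge0 ?divr_ge0 ?(ltW b0) //.
    by rewrite lerXn2r ?nnegrE ?(ltW b0) ?(ltW a0).
  by apply: le_trans za; lra.
have -> : rho ^+ 2 * ((c * b) ^+ 2 * (c * b / 2))^-1 =
    2 * rho ^+ 2 / c ^+ 3 * b ^- 3.
  by field; rewrite !gt_eqF.
have -> : 16 * rho ^+ 2 / c ^+ 3 * wbox kl = 2 * rho ^+ 2 / c ^+ 3 * (8 * wbox kl).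
  by ring.
rewrite ler_wpM2l // divr_ge0 ?exprn_ge0 ?(ltW c0) //.
by rewrite mulr_ge0 // exprn_ge0 // ltW.
Qed.

Lemma zterm_abs tau z : 0 < cIm tau -> exists K, abs_bound (zterm tau z) K.
Proof.
move=> /lat_ge[c [r [c0 r0 H]]].
have /H[_ Hl] : nrm (tau - tau) < r by rewrite subrr nrm0.
pose rho := nrm z + 1; have rho0 : 0 < rho by rewrite ltr_wpDl // nrm_ge0.
have zr : nrm z <= rho by rewrite lerDl.
have k0 : 0 <= 16 * rho ^+ 2 / c ^+ 3.
  apply: divr_ge0; last by apply: exprn_ge0; exact: ltW.
  by apply: mulr_ge0 => //; apply: exprn_ge0; exact: ltW.
apply: (@abs_bound_tail R _ _ (fun kl => 16 * rho ^+ 2 / c ^+ 3 * wbox kl)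
  (16 * rho ^+ 2 / c ^+ 3 * 64) (big_box (nbound (2 * rho / c)))).
- by move=> kl; rewrite mulr_ge0 // wbox_ge0.
- by move=> B; rewrite -mulr_sumr ler_wpM2l // wbox_sum.
move=> kl; rewrite in_big_box -ltnNge => hb.
have [] // := zterm_le c0 rho0 zr (Hl kl).
rewrite [leRHS]mulrC -ler_pdivrMr //; apply: ltW; apply: lt_trans (nboundP _) _.
by rewrite ltr_nat.
Qed.

Lemma has_sum_single (I : choiceType) (i0 : I) (c : C) :
  has_sum (fun i => if i == i0 then c else 0) c.
Proof.
apply/has_sumP => e e0; exists [fset i0]%fset => B /fsubsetP HB.
have iB : i0 \in B by apply: HB; rewrite inE.
rewrite /partial_sum (big_fsetD1 i0) //= eqxx big_seq big1 => [|i].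
  by rewrite addr0 subrr nrm0.
by rewrite !inE => /andP[/negbTE -> _].
Qed.

(** The definition singles out the origin, while [zterm] includes it; the two families differ at
    this one index. *)
Lemma lattice_zeta_sum tau z : 0 < cIm tau ->
  has_sum (zterm tau z) (lattice_zeta tau z).
Proof.
move=> ht; have [K HK] := zterm_abs z ht.
have H := abs_has_sum HK.
have H0 : has_sum (fun kl : int * int => if kl == (0, 0) then z^-1 else 0) z^-1.
  exact: has_sum_single.
have := has_sumD H (has_sumN H0).
set f := (fun kl => _ + _) => Hf.
have Ef : f = (fun kl : int * int => if kl == (0, 0) then 0
    else let a := kl.1%:~R * tau + kl.2%:~R in
      (z - a)^-1 + a^-1 + z / a ^+ 2).
  apply/funext => kl; rewrite /f; case: eqP => [->|_]; last by rewrite subr0.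
  rewrite /zterm /lat /= mul0r addr0 subr0 invr0 expr0n /= invr0 mulr0 !addr0.
  exact: subrr.
have -> : lattice_zeta tau z = usum (zterm tau z).
  by rewrite /lattice_zeta -Ef (has_sum_usum Hf) addrC subrK.
exact: H.
Qed.

(** For [s > 0] the origin contributes 0, by [0^-1 = 0]. *)
Definition gterm (s : nat) tau kl : C := lat tau kl ^- s.

Lemma gterm_abs s tau : (2 < s)%N -> 0 < cIm tau -> exists K, abs_bound (gterm s tau) K.
Proof.
move=> s2 /lat_ge[c [r [c0 r0 H]]].
have /H[_ Hl] : nrm (tau - tau) < r by rewrite subrr nrm0.
have cs : 0 < c ^- s by rewrite invr_gt0 exprn_gt0.
apply: (@abs_bound_tail R _ _ (fun kl => c ^- s * (8 * wbox kl)) (c ^- s * (8 * 64)) (big_box 0)).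
- move=> kl; apply: mulr_ge0; first exact: ltW.
  by apply: mulr_ge0 => //; exact: wbox_ge0.
- by move=> B; rewrite -!mulr_sumr ler_wpM2l ?(ltW cs) // ler_pM2l // wbox_sum.
move=> kl; rewrite in_big_box -ltnNge => b0.
have b0R : 1 <= (box kl)%:R :> R by rewrite ler1n.
rewrite /gterm nrmV nrmX.
have cb : 0 < c * (box kl)%:R by rewrite mulr_gt0 //; lra.
apply: (@le_trans _ _ ((c * (box kl)%:R) ^- s)).
  rewrite lef_pV2 ?posrE ?exprn_gt0 //; last by apply: lt_le_trans (Hl kl).
  by rewrite lerXn2r ?nnegrE ?nrm_ge0 ?(ltW cb).
rewrite exprMn invfM ler_pM2l //; apply: le_trans (wbox_cube b0).
rewrite lef_pV2 ?posrE ?exprn_gt0 //; [|lra|lra].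
by rewrite ler_weXn2l.
Qed.

End Lattice.

Lemma det_mx2 (K : comPzRingType) (A : 'M[K]_2) : \det A = A 0 0 * A 1 1 - A 0 1 * A 1 0.
Proof.
rewrite (expand_det_row _ 0) big_ord_recl big_ord1 /cofactor !det_mx11 !mxE /=.
have l00 : lift 0 0 = 1 :> 'I_2 by apply/val_inj.
have l10 : lift 1 0 = 0 :> 'I_2 by apply/val_inj.
by rewrite !l00 l10 expr0 expr1 mul1r mulN1r mulrN.
Qed.

(** * The action of SL(2, Z) on lattice sums *)

Section Covariance.
Variable R : realType.
Local Notation C := (Cx R).
Variables (g : 'M[int]_2) (hg : \det g = 1).
Implicit Types (z tau : C).

Definition mobius tau : C := ((g 0 0)%:~R * tau + (g 0 1)%:~R) / autom g tau.

Lemma det2 : g 0 0 * g 1 1 - g 0 1 * g 1 0 = 1.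
Proof. by rewrite -det_mx2. Qed.

Lemma autom_neq0 tau : 0 < cIm tau -> autom g tau != 0.
Proof.
move=> ht; apply/eqP => E; have D := det2.
have := congr1 (@cIm R) E; rewrite /autom cImD cImM -!ofR_int /= mul0r !addr0.
move=> /eqP; rewrite mulf_eq0 (gt_eqF ht) orbF intr_eq0 => /eqP g10.
move: E; rewrite /autom g10 mul0r add0r => /eqP; rewrite intr_eq0 => /eqP g11.
by move: D; rewrite g10 g11 !mulr0 subr0.
Qed.

(** Solves the two real equations contained in [mobius tau * autom g tau = alpha tau + beta]; the
    determinant enters at the end. *)
Lemma mobius_Im tau : 0 < cIm tau ->
  cIm (mobius tau) = cIm tau / nrm (autom g tau) ^+ 2.
Proof.
move=> ht; have J0 := autom_neq0 ht.
have nJ : nrm (autom g tau) ^+ 2 != 0.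
  by rewrite expf_neq0 // nrm_eq0.
have E : mobius tau * autom g tau = (g 0 0)%:~R * tau + (g 0 1)%:~R.
  by rewrite /mobius mulfVK.
move: nJ E; rewrite nrm_sqr; move: (mobius tau) => M nJ E; move: nJ.
have D : (g 0 0)%:~R * (g 1 1)%:~R - (g 0 1)%:~R * (g 1 0)%:~R = 1 :> R.
  by rewrite -!intrM -rmorphB /= det2.
have := congr1 (@cRe R) E; have := congr1 (@cIm R) E.
rewrite /autom !(cReD, cImD, cReM, cImM) -!ofR_int /= !mul0r !subr0 !addr0.
set A : R := (g 0 0)%:~R in D *; set B : R := (g 0 1)%:~R in D *.
set c : R := (g 1 0)%:~R in D *; set d : R := (g 1 1)%:~R in D *.
set x := cRe tau; set y := cIm tau; set u := cRe M; set v := cIm M.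
move=> E1 E2 n0.
apply: (mulIf n0); rewrite mulfVK //.
have e1 : v * (c * x + d) = A * y - u * (c * y) by lra.
have e2 : u * (c * x + d) = A * x + B + v * (c * y) by lra.
have -> : v * ((c * x + d) ^+ 2 + (c * y) ^+ 2) =
  (v * (c * x + d)) * (c * x + d) + v * (c * y) * (c * y) by ring.
rewrite e1.
have -> : (A * y - u * (c * y)) * (c * x + d) + v * (c * y) * (c * y) =
  A * y * (c * x + d) - (c * y) * (u * (c * x + d)) + v * (c * y) * (c * y) by ring.
rewrite e2 -[RHS]mulr1 -D; ring.
Qed.

Lemma mobius_H tau : 0 < cIm tau -> 0 < cIm (mobius tau).
Proof.
move=> ht; rewrite mobius_Im // divr_gt0 // exprn_gt0 // nrm_gt0.
exact: autom_neq0.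
Qed.

(** The row vector (k, l) times [g]: multiplied by gamma tau + delta, the point k, l of the lattice
    of [mobius tau] is this point of the lattice of tau. *)
Definition lat_map (kl : int * int) : int * int :=
  (kl.1 * g 0 0 + kl.2 * g 1 0, kl.1 * g 0 1 + kl.2 * g 1 1).

Definition lat_inv (kl : int * int) : int * int :=
  (kl.1 * g 1 1 - kl.2 * g 1 0, kl.2 * g 0 0 - kl.1 * g 0 1).

Lemma lat_mapK : cancel lat_map lat_inv.
Proof.
move=> [k l]; rewrite /lat_map /lat_inv /=; congr (_, _).
  by rewrite -[RHS]mulr1 -det2; ring.
by rewrite -[RHS]mulr1 -det2; ring.
Qed.

Lemma lat_invK : cancel lat_inv lat_map.
Proof.
move=> [k l]; rewrite /lat_map /lat_inv /=; congr (_, _).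
  by rewrite -[RHS]mulr1 -det2; ring.
by rewrite -[RHS]mulr1 -det2; ring.
Qed.

Lemma lat_mobius tau kl : 0 < cIm tau ->
  lat (mobius tau) kl = lat tau (lat_map kl) / autom g tau.
Proof.
move=> ht; have J0 := autom_neq0 ht.
apply: (mulIf J0); rewrite mulfVK // /lat mulrDl -[_ * mobius tau * _]mulrA.
rewrite [mobius tau * _]mulfVK // /autom /= !intrD !intrM; ring.
Qed.

Lemma zterm_mobius tau z kl : 0 < cIm tau ->
  zterm (mobius tau) (z / autom g tau) kl = autom g tau * zterm tau z (lat_map kl).
Proof.
move=> ht; have J0 := autom_neq0 ht.
rewrite /zterm lat_mobius //; move: (lat tau _) (autom g tau) J0 => a J J0.
have -> : (z / J - a / J)^-1 = J * (z - a)^-1 by rewrite -mulrBl invfM invrK mulrC.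
have -> : (a / J)^-1 = J * a^-1 by rewrite invfM invrK mulrC.
have -> : z / J / (a / J) ^+ 2 = J * (z / a ^+ 2).
  rewrite exprMn (invfM (a ^+ 2)) exprVn invrK.
  by move: (a ^+ 2)^-1 => b; field.
ring.
Qed.

Theorem lattice_zeta_mobius tau z : 0 < cIm tau ->
  lattice_zeta (mobius tau) (z / autom g tau) = autom g tau * lattice_zeta tau z.
Proof.
move=> ht.
apply: has_sum_unique (@lattice_zeta_sum R _ (z / autom g tau) (mobius_H ht)) _.
have H := has_sumZ (a := autom g tau)
  (has_sum_bij lat_mapK lat_invK (@lattice_zeta_sum R tau z ht)).
rewrite (_ : zterm _ _ = fun kl => autom g tau * (zterm tau z \o lat_map) kl) //.
by apply/funext => kl; rewrite zterm_mobius.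
Qed.

Lemma gterm_mobius s tau : (2 < s)%N -> 0 < cIm tau ->
  usum (gterm s (mobius tau)) = autom g tau ^+ s * usum (gterm s tau).
Proof.
move=> s2 ht; apply: has_sum_usum.
have [K HK] := gterm_abs s2 ht.
have H := has_sumZ (a := autom g tau ^+ s) (has_sum_bij lat_mapK lat_invK (abs_has_sum HK)).
rewrite (_ : gterm _ _ = fun kl => autom g tau ^+ s * (gterm s tau \o lat_map) kl) //.
apply/funext => kl; rewrite /gterm /= lat_mobius // exprMn exprVn invfM invrK.
exact: mulrC.
Qed.

End Covariance.

Section Products.
Variable R : realType.
Local Notation C := (Cx R).
Variables X Y : normedModType C.

Lemma nrm_fst (p : X * Y) : nrm p.1 <= nrm p.
Proof. by rewrite -ofR_le -!normE prod_normE num_le_max lexx. Qed.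

Lemma nrm_snd (p : X * Y) : nrm p.2 <= nrm p.
Proof. by rewrite -ofR_le -!normE prod_normE num_le_max lexx orbT. Qed.

Lemma fdiff_fst (p : X * Y) :
  differentiable (fun q : X * Y => q.1) p /\
  'd (fun q : X * Y => q.1) p = fst :> (X * Y -> X).
Proof.
apply: (@differentiable_intro _ _ _ _ _ _ 1) => [c a b|h|e e0].
- by [].
- by rewrite mul1r nrm_fst.
exists 1 => // h _.
have -> : (p + h).1 - p.1 - h.1 = 0.
  by rewrite -[(p + h).1]/(p.1 + h.1) (addrC p.1) addrK subrr.
by rewrite nrm0 mulr_ge0 ?nrm_ge0 // ltW.
Qed.

Lemma fdiff_snd (p : X * Y) :
  differentiable (fun q : X * Y => q.2) p /\
  'd (fun q : X * Y => q.2) p = snd :> (X * Y -> Y).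
Proof.
apply: (@differentiable_intro _ _ _ _ _ _ 1) => [c a b|h|e e0].
- by [].
- by rewrite mul1r nrm_snd.
exists 1 => // h _.
have -> : (p + h).2 - p.2 - h.2 = 0.
  by rewrite -[(p + h).2]/(p.2 + h.2) (addrC p.2) addrK subrr.
by rewrite nrm0 mulr_ge0 ?nrm_ge0 // ltW.
Qed.

End Products.

(** * Joint analyticity of the zeta function *)

Section LatticeZetaAnalytic.
Variable R : realType.
Local Notation C := (Cx R).

Definition off_lattice (z tau : C) : Prop := forall kl, z != lat tau kl.

Lemma fdiff_lat kl (p : C * C) : differentiable (fun q : C * C => lat q.2 kl) p.
Proof.
apply: fdiffD; last exact: fdiff_cst.
by apply: fdiffMl; exact: (fdiff_snd p).1.
Qed.

(** At the index (0, 0) the lattice point is 0 for every tau, and [0^-1 = 0] makes two of the three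
    summands vanish identically. *)
Lemma fdiff_zterm kl (p : C * C) : p.1 != lat p.2 kl ->
  (kl = (0, 0) \/ lat p.2 kl != 0) ->
  differentiable (fun q : C * C => zterm q.2 q.1 kl) p.
Proof.
move=> h1 h2; have z0 : p.1 - lat p.2 kl != 0 by rewrite subr_eq0.
have d1 := (@fdiff_fst R C C p).1; have dl := fdiff_lat kl p.
have dz : differentiable (fun q : C * C => (q.1 - lat q.2 kl)^-1) p.
  exact: fdiffV (fdiffB d1 dl) z0.
case: h2 => [E|l0].
  have -> : (fun q : C * C => zterm q.2 q.1 kl) = (fun q => (q.1 - lat q.2 kl)^-1).
    apply/funext => q; rewrite /zterm E /lat /= mul0r addr0 invr0 expr0n /= invr0.
    by rewrite mulr0 !addr0.
  exact: dz.
have l2 : lat p.2 kl ^+ 2 != 0 by rewrite expf_neq0.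
exact: fdiffD (fdiffD dz (fdiffV dl l0)) (fdiffM d1 (fdiffV (fdiffX 2 dl) l2)).
Qed.

(** The M-test on the product space, with the bounds of [lat_ge] uniform in tau. The terms with
    index in a large box, where a pole may be close, form the exceptional finite set. *)
Theorem lattice_zeta_analytic (p : C * C) : 0 < cIm p.2 -> off_lattice p.1 p.2 ->
  analytic_at (fun q : C * C => lattice_zeta q.2 q.1) p.
Proof.
move=> hp off; have [c [r0 [c0 r00 H]]] := lat_ge hp.
pose r := Num.min r0 1; have r_gt0 : 0 < r by rewrite lt_min r00 ltr01.
pose rho := nrm p.1 + 1; have rho0 : 0 < rho by rewrite ltr_wpDl // nrm_ge0.
pose K := 16 * rho ^+ 2 / c ^+ 3.
have K0 : 0 <= K.
  apply: divr_ge0; last by apply: exprn_ge0; exact: ltW.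
  by apply: mulr_ge0 => //; apply: exprn_ge0; exact: ltW.
have inball q : nrm (q - p) < r -> [/\ 0 < cIm q.2, nrm q.1 <= rho &
    forall kl, c * (box kl)%:R <= nrm (lat q.2 kl)].
  rewrite lt_min => /andP[h1 h2].
  have [] := H q.2; first by apply: le_lt_trans (nrm_snd (q - p)) h1.
  split=> //; rewrite -(subrK p.1 q.1) (le_trans (nrmD _ _)) // /rho addrC lerD2l.
  by apply: le_trans (nrm_fst (q - p)) _; exact: ltW.
have lat0 q kl : nrm (q - p) < r -> kl = (0, 0) \/ lat q.2 kl != 0.
  move=> /inball[_ _ /(_ kl) h]; case: (posnP (box kl)) => b.
    left; case: kl b {h} => k l; rewrite /box /= => /eqP.
    by rewrite -leqn0 geq_max !leqn0 !absz_eq0 => /andP[/eqP -> /eqP ->].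
  right; rewrite -nrm_gt0; apply: lt_le_trans h.
  by rewrite mulr_gt0 // ltr0n.
pose n0 := nbound (2 * rho / c).
have HB (B : {fset int * int}) : \sum_(kl <- B) K * wbox R kl <= K * 64.
  by rewrite -mulr_sumr ler_wpM2l // wbox_sum.
have HA kl : kl \in big_box n0 -> analytic_at (fun q : C * C => zterm q.2 q.1 kl) p.
  move=> _; have := off kl; rewrite -subr_eq0 -nrm_gt0 => z0.
  have df : differentiable (fun q : C * C => q.1 - lat q.2 kl) p.
    exact: fdiffB (@fdiff_fst R C C p).1 (fdiff_lat kl p).
  have /cvg_nrmP/(_ _ z0) : (fun q : C * C => q.1 - lat q.2 kl) @ p --> p.1 - lat p.2 kl.
    exact: differentiable_continuous df.
  move=> H1; rewrite /analytic_at.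
  apply: filterS2 (near_ball p r_gt0) H1 => q hq hz.
  apply: fdiff_zterm (lat0 _ _ hq).
  rewrite -subr_eq0 -nrm_gt0; move: hz.
  set a := q.1 - _; set b := p.1 - _ => hz.
  by have := nrmB a (a - b); rewrite opprB addrC subrK; lra.
have Hu kl : kl \notin big_box n0 ->
    bounded_hol (fun q : C * C => zterm q.2 q.1 kl) p r (K * wbox R kl).
  rewrite in_big_box -ltnNge => hb q hq.
  have [hq2 hq1 hl] := inball q hq.
  have hbig : 2 * rho <= c * (box kl)%:R.
    rewrite [leRHS]mulrC -ler_pdivrMr //; apply: ltW; apply: lt_trans (nboundP _) _.
    by rewrite ltr_nat.
  have [n1 n2 n3] := zterm_le c0 rho0 hq1 (hl kl) hbig.
  split; last exact: n3.
  by apply: fdiff_zterm; [rewrite -subr_eq0 | right].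
have Hc := (hol_usum r_gt0 (fun kl => mulr_ge0 K0 (wbox_ge0 R kl)) HB HA Hu).1.
apply: eq_analytic_at (hol_cvg_analytic Hc).
apply/near_nrmP; exists r => // q /inball[hq _ _].
exact: has_sum_usum (@lattice_zeta_sum R _ _ hq).
Qed.

End LatticeZetaAnalytic.

(** * Eisenstein series as sums of rows *)

Section Eisenstein.
Variable R : realType.
Local Notation C := (Cx R).
Implicit Types (z tau : C).
Let t := twopii R.

Lemma sum_sym_opp (V : zmodType) (f : int -> V) N :
  \sum_(k <- sym_fset N) f (- k) = \sum_(k <- sym_fset N) f k.
Proof.
rewrite !sum_sym_fset oppr0; congr (_ + _); apply: eq_bigr => n _.
by rewrite opprK addrC.
Qed.

(** For odd [j], the value of the symmetric sum of [(n tau + l)^-(j + 1)] over [l], by Lipschitz'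
    formula if [n > 0]. As [j + 1] is even, rows [k] and [- k] agree. *)
Definition row_sum (j : nat) tau (n : nat) : C :=
  if n is 0 then 2 * zeta R j.+1
  else t ^+ j.+1 / (j`!)%:R * usum (fun l => qpow j l (n%:R * tau)).

Lemma zeta_cvg (s : nat) : (1 < s)%N ->
  series (fun l => (l.+1%:R : C) ^- s) @ \oo --> zeta R s.
Proof.
move=> s1; have [K HK] : exists K, abs_bound (fun l => (l.+1%:R : C) ^- s) K.
  exists (1 * 4); apply: abs_bound_wgt => // l; rewrite mul1r nrmV nrmX nrm_nat.
  apply: le_trans (wgt_inv_sqr R l).
  by rewrite lef_pV2 ?posrE ?exprn_gt0 // ler_weXn2l // ler1n.
have H := series_cvg (abs_has_sum HK).
by rewrite /zeta (series_lim (abs_has_sum HK)).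
Qed.

Lemma Im_natM n tau : cIm (n%:R * tau) = n%:R * cIm tau.
Proof. by rewrite cImM -ofR_nat /= mul0r addr0. Qed.

Lemma row_sum_cvg j tau (k : int) : odd j -> 0 < cIm tau ->
  (fun N => \sum_(l <- sym_fset N) (k%:~R * tau + l%:~R) ^- j.+1) @ \oo -->
  row_sum j tau `|k|%N.
Proof.
move=> oj ht; have j0 : (0 < j)%N by case: j oj.
have s1 : (-1) ^+ j.+1 = 1 :> C by rewrite -signr_odd /= oj.
have pos n : (fun N => \sum_(l <- sym_fset N) (n.+1%:R * tau - l%:~R) ^- j.+1) @ \oo -->
   row_sum j tau n.+1.
  have hn : 0 < cIm (n.+1%:R * tau) by rewrite Im_natM mulr_gt0.
  by have := Lipschitz_formula j0 hn; rewrite s1 mul1r.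
case: k => [[|n]|n]; last 2 first.
- rewrite absz_nat.
  rewrite (_ : (fun N => _) = fun N => \sum_(l <- sym_fset N) (n.+1%:R * tau - l%:~R) ^- j.+1).
    exact: pos.
  apply/funext => N; rewrite -sum_sym_opp; apply: eq_bigr => l _.
  by rewrite mulrNz.
- rewrite NegzE abszN absz_nat.
  rewrite (_ : (fun N => _) = fun N => \sum_(l <- sym_fset N) (n.+1%:R * tau - l%:~R) ^- j.+1).
    exact: pos.
  apply/funext => N; apply: eq_bigr => l _; congr (_^-1).
  have -> : (- n.+1%:Z)%:~R * tau + l%:~R = -1 * (n.+1%:R * tau - l%:~R).
    by rewrite mulrNz -[n.+1%:~R]/(n.+1%:R); ring.
  by rewrite exprMn s1 mul1r.
rewrite absz0 /= (_ : (fun N => _) = fun N => 2 * series (fun l => (l.+1%:R : C) ^- j.+1) N).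
  by apply: cvgC_Ml; apply: zeta_cvg.
apply/funext => N.
rewrite sum_sym_fset mul0r addr0 expr0n /= invr0 add0r big_add1 /= /series /= mulr_sumr.
apply: eq_bigr => n _; rewrite mulrNz !add0r -[n.+1%:~R]/(n.+1%:R).
have -> : - n.+1%:R = -1 * n.+1%:R :> C by rewrite mulN1r.
by rewrite exprMn s1 mul1r mulr_natl mulr2n.
Qed.

(** The terms [l^j q^((n + 1) l)]. Summed over [l] they give the rows of Lipschitz' formula, summed
    over [n] the Lambert series in [Geis]. *)
Definition lambert (j : nat) tau (nl : nat * nat) : C :=
  qpow j nl.2 (nl.1.+1%:R * tau).

Lemma qexp_natM n z : qexp (n%:R * z) = qexp z ^+ n.
Proof. by rewrite /qexp mulrCA cexpMn. Qed.

Lemma lambert_abs j tau : (0 < j)%N -> 0 < cIm tau ->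
  exists K, abs_bound (lambert j tau) K.
Proof.
move=> j0 ht; have y0 : 0 < 2 * pi * cIm tau by rewrite !mulr_gt0 // pi_gt0.
have [c c0 H] := exp_wgt j y0.
exists (c * (4 * 4)) => B.
apply: (@le_trans _ _ (\sum_(nl <- B) c * (wgt R nl.1 * wgt R nl.2))); last first.
  rewrite -mulr_sumr ler_wpM2l //.
  by apply: (@wgt_sum_pair R nat nat) => *; rewrite ?wgt_sum_fset // ltW // wgt_gt0.
apply: ler_sum => -[n l] _; rewrite /lambert /qpow /=.
case: l => [|l].
  rewrite expr0n (gtn_eqF j0) mul0r nrm0; apply: mulr_ge0 => //.
  by apply: mulr_ge0; exact/ltW/wgt_gt0.
apply: le_trans (H n l.+1 isT).
rewrite nrmM nrmX nrm_nat qexp_natM -exprM nrm_qexpX.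
by rewrite ler_wpM2l ?exprn_ge0.
Qed.

Lemma lambert_rows j tau : (0 < j)%N -> 0 < cIm tau ->
  has_sum (fun n => usum (fun l => qpow j l (n.+1%:R * tau))) (usum (lambert j tau)).
Proof. by move=> j0 ht; have [K HK] := lambert_abs j0 ht; exact: abs_rows HK. Qed.

(** For fixed [l > 0] the sum over [n] is geometric and starts with [q^l] because of the shift by
    one; the column [l = 0] vanishes as [j > 0]. *)
Lemma lambert_cols j tau : (0 < j)%N -> 0 < cIm tau ->
  has_sum (fun l => l%:R ^+ j * qexp tau ^+ l / (1 - qexp tau ^+ l))
    (usum (lambert j tau)).
Proof.
move=> j0 ht; have [K HK] := lambert_abs j0 ht.
pose sw (x : nat * nat) := (x.2, x.1).
have swK : cancel sw sw by case.
apply: has_sum_rows (has_sum_bij swK swK (abs_has_sum HK)) _ => l.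
case: l => [|l].
  rewrite expr0n (gtn_eqF j0) !mul0r.
  rewrite (_ : (fun n => _) = fun=> 0).
    rewrite (_ : (0 : C) = 0 * 0) ?mul0r //.
    have := has_sumZ (a := 0) (@has_sum_single R nat 0%N 0).
    by under eq_fun do rewrite mul0r; rewrite mul0r.
  by apply/funext => n; rewrite /lambert /= /qpow expr0n (gtn_eqF j0) mul0r.
have hl : 0 < cIm (l.+1%:R * tau) by rewrite Im_natM mulr_gt0.
have [K' HK'] := qpow_abs 0 hl; have G := geometric_usum hl.
have q1 : 1 - qexp (l.+1%:R * tau) != 0.
  by apply: contra_eq_neq G => ->; rewrite mul0r eq_sym oner_eq0.
have Eu : usum (fun n => qpow 0 n (l.+1%:R * tau)) = (1 - qexp (l.+1%:R * tau))^-1.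
  by apply: (mulfI q1); rewrite G divff.
have := has_sumZ (a := l.+1%:R ^+ j * qexp tau ^+ l.+1) (abs_has_sum HK').
rewrite Eu qexp_natM.
rewrite (_ : (fun n => _) = (fun n => (lambert j tau \o sw) (l.+1, n))) //.
apply/funext => n; rewrite /lambert /= /qpow !qexp_natM -!exprM expr0 mul1r.
by rewrite -mulrA -exprD; congr (_ * _ ^+ _); lia.
Qed.

Lemma GeisE k tau : 0 < cIm tau ->
  Geis k tau = 2 * zeta R (2 * k + 2) + eis_const R k * usum (lambert (2 * k + 1) tau).
Proof.
move=> ht; rewrite /Geis; congr (_ + _ * _).
have j0 : (0 < 2 * k + 1)%N by lia.
have H := series_cvg (lambert_cols j0 ht).
set u := (fun l => _) in H.
have u0 : u 0%N = 0 by rewrite /u expr0n (gtn_eqF j0) !mul0r.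
have : (fun N => series u N.+1) @ \oo --> usum (lambert (2 * k + 1) tau).
  by rewrite cvg_shiftS.
rewrite (_ : (fun N => _) = series (fun l => u l.+1)).
  by move=> Hs; apply: cvg_lim Hs; exact: norm_hausdorff.
by apply/funext => N; rewrite /series /= big_nat_recl // u0 add0r.
Qed.

(** This includes [k = 0], where the lattice sum is not absolutely convergent and the order of
    summation matters. *)
Lemma Geis_rows k tau : 0 < cIm tau ->
  (fun N => \sum_(l <- sym_fset N) row_sum (2 * k + 1) tau `|l|%N) @ \oo -->
  Geis k tau.
Proof.
move=> ht; have j0 : (0 < 2 * k + 1)%N by lia.
rewrite GeisE //.
have H := cvgC_Ml (a := eis_const R k) (series_cvg (lambert_rows j0 ht)).
have : (fun N => 2 * zeta R (2 * k + 2) + eis_const R k *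
   series (fun n => usum (fun l => qpow (2 * k + 1) l (n.+1%:R * tau))) N) @ \oo -->
   2 * zeta R (2 * k + 2) + eis_const R k * usum (lambert (2 * k + 1) tau).
  by apply: cvgD H; exact: cvg_cst.
rewrite (_ : (fun N => _) = fun N => \sum_(l <- sym_fset N) row_sum (2 * k + 1) tau `|l|%N) //.
apply/funext => N; rewrite sum_sym_fset absz0 /= addnS; congr (_ + _).
rewrite big_add1 /= /series /= mulr_sumr; apply: eq_bigr => n _.
rewrite -mulr2n -[RHS]mulr_natl mulrA; congr (_ * _).
by rewrite /eis_const -/t addnS mulrA.
Qed.

Theorem Geis_lattice k tau : (0 < k)%N -> 0 < cIm tau ->
  Geis k tau = usum (gterm (2 * k + 2) tau).
Proof.
move=> k0 ht; have s2 : (2 < 2 * k + 2)%N by lia.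
have oj : odd (2 * k + 1) by rewrite oddD oddM.
have [K HK] := gterm_abs s2 ht.
have H : has_sum (fun i : int => row_sum (2 * k + 1) tau `|i|%N)
   (usum (gterm (2 * k + 2) tau)).
  apply: has_sum_rows (abs_has_sum HK) _ => i.
  have Hi := abs_has_sum (abs_bound_row i HK).
  have Hr : (fun n => partial_sum (fun l => gterm (2 * k + 2) tau (i, l)) (sym_fset n))
      @ \oo --> row_sum (2 * k + 1) tau `|i|%N.
    have := @row_sum_cvg (2 * k + 1) tau i oj ht; rewrite -addnS.
    by apply: cvg_trans; apply: near_eq_cvg; apply: nearW.
  have E := cvgC_unique (has_sum_exhaust near_sym_fset Hi) Hr.
  by move: Hi; rewrite E.
apply: cvgC_unique (@Geis_rows k tau ht) _.
exact: has_sum_exhaust near_sym_fset H.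
Qed.

End Eisenstein.

(** * Quasi-periods of the zeta function and the law of G_2 *)

Section QuasiPeriods.
Variable R : realType.
Local Notation C := (Cx R).
Implicit Types (z tau : C).
Let t := twopii R.

(** Row [k] of [zterm tau z] in closed form: each of the three parts is summed symmetrically over
    the second index. *)
Definition zeta_row tau z (k : int) : C :=
  Eone (z - k%:~R * tau) + Eone (k%:~R * tau) + z * row_sum 1 tau `|k|%N.

Lemma lattice_zeta_rows tau z : 0 < cIm tau ->
  has_sum (zeta_row tau z) (lattice_zeta tau z).
Proof.
move=> ht; have [K HK] := zterm_abs z ht.
apply: has_sum_rows (@lattice_zeta_sum R tau z ht) _ => i.
have Hi := abs_has_sum (abs_bound_row i HK).
have Hr : (fun N => partial_sum (fun l => zterm tau z (i, l)) (sym_fset N)) @ \oo -->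
    zeta_row tau z i.
  have -> : (fun N => partial_sum (fun l => zterm tau z (i, l)) (sym_fset N)) =
      (fun N => \sum_(l <- sym_fset N) (z - i%:~R * tau - l%:~R)^-1 +
       \sum_(l <- sym_fset N) (i%:~R * tau - l%:~R)^-1 +
       z * \sum_(l <- sym_fset N) (i%:~R * tau + l%:~R) ^- 2).
    apply/funext => N; rewrite -[in X in _ + X + _]sum_sym_opp mulr_sumr -!big_split /=.
    apply: eq_bigr => l _; rewrite /zterm /lat /= mulrNz opprK opprD addrA.
    by [].
  apply: cvgD; first by apply: cvgD; exact: @Eone_cvg.
  by apply: cvgC_Ml; exact: (@row_sum_cvg R 1 tau i isT ht).
have E := cvgC_unique (has_sum_exhaust near_sym_fset Hi) Hr.
by move: Hi; rewrite E.
Qed.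

Lemma lattice_zeta_sym tau z : 0 < cIm tau ->
  (fun N => \sum_(k <- sym_fset N) zeta_row tau z k) @ \oo --> lattice_zeta tau z.
Proof.
by move=> ht; exact: has_sum_exhaust near_sym_fset (@lattice_zeta_rows tau z ht).
Qed.

(** [Eone] has period 1, so only the term linear in [z] changes, and its coefficients sum to G_2. *)
Lemma lattice_zetaD1 tau z : 0 < cIm tau ->
  lattice_zeta tau (z + 1) = lattice_zeta tau z + Geis 0 tau.
Proof.
move=> ht; apply: cvgC_unique (@lattice_zeta_sym tau (z + 1) ht) _.
have -> : (fun N => \sum_(k <- sym_fset N) zeta_row tau (z + 1) k) =
  (fun N => \sum_(k <- sym_fset N) zeta_row tau z k +
            \sum_(k <- sym_fset N) row_sum 1 tau `|k|%N).
  apply/funext => N; rewrite -big_split /=; apply: eq_bigr => k _.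
  rewrite /zeta_row (_ : z + 1 - k%:~R * tau = z - k%:~R * tau + 1); last by ring.
  by rewrite Eone_periodic; ring.
by apply: cvgD; [exact: lattice_zeta_sym | exact: (@Geis_rows R 0 tau ht)].
Qed.

Lemma cotzN z : cotz (- z) = - cotz z.
Proof.
rewrite /cotz; have -> : qexp (- z) = (qexp z)^-1 by rewrite /qexp mulrN cexpN.
have q0 : qexp z != 0 by exact: cexp_neq0.
have [->|q1] := eqVneq (qexp z) 1; first by rewrite invr1 subrr invr0 !mulr0 oppr0.
have n1 : qexp z - 1 != 0 by rewrite subr_eq0.
have n2 : 1 - qexp z != 0 by rewrite -opprB oppr_eq0.
by field; rewrite q0 n1 mulN1r n2.
Qed.

Lemma qexp_cvg0 tau z : 0 < cIm tau ->
  (fun N : nat => qexp (z + N%:R * tau)) @ \oo --> (0 : C).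
Proof.
move=> ht; apply/cvg_nrmP => e e0.
have y0 : 0 < 2 * pi * cIm tau by rewrite !mulr_gt0 // pi_gt0.
pose A := nrm (qexp z) / (2 * pi * cIm tau).
have A0 : 0 <= A by rewrite divr_ge0 ?nrm_ge0 // ltW.
exists (nbound (A / e)).+1 => // N /= hN.
have N0 : 0 < N%:R :> R by rewrite ltr0n; lia.
rewrite subr0 qexpD nrmM qexp_natM nrm_qexpX.
have := @pow_exp_le R 1 N _ isT y0; rewrite !expr1 mulrC -ler_pdivlMr // => h.
apply: (@le_lt_trans _ _ (A / N%:R)).
  have -> : A / N%:R = nrm (qexp z) * (1 / (2 * pi * cIm tau) / N%:R).
    by rewrite /A mul1r mulrA.
  by apply: ler_wpM2l h; exact: nrm_ge0.
rewrite ltr_pdivrMr // mulrC -ltr_pdivrMr //.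
by apply: lt_trans (nboundP _) _; rewrite ltr_nat.
Qed.

(** Here q tends to 0. The limit is - pi i; with the opposite limit in the other direction it makes
    up the 2 pi i of Legendre's relation. *)
Lemma cotz_cvg_up tau z : 0 < cIm tau ->
  (fun N : nat => cotz (z + N%:R * tau)) @ \oo --> - (t / 2).
Proof.
move=> ht; have H := @qexp_cvg0 tau z ht.
have -> : - (t / 2) = t / 2 * (0 + 1) / (0 - 1).
  by rewrite add0r sub0r invrN invr1 mulr1 mulrN1.
have Hp : (fun N : nat => qexp (z + N%:R * tau) + 1) @ \oo --> (0 + 1 : C).
  by apply: cvgD; [exact: H | exact: cvg_cst].
have Hm : (fun N : nat => qexp (z + N%:R * tau) - 1) @ \oo --> (0 - 1 : C).
  by apply: cvgD; [exact: H | exact: cvg_cst].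
have m0 : (0 - 1 : C) != 0 by rewrite sub0r oppr_eq0 oner_eq0.
exact: (cvgM (cvgC_Ml (a := t / 2) Hp) (cvgV m0 Hm)).
Qed.

Lemma cotz_cvg_down tau z : 0 < cIm tau ->
  (fun N : nat => cotz (z - N%:R * tau)) @ \oo --> t / 2.
Proof.
move=> ht.
have -> : (fun N : nat => cotz (z - N%:R * tau)) =
    (fun N : nat => - cotz (- z + N%:R * tau)).
  by apply/funext => N; rewrite -cotzN opprD opprK.
by rewrite -[X in _ --> X]opprK; apply: cvgN; exact: cotz_cvg_up.
Qed.

(* The rows telescope, and leave the two limits of the cotangent: this is
   Legendre's relation. *)
Lemma lattice_zetaDtau tau z : 0 < cIm tau ->
  lattice_zeta tau (z + tau) = lattice_zeta tau z + (tau * Geis 0 tau - t).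
Proof.
move=> ht; apply: cvgC_unique (@lattice_zeta_sym tau (z + tau) ht) _.
have -> : (fun N => \sum_(k <- sym_fset N) zeta_row tau (z + tau) k) =
  (fun N => \sum_(k <- sym_fset N) zeta_row tau z k +
     (tau * (\sum_(k <- sym_fset N) row_sum 1 tau `|k|%N) +
      (cotz (z + tau + N%:R * tau) - cotz (z - N%:R * tau)))).
  apply/funext => N.
  have -> : cotz (z + tau + N%:R * tau) - cotz (z - N%:R * tau) =
    \sum_(k <- sym_fset N) (Eone (z + tau - k%:~R * tau) - Eone (z - k%:~R * tau)).
    rewrite sumrB.
    have -> : \sum_(k <- sym_fset N) Eone (z + tau - k%:~R * tau) =
      \sum_(k <- sym_fset N) Eone (z - (k - 1)%:~R * tau).
      by apply: eq_bigr => k _; congr Eone; rewrite rmorphB /=; ring.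
    rewrite (sum_sym_shift (fun k => Eone (z - k%:~R * tau))) !Eone_cotz.
    have -> : z - (- N.+1%:Z)%:~R * tau = z + tau + N%:R * tau.
      by rewrite mulrNz -[N.+1%:~R]/(N.+1%:R) -(natr1 N); ring.
    rewrite -[N%:~R]/(N%:R); ring.
  rewrite mulr_sumr -!big_split /=; apply: eq_bigr => k _.
  by rewrite /zeta_row; ring.
apply: cvgD; first exact: lattice_zeta_sym.
apply: cvgD; first by apply: cvgC_Ml; exact: (@Geis_rows R 0 tau ht).
have -> : - t = - (t / 2) - t / 2 by field.
by apply: cvgD; [exact: cotz_cvg_up | apply: cvgN; exact: cotz_cvg_down].
Qed.

Lemma quasi_period_int (f : C -> C) (w eta : C) :
  (forall z, f (z + w) = f z + eta) ->
  forall (k : int) z, f (z + k%:~R * w) = f z + k%:~R * eta.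
Proof.
move=> fw; have fn (n : nat) z : f (z + n%:R * w) = f z + n%:R * eta.
  elim: n => [|n IH]; first by rewrite !mul0r !addr0.
  by rewrite -(natr1 n) !mulrDl !mul1r addrA fw IH addrA.
case=> n z; first exact: fn.
have := fn n.+1 (z - n.+1%:R * w); rewrite subrK => ->.
by rewrite NegzE mulrNz -[n.+1%:~R]/(n.+1%:R) !mulNr addrK.
Qed.

Theorem Geis0_mobius (g : 'M[int]_2) tau : \det g = 1 -> 0 < cIm tau ->
  Geis 0 (mobius g tau) =
  autom g tau ^+ 2 * Geis 0 tau - t * (g 1 0)%:~R * autom g tau.
Proof.
move=> hg ht; have J0 := autom_neq0 hg ht; set J := autom g tau in J0 *.
have h1 := @lattice_zetaD1 (mobius g tau) 0 (mobius_H hg ht).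
have -> : Geis 0 (mobius g tau) =
    lattice_zeta (mobius g tau) 1 - lattice_zeta (mobius g tau) 0.
  by rewrite -[X in lattice_zeta _ X - _]add0r h1 addrC addKr.
have := @lattice_zeta_mobius R g hg tau J ht; rewrite -/J divff // => ->.
have := @lattice_zeta_mobius R g hg tau 0 ht; rewrite -/J mul0r => ->.
(* The automorphy factor is itself a period of the lattice of tau, so the quasi-periods evaluate the
   zeta function at [J]. *)
have eJ : J = 0 + (g 1 0)%:~R * tau + (g 1 1)%:~R * 1.
  by rewrite add0r mulr1.
have p1 z := @lattice_zetaD1 tau z ht.
have pt z := @lattice_zetaDtau tau z ht.
rewrite [X in lattice_zeta tau X]eJ (quasi_period_int p1) (quasi_period_int pt).
by rewrite /J /autom; ring.
Qed.

Theorem Geis_mobius (g : 'M[int]_2) k tau : \det g = 1 -> (0 < k)%N -> 0 < cIm tau ->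
  Geis k (mobius g tau) = autom g tau ^+ (2 * k + 2) * Geis k tau.
Proof.
move=> hg k0 ht.
by rewrite !Geis_lattice ?gterm_mobius //; [lia | exact: mobius_H].
Qed.

Lemma off_lattice_half tau : 0 < cIm tau -> off_lattice (1 / 2) tau /\
  off_lattice (- (1 / 2)) tau.
Proof.
move=> ht; have two (a : C) : (a *+ 2 = 1 \/ a *+ 2 = -1) -> forall kl, a != lat tau kl.
  move=> ha [k l]; apply/eqP => E.
  have imz (b : C) : b = 1 \/ b = -1 -> cIm b = 0 by case=> ->; rewrite ?cImN /= ?oppr0.
  have := imz _ ha; rewrite E /lat /= mulr2n !cImD !cImM -!ofR_int /= mul0r !addr0.
  move=> h; have {}h : (k%:~R : R) * cIm tau = 0 by lra.
  move/eqP: h; rewrite mulf_eq0 (gt_eqF ht) orbF intr_eq0 => /eqP k0.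
  move: ha; rewrite E k0 /lat /= mul0r add0r -mulr_natr -[2%:R]/(2%:~R) -intrM.
  by case=> /eqP; rewrite -[1]/(1%:~R) -?mulrNz eqr_int => /eqP; lia.
have h2 : (1 / 2 : C) *+ 2 = 1 by rewrite mulr2n -splitr.
by split; apply: two; [left | right; rewrite mulNrn h2].
Qed.

(** As a quasi-period, G_2 is the difference of the zeta values at 1/2 and -1/2, which never lie on
    the lattice. *)
Lemma Geis0_analytic tau : 0 < cIm tau -> differentiable (Geis 0) tau.
Proof.
move=> ht; have [h1 h2] := off_lattice_half ht.
have dsl (a : C) : off_lattice a tau -> differentiable (fun s => lattice_zeta s a) tau.
  move=> ha; have da := analytic_at_diff (@lattice_zeta_analytic R (a, tau) ht ha).
  apply: (@fdiff_comp R C (C * C)%type C (fun s : C => (a, s))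
    (fun q : C * C => lattice_zeta q.2 q.1)) da.
  by apply: differentiable_pair; [exact: fdiff_cst | exact: fdiff_id].
have near_eq : \forall s \near tau,
    lattice_zeta s (1 / 2) - lattice_zeta s (- (1 / 2)) = Geis 0 s.
  apply: filterS (near_Im ht) => s hs.
  rewrite [X in lattice_zeta s X - _](_ : 1 / 2 = - (1 / 2) + 1); last by field.
  by rewrite lattice_zetaD1 // addrC addKr.
exact: (near_eq_diff near_eq (fdiffB (dsl _ h1) (dsl _ h2))).1.
Qed.

End QuasiPeriods.

(** * The logarithm and powers of the automorphy factor *)

Section ComplexLogarithm.
Variable R : realType.
Local Notation C := (Cx R).
Implicit Types (z : C).

Lemma cos_ratio z : z != 0 -> -1 <= cRe z / cmod z <= 1.
Proof.
move=> z0; have m0 : 0 < cmod z by rewrite -nrm_cmod nrm_gt0.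
rewrite ler_pdivlMr // ler_pdivrMr // mulN1r mul1r -ler_norml -nrm_cmod.
exact: nrm_Re.
Qed.

Lemma clogK z : z != 0 -> cexp (clog z) = z.
Proof.
move=> z0; have m0 : 0 < cmod z by rewrite -nrm_cmod nrm_gt0.
have hr := cos_ratio z0.
have ca : cos (acos (cRe z / cmod z)) = cRe z / cmod z by rewrite acosK // in_itv.
have sa : cmod z * sin (acos (cRe z / cmod z)) = `|cIm z|.
  have sm : cmod z = Num.sqrt (cmod z ^+ 2) by rewrite sqrtr_sqr ger0_norm // ltW.
  rewrite sin_acos // {1}sm -sqrtrM ?sqr_ge0 // -sqrtr_sqr; congr Num.sqrt.
  have s := nrm_sqr z; rewrite nrm_cmod in s.
  have -> : cmod z ^+ 2 * (1 - (cRe z / cmod z) ^+ 2) = cmod z ^+ 2 - cRe z ^+ 2.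
    by field; rewrite gt_eqF.
  by rewrite s addrC addKr.
rewrite /cexp /clog /= lnK ?posrE // /carg.
apply: eqC => /=; case: ifP => im.
- by rewrite ca mulrC mulfVK ?gt_eqF.
- rewrite mulr_natl addrC cosD2pi cosN ca mulrC mulfVK ?gt_eqF //.
- by rewrite sa ger0_norm.
rewrite mulr_natl addrC sinD2pi sinN mulrN sa ltr0_norm ?opprK //.
by rewrite ltNge im.
Qed.

Lemma real_cont (f : C -> R) z : (forall x, `|f x - f z| <= nrm (x - z)) ->
  {for z, continuous f}.
Proof.
move=> H A /nbhs_ballP[e /= e0 He].
suff K : \forall x \near z, A (f x) by exact: K.
apply/near_nrmP; exists e => // x hx.
by apply: He; rewrite -ball_normE /= distrC (le_lt_trans (H x)).
Qed.

Lemma real_cont_near (f : C -> R) z (e : R) : {for z, continuous f} -> 0 < e ->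
  exists2 d : R, 0 < d & forall x, nrm (x - z) < d -> `|f x - f z| < e.
Proof.
move=> cf e0; have H : \forall x \near z, ball (f z) e (f x).
  by apply: cf; exact: nbhsx_ballx.
have /near_nrmP[d d0 Hd] := H; exists d => // x /Hd.
by rewrite -ball_normE /= distrC.
Qed.

Lemma nrm_cont z : {for z, continuous (fun x : C => cmod x)}.
Proof.
apply: real_cont => x; rewrite -!nrm_cmod.
have h1 := nrmD (x - z) z; have h2 := nrmB x (x - z).
rewrite subrK in h1; rewrite opprB addrC subrK in h2.
by rewrite ler_norml; lra.
Qed.

Lemma cRe_cont z : {for z, continuous (@cRe R)}.
Proof. by apply: real_cont => x; rewrite -cReB; exact: nrm_Re. Qed.

(** Off the real axis a single one of the two formulas for [carg] is valid near [z]. *)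
Lemma clog_cont z : cIm z != 0 -> (@clog R) @ z --> clog z.
Proof.
move=> im; have z0 : z != 0 by apply: contra_neq im => ->.
have m0 : 0 < cmod z by rewrite -nrm_cmod nrm_gt0.
have cl : {for z, continuous (fun x : C => ln (cmod x))}.
  apply: (@continuous_comp _ _ _ (fun x : C => cmod x) (@ln R)); first exact: nrm_cont.
  exact: continuous_ln.
have ca : {for z, continuous (fun x : C => acos (cRe x / cmod x))}.
  apply: (@continuous_comp _ _ _ (fun x : C => cRe x / cmod x) (@acos R)).
    apply: continuousM; first exact: cRe_cont.
    by apply: continuousV; [rewrite gt_eqF | exact: nrm_cont].
  apply: continuous_acos; have := nrm_sqr z; rewrite nrm_cmod => s.
  rewrite -ltr_norml normrM normfV (ger0_norm (ltW m0)) ltr_pdivrMr // mul1r.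
  rewrite -(@ltr_pXn2r _ 2) ?nnegrE ?normr_ge0 ?(ltW m0) // s -normrX ger0_norm ?sqr_ge0 //.
  by rewrite ltrDl exprn_even_gt0.
have cg : {for z, continuous (@carg R)}.
  case: (ltgtP 0 (cIm z)) (im) => // hI _.
    have near_eq : \forall x \near z, acos (cRe x / cmod x) = carg x.
      by apply: filterS (near_Im hI) => x hx; rewrite /carg (ltW hx).
    rewrite /prop_for /continuous_at /carg (ltW hI).
    exact: cvg_trans (near_eq_cvg near_eq) ca.
  have near_eq : \forall x \near z, 2 * pi - acos (cRe x / cmod x) = carg x.
    have hI' : 0 < cIm (- z) by rewrite cImN oppr_gt0.
    have : \forall x \near z, cIm x < 0.
      apply/near_nrmP; exists (- cIm z); first by rewrite oppr_gt0.
      move=> x hx; have := le_lt_trans (nrm_Im (x - z)) hx.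
      by rewrite cImB ltr_norml => /andP[]; lra.
    by apply: filterS => x hx; rewrite /carg leNgt hx.
  rewrite /prop_for /continuous_at /carg leNgt hI /=.
  apply: cvg_trans (near_eq_cvg near_eq) _.
  by apply: cvgB; [exact: cvg_cst | exact: ca].
apply: (iffRL (@cvg_nrmP R C C (nbhs z) _ (@clog R) (clog z))) => e e0.
have e2 : 0 < e / 2 by rewrite divr_gt0.
have [d1 p1 H1] := real_cont_near cl e2.
have [d2 p2 H2] := real_cont_near cg e2.
suff K : \forall x \near z, nrm (clog x - clog z) < e by exact: K.
apply/near_nrmP; exists (Num.min d1 d2); first by rewrite lt_min p1.
move=> x; rewrite lt_min => /andP[/H1 h1 /H2 h2].
rewrite (le_lt_trans (nrm_le_ReIm _)) // cReB cImB /= [ltRHS]splitr.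
by apply: ltrD.
Qed.

Lemma cder_inverse (f F : C -> C) z d : d != 0 -> f @ z --> f z ->
  cder F (f z) d -> (\forall x \near z, F (f x) = x) -> cder f z d^-1.
Proof.
move=> d0 cf HF /near_nrmP[r r0 Hr]; apply: cder_intro => e e0.
have nd : 0 < nrm d by rewrite nrm_gt0.
(* The first bound gives [nrm d * nrm del <= 2 * nrm h]; inserted into the expansion of [F], the
   second gives the final error. *)
pose eta := Num.min (nrm d / 2) (e * nrm d ^+ 2 / 2).
have eta0 : 0 < eta by rewrite lt_min !divr_gt0 // mulr_gt0 // exprn_gt0.
have [rho rho0 Hrho] := diff_nrm HF.1 eta0.
have /cvg_nrmP/(_ _ rho0)/near_nrmP[s s0 Hs] := cf.
exists (Num.min r s); first by rewrite lt_min r0.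
move=> h; rewrite lt_min => /andP[hr hs].
have zh : nrm (z + h - z) = nrm h by rewrite addrC addKr.
have := Hs (z + h); rewrite zh => /(_ hs); set del := f (z + h) - f z => hdel.
have fd : f z + del = f (z + h) by rewrite /del addrC subrK.
have := Hrho del hdel; rewrite (cder_diff HF) fd.
rewrite !Hr ?zh ?subrr ?nrm0 // (addrC z) addrK => Hh.
have e1 : eta <= nrm d / 2 by rewrite ge_min lexx.
have e2 : eta <= e * nrm d ^+ 2 / 2 by rewrite ge_min lexx orbT.
have n0 := nrm_ge0 del; have h0 := nrm_ge0 h.
have ddel : nrm d * nrm del <= 2 * nrm h.
  have := nrmB h (h - d * del); rewrite opprB addrC subrK nrmM => h1.
  have : eta * nrm del <= nrm d / 2 * nrm del by rewrite ler_wpM2r.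
  lra.
rewrite -(ler_pM2l nd) -nrmM.
have -> : d * (f (z + h) - f z - d^-1 * h) = - (h - d * del) by rewrite /del; field.
rewrite nrmN (le_trans Hh) // -(ler_pM2l nd).
apply: (@le_trans _ _ (eta * (2 * nrm h))).
  by rewrite mulrCA ler_wpM2l // ltW.
apply: (@le_trans _ _ (e * nrm d ^+ 2 / 2 * (2 * nrm h))).
  by rewrite ler_wpM2r // mulr_ge0.
by rewrite le_eqVlt; apply/orP; left; apply/eqP; field.
Qed.

Lemma cder_clog z : cIm z != 0 -> cder (@clog R) z z^-1.
Proof.
move=> im; have z0 : z != 0 by apply: contra_neq im => ->.
apply: (cder_inverse (F := @cexp R)) => //; first exact: clog_cont.
  by have := cder_cexp (clog z); rewrite clogK.
apply/near_nrmP; exists (nrm z); first by rewrite nrm_gt0.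
move=> x hx; apply: clogK; apply/eqP => x0; move: hx.
by rewrite x0 sub0r nrmN ltxx.
Qed.

Lemma cpowD1 (r : C) (s : C) : r != 0 -> cpow r (s + 1) = cpow r s * r.
Proof. by move=> r0; rewrite /cpow mulrDl mul1r cexpD clogK. Qed.

Lemma cpowDn (r s : C) n : r != 0 -> cpow r (s + n%:R) = cpow r s * r ^+ n.
Proof.
move=> r0; elim: n => [|n IH]; first by rewrite addr0 mulr1.
by rewrite -(natr1 n) addrA cpowD1 // IH exprSr mulrA.
Qed.

Lemma cder_cpow_autom (g : 'M[int]_2) (s tau : C) : \det g = 1 -> 0 < cIm tau ->
  cder (fun x => cpow (autom g x)^-1 s) tau
    (- s * (g 1 0)%:~R / autom g tau * cpow (autom g tau)^-1 s).
Proof.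
move=> hg ht; have J0 := autom_neq0 hg ht.
have dJ : cder (autom g) tau (g 1 0)%:~R.
  have := cder_D2 (cder_Ml ((g 1 0)%:~R : C) (cder_id tau)) (cder_cst ((g 1 1)%:~R : C) tau).
  by rewrite mulr1 addr0.
(* A constant automorphy factor may lie on the cut of the logarithm, so this case is settled
   apart. *)
have [c0|c0] := eqVneq (g 1 0) 0.
  rewrite c0 mulr0 !mul0r.
  have -> : (fun x => cpow (autom g x)^-1 s) = (fun _ => cpow ((g 1 1)%:~R)^-1 s).
    by apply/funext => x; rewrite /autom c0 mul0r add0r.
  exact: cder_cst.
have imJ : cIm (autom g tau)^-1 != 0.
  have imJ : cIm (autom g tau) != 0.
    rewrite /autom cImD cImM -!ofR_int /= mul0r !addr0 mulf_neq0 ?intr_eq0 //.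
    by rewrite gt_eqF.
  apply: contra_neq imJ => im; have := mulVf J0 => /(congr1 (@cIm R)).
  rewrite cImM im mul0r addr0 /= => /eqP; rewrite mulf_eq0 => /orP[/eqP re|/eqP //].
  have : (autom g tau)^-1 = 0 by apply: eqC.
  by move/eqP; rewrite invr_eq0 (negbTE J0).
have H1 := cder_comp dJ (cder_inv J0).
have H2 := cder_comp H1 (cder_clog imJ).
have H3 := cder_comp (cder_Ml s H2) (cder_cexp _).
have := H3; rewrite /cpow (_ : _ * (s * _) = - s * (g 1 0)%:~R / autom g tau *
  cexp (s * clog (autom g tau)^-1)) //.
by rewrite invrK; field.
Qed.

End ComplexLogarithm.

(** * Covariance of the Weierstrass functions *)

Section WeierstrassCovariance.
Variable R : realType.
Local Notation C := (Cx R).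

Lemma derivable_cder (f : C -> C) (z : C) : derivable f z 1 -> cder f z ('D_1 f z).
Proof.
by move=> /derivable1_diffP df; split => //; rewrite -derive_diff.
Qed.

Lemma derive_junk (f : C -> C) (z : C) : ~ derivable f z 1 -> 'D_1 f z = 0.
Proof. by move=> H; exact: (dvgP H). Qed.

(* The library gives the derivative the value 0 at a point where it does not exist,
   so no differentiability is needed. *)
Lemma derive_scale (f : C -> C) (a J z : C) : J != 0 ->
  'D_1 (fun x => a * f (J * x)) z = a * J * 'D_1 f (J * z).
Proof.
move=> J0; have dJ (c w : C) : cder (fun x => c * x) w c.
  by have := cder_Ml c (cder_id w); rewrite mulr1.
have [df|ndf] := pselect (derivable f (J * z) 1).
  have := cder_Ml a (cder_comp (dJ J z) (derivable_cder df)).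
  by move=> /cder_D ->; ring.
have [->|a0] := eqVneq a 0.
  have -> : (fun x => 0 * f (J * x)) = (fun _ => 0).
    by apply/funext => x; rewrite mul0r.
  by rewrite (cder_D (cder_cst 0 z)) !mul0r.
rewrite (derive_junk ndf) mulr0; apply: derive_junk => dF; apply: ndf.
apply/derivable1_diffP.
have zE : z = J^-1 * (J * z) by rewrite mulKf.
rewrite zE in dF; have H := cder_Ml a^-1 (cder_comp (dJ J^-1 (J * z)) (derivable_cder dF)).
have := H.1; rewrite (_ : (fun x => _) = f) //.
by apply/funext => x; rewrite mulVKf // mulKf.
Qed.

(** Each derivative in [z] contributes one more automorphy factor. By [derive_scale] the identity
    holds at every [z], lattice points included. *)
Lemma wpS_mobius (g : 'M[int]_2) k (tau z : C) : \det g = 1 -> 0 < cIm tau ->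
  wpS k (mobius g tau) (z / autom g tau) = autom g tau ^+ k.+1 * wpS k tau z.
Proof.
move=> hg ht; have J0 := autom_neq0 hg ht.
elim: k z => [|k IH] z; first by rewrite expr1; exact: lattice_zeta_mobius.
rewrite /=; set J := autom g tau in J0 IH *.
have -> : wpS k (mobius g tau) = fun x => J ^+ k.+1 * wpS k tau (J * x).
  by apply/funext => x; rewrite -IH mulrAC divff // mul1r.
have zJ : J * (z / J) = z by rewrite mulrCA divff ?mulr1.
have E := derive_scale (wpS k tau) (J ^+ k.+1) (z / J) J0; rewrite zJ in E.
apply: etrans (congr1 (fun c => - k.+1%:R^-1 * c) E) _.
by rewrite [J ^+ k.+2]exprSr; move: ('D_1 (wpS k tau) z) => d; ring.
Qed.

End WeierstrassCovariance.

(** * The slash operator *)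

Section SlashOperator.
Variable R : realType.
Local Notation C := (Cx R).
Variable n : nat.
Local Notation P := ('rV[C]_n * C)%type.
Variables (g : 'M[int]_2) (hg : \det g = 1).
Implicit Types (x p : P) (h : P -> C) (s : C).

Definition slash s h : P -> C :=
  fun x => cpow (autom g x.2)^-1 s * h (modular_act g x).

Lemma modular_actE x : modular_act g x = ((autom g x.2)^-1 *: x.1, mobius g x.2).
Proof. by []. Qed.

Lemma cder_autom (tau : C) : cder (autom g) tau (g 1 0)%:~R.
Proof.
have := cder_D2 (cder_Ml ((g 1 0)%:~R : C) (cder_id tau)) (cder_cst ((g 1 1)%:~R : C) tau).
by rewrite mulr1 addr0.
Qed.

Lemma cder_automV (tau : C) : 0 < cIm tau ->
  cder (fun y => (autom g y)^-1) tau (- (g 1 0)%:~R / autom g tau ^+ 2).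
Proof.
move=> ht; have J0 := autom_neq0 hg ht.
have := cder_comp (cder_autom tau) (cder_inv J0).
by rewrite (_ : - autom g tau ^- 2 * _ = - (g 1 0)%:~R / autom g tau ^+ 2) //; ring.
Qed.

Lemma cder_mobius (tau : C) : 0 < cIm tau ->
  cder (mobius g) tau (autom g tau ^- 2).
Proof.
move=> ht; have J0 := autom_neq0 hg ht.
have h1 := cder_D2 (cder_Ml ((g 0 0)%:~R : C) (cder_id tau)) (cder_cst ((g 0 1)%:~R : C) tau).
have := cder_M h1 (cder_automV ht).
set d := _ + _; have -> : d = autom g tau ^- 2.
  have D : (g 0 0)%:~R * (g 1 1)%:~R - (g 0 1)%:~R * (g 1 0)%:~R = 1 :> C.
    by rewrite -!intrM -rmorphB /= det2.
  rewrite /d mulr1 addr0.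
  have J2 : autom g tau ^+ 2 != 0 by rewrite expf_neq0.
  apply: (mulIf J2); rewrite mulVf //; apply: etrans D.
  by move: J0; rewrite /autom /= => J0; field.
by [].
Qed.

Lemma act_differentiable x : 0 < cIm x.2 -> differentiable (modular_act g) x.
Proof.
move=> hx.
have d2 := (@fdiff_snd R _ _ x).1; have d1 := (@fdiff_fst R _ _ x).1.
have dV : differentiable (fun y : P => (autom g y.2)^-1) x.
  exact: (@fdiff_comp R P C C (fun y => y.2) (fun w => (autom g w)^-1)) d2 (cder_automV hx).1.
apply: differentiable_pair.
  rewrite (_ : (fun y : P => _) =
      (fun y : P => \sum_(j < n) ((autom g y.2)^-1 * y.1 0 j) *: delta_mx 0 j)).
    apply: fdiff_sum => j _; apply: differentiableZl; apply: fdiffM => //.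
    apply: (@fdiff_comp R P _ C (fun y => y.1) (fun u => u 0 j)) d1 _.
    exact: differentiable_coord.
  apply/funext => y; rewrite [in LHS](row_sum_delta y.1) scaler_sumr.
  by apply: eq_bigr => j _; rewrite scalerA.
exact: (@fdiff_comp R P C C (fun y => y.2) (mobius g)) d2 (cder_mobius hx).1.
Qed.

Lemma slash_differentiable s h x : 0 < cIm x.2 ->
  differentiable h (modular_act g x) -> differentiable (slash s h) x.
Proof.
move=> hx dh; apply: fdiffM.
  exact: (@fdiff_comp R P C C (fun y => y.2) (fun w => cpow (autom g w)^-1 s))
    (@fdiff_snd R _ _ x).1 (cder_cpow_autom s hg hx).1.
exact: fdiff_comp (act_differentiable hx) dh.
Qed.

Lemma D_line (X : normedModType C) (f : X -> C) (x v : X) (d : C) :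
  differentiable f x -> cder (fun k : C => f (x + k *: v)) 0 d -> 'D_v f x = d.
Proof.
move=> df [_ <-]; rewrite derive_diff //.
have df0 : differentiable f (x + 0 *: v) by rewrite scale0r addr0.
have := congr1 (fun F : C -> C => F 1) (differentiable_line df0).2.
by rewrite scale0r addr0 scale1r => ->.
Qed.

Lemma diff_scale (X : normedModType C) (f : X -> C) (x v : X) (k : C) :
  'd f x (k *: v) = k * 'd f x v.
Proof. exact: linearZ. Qed.

(** Along this direction tau is fixed, so the power is constant and the action only rescales the
    direction by the inverse automorphy factor. *)
Lemma dz_slash s h x i : 0 < cIm x.2 -> differentiable h (modular_act g x) ->
  an_dz i (slash s h) x = slash (s + 1) (an_dz i h) x.
Proof.
move=> hx dh; have J0 := autom_neq0 hg hx.
pose r := (autom g x.2)^-1; pose v : P := (delta_mx 0 i, 0).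
have r0 : r != 0 by rewrite invr_eq0.
apply: D_line; first exact: slash_differentiable.
have E : (fun k : C => slash s h (x + k *: v)) =
    (fun k : C => cpow r s * h (modular_act g x + k *: (r *: v))).
  apply/funext => k; rewrite /slash.
  have -> : (x + k *: v).2 = x.2 by rewrite /= scaler0 addr0.
  congr (_ * h _); rewrite !modular_actE.
  have -> : (x + k *: v).2 = x.2 by rewrite /= scaler0 addr0.
  congr (_, _); last by rewrite /= !scaler0 addr0.
  by rewrite /= scalerDr !scalerA mulrC.
have E2 : slash (s + 1) (an_dz i h) x = cpow r s * (r * an_dz i h (modular_act g x)).
  by rewrite /slash -/r (cpowD1 _ r0) mulrA.
have dh0 : differentiable h (modular_act g x + 0 *: (r *: v)).
  by rewrite scale0r addr0.
have [dl dlE] := differentiable_line dh0.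
have H1 : cder (fun k : C => h (modular_act g x + k *: (r *: v))) 0
    (r * an_dz i h (modular_act g x)).
  split; first exact: dl.
  apply: etrans (congr1 (fun F : C -> C => F 1) dlE) _.
  rewrite scale0r addr0 scale1r diff_scale.
  by congr (_ * _); exact: esym (derive_diff v dh).
rewrite E E2; exact (cder_Ml (cpow r s) H1).
Qed.

Lemma diff_coords h (y : P) (u : 'rV[C]_n) (c : C) : differentiable h y ->
  'd h y (u, c) = \sum_(j < n) u 0 j * an_dz j h y + c * an_dtau h y.
Proof.
move=> dh; have -> : (u, c) = \sum_(j < n) u 0 j *: ((delta_mx 0 j, 0) : P) +
    c *: ((0, 1) : P).
  have -> : \sum_(j < n) u 0 j *: ((delta_mx 0 j, 0) : P) = (u, 0).
    rewrite [in RHS](row_sum_delta u).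
    elim/big_rec2: _ => [//|j a b _ ->].
    by congr (_, _); rewrite /= scaler0 addr0.
  by congr (_, _); rewrite /= ?scaler0 ?addr0 // add0r [_ *: _]mulr1.
rewrite linearD linear_sum linearZ /=; congr (_ + _).
  by apply: eq_bigr => j _; rewrite linearZ /an_dz derive_diff.
by rewrite /an_dtau derive_diff.
Qed.

(** The three terms come from the power, from the dependence of [z / autom g tau] on tau, and from
    [mobius], whose derivative is [autom g tau ^- 2]. *)
Lemma dtau_slash s h x : 0 < cIm x.2 -> differentiable h (modular_act g x) ->
  an_dtau (slash s h) x = cpow (autom g x.2)^-1 s *
    (- s * (g 1 0)%:~R / autom g x.2 * h (modular_act g x)
     - (g 1 0)%:~R / autom g x.2 ^+ 2 *
         (\sum_(j < n) x.1 0 j * an_dz j h (modular_act g x))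
     + autom g x.2 ^- 2 * an_dtau h (modular_act g x)).
Proof.
move=> hx dh; have J0 := autom_neq0 hg hx.
apply: D_line; first exact: slash_differentiable.
pose F (y : C) := cpow (autom g y)^-1 s * h ((autom g y)^-1 *: x.1, mobius g y).
have E : (fun k : C => slash s h (x + k *: ((0, 1) : P))) = (fun k : C => F (k + x.2)).
  apply/funext => k; rewrite /slash /F modular_actE.
  have -> : (x + k *: ((0, 1) : P)).2 = k + x.2 by rewrite /= [k *: 1]mulr1 addrC.
  by have -> : (x + k *: ((0, 1) : P)).1 = x.1 by rewrite /= scaler0 addr0.
rewrite E; set d := (X in cder _ _ X).
suff HF : @cder R (F : C -> C) (x.2 : C) d.
  have hk : cder (fun k : C => k + x.2) 0 1.
    by have := cder_D2 (cder_id 0) (cder_cst x.2 0); rewrite addr0.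
  have HF' : cder F (0 + x.2) d by rewrite add0r.
  by have := cder_comp hk HF'; rewrite mulr1.
pose c (y : C) : P := ((autom g y)^-1 *: x.1, mobius g y).
have dV := cder_automV hx; have dm := cder_mobius hx.
pose c1 (y : C) : 'rV[C]_n := (autom g y)^-1 *: x.1.
have dc1 : differentiable c1 (x.2 : C) by apply: differentiableZl; exact: dV.1.
have dc1E : 'd c1 (x.2 : C) (1 : C) = (- (g 1 0)%:~R / autom g x.2 ^+ 2) *: x.1.
  apply: etrans (congr1 (fun F : C -> 'rV[C]_n => F 1) (diffZl x.1 dV.1)) _.
  by rewrite dV.2.
have dc : differentiable c (x.2 : C).
  by apply: differentiable_pair; [exact: dc1 | exact: dm.1].
have dcE : 'd c (x.2 : C) (1 : C) =
    ((- (g 1 0)%:~R / autom g x.2 ^+ 2) *: x.1, autom g x.2 ^- 2).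
  apply: etrans (congr1 (fun F : C -> P => F 1) (diff_pair dc1 dm.1)) _.
  by rewrite dc1E dm.2.
have Hh : cder (fun y => h (c y)) x.2 ('d h (c x.2)
    ((- (g 1 0)%:~R / autom g x.2 ^+ 2) *: x.1, autom g x.2 ^- 2)).
  split; first exact: fdiff_comp dc dh.
  by apply: etrans (congr1 (fun F : C -> C => F 1) (diff_comp dc dh)) _; rewrite /= dcE.
have := cder_M (cder_cpow_autom s hg hx) Hh.
rewrite diff_coords // /d -[c x.2]/(modular_act g x).
have -> : \sum_(j < n) ((- (g 1 0)%:~R / autom g x.2 ^+ 2) *: x.1) 0 j *
   an_dz j h (modular_act g x) = - (g 1 0)%:~R / autom g x.2 ^+ 2 *
         (\sum_(j < n) x.1 0 j * an_dz j h (modular_act g x)).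
  by rewrite [RHS]mulr_sumr; apply: eq_bigr => j _; rewrite !mxE mulrA.
set S := \sum_(j < n) _; move: S (an_dtau h _) (h _) (cpow _ s) => S T H0 A.
have E' (f : C -> C) z d1 d2 : d1 = d2 -> cder f z d1 -> cder f z d2 by move=> ->.
by apply: E'; ring.
Qed.

End SlashOperator.

(** * Covariance of the coefficients and of the operators O_i *)

Section SystemCovariance.
Variable R : realType.
Local Notation C := (Cx R).
Variable n : nat.
Local Notation P := ('rV[C]_n * C)%type.
Variables (g : 'M[int]_2) (hg : \det g = 1).
Implicit Types (x p : P) (f h : P -> C) (s : C) (i j : 'I_n).

Lemma an_wp_act m i j x : 0 < cIm x.2 ->
  an_wp m.+1 i j (modular_act g x) = autom g x.2 ^+ m.+1 * an_wp m.+1 i j x.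
Proof.
move=> hx; rewrite /an_wp /wp /= -wpS_mobius //; congr (wpS _ _ _).
by rewrite !mxE -mulrBr mulrC.
Qed.

Lemma Ranalytic_act w (y : Relt R n w) x : 0 < cIm x.2 ->
  Ranalytic y (modular_act g x) = autom g x.2 ^+ w * Ranalytic y x.
Proof.
move=> hx; rewrite /Ranalytic.
elim: y => /= [w0|c|||i j _|i j _|w0 a IHa b IHb|w1 w2 a IHa b IHb].
- by rewrite mulr0.
- by rewrite expr0 mul1r.
- exact: (@Geis_mobius R g 1).
- exact: (@Geis_mobius R g 2).
- exact: an_wp_act.
- exact: an_wp_act.
- by rewrite mulrDr IHa IHb.
- by rewrite exprD IHa IHb mulrACA.
Qed.

(** [A] is the power and [G] is G_2; [H], [T] are [h] and its tau-derivative at the image point, [S]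
    and [W] the sums of its z-derivatives weighted by the z_k and by wp_1 at the original point. The
    terms with [t * c] are those of the law of G_2. *)
Lemma O_slash_identity (t A G H T s S W c J : C) : J != 0 ->
  t * (A * (- s * c / J * H - c / J ^+ 2 * S + J ^- 2 * T)) + G * s * (A * H) +
    G * (A * (J^-1 * S)) - A * (J^-1 * W) =
  A * J^-1 ^+ 2 * (t * T + (J ^+ 2 * G - t * c * J) * s * H +
    (J ^+ 2 * G - t * c * J) * (J^-1 * S) - J * W).
Proof. by move=> ?; field. Qed.

Lemma O_slash s h x i : 0 < cIm x.2 -> differentiable h (modular_act g x) ->
  analytic_O i s (slash g s h) x = slash g (s + 2) (analytic_O i s h) x.
Proof.
move=> hx dh; have J0 := autom_neq0 hg hx.
have G0 := Geis0_mobius hg hx.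
have E2 : cpow (autom g x.2)^-1 (s + 2) = cpow (autom g x.2)^-1 s * (autom g x.2)^-1 ^+ 2.
  by rewrite cpowDn // invr_eq0.
have dzE k : an_dz k (slash g s h) x = cpow (autom g x.2)^-1 s * ((autom g x.2)^-1 * an_dz k h (modular_act g x)).
  by rewrite (dz_slash hg s k hx dh) /slash cpowD1 ?invr_eq0 // mulrA.
pose S := \sum_(k < n) x.1 0 k * an_dz k h (modular_act g x).
pose W := \sum_(k < n | k != i) an_wp 1 k i x * an_dz k h (modular_act g x).
have S1 : \sum_(k < n) x.1 0 k * an_dz k (slash g s h) x =
    cpow (autom g x.2)^-1 s * ((autom g x.2)^-1 * S).
  by rewrite /S !mulr_sumr; apply: eq_bigr => k _; rewrite dzE mulrCA; congr (_ * _); exact: mulrCA.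
have S2 : \sum_(k < n | k != i) an_wp 1 k i x * an_dz k (slash g s h) x =
    cpow (autom g x.2)^-1 s * ((autom g x.2)^-1 * W).
  by rewrite /W !mulr_sumr; apply: eq_bigr => k _; rewrite dzE mulrCA; congr (_ * _); exact: mulrCA.
have S3 : \sum_(k < n) (modular_act g x).1 0 k * an_dz k h (modular_act g x) =
    (autom g x.2)^-1 * S.
  by rewrite /S mulr_sumr; apply: eq_bigr => k _; rewrite !mxE mulrA.
have S4 : \sum_(k < n | k != i) an_wp 1 k i (modular_act g x) * an_dz k h (modular_act g x) =
    autom g x.2 * W.
  by rewrite /W mulr_sumr; apply: eq_bigr => k _; rewrite an_wp_act // expr1 mulrA.
have L := O_slash_identity (twopii R) (cpow (autom g x.2)^-1 s) (Geis 0 x.2) (h (modular_act g x))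
  (an_dtau h (modular_act g x)) s S W (g 1 0)%:~R J0.
have Rr : analytic_O i s h (modular_act g x) =
    twopii R * an_dtau h (modular_act g x) +
    (autom g x.2 ^+ 2 * Geis 0 x.2 - twopii R * (g 1 0)%:~R * autom g x.2) * s *
      h (modular_act g x) +
    (autom g x.2 ^+ 2 * Geis 0 x.2 - twopii R * (g 1 0)%:~R * autom g x.2) *
      ((autom g x.2)^-1 * S) - autom g x.2 * W.
  by rewrite /analytic_O S3 S4 [(modular_act g x).2]/(mobius g x.2) G0.
have Ll : analytic_O i s (slash g s h) x =
    twopii R * an_dtau (slash g s h) x + Geis 0 x.2 * s * slash g s h x +
    Geis 0 x.2 * (cpow (autom g x.2)^-1 s * ((autom g x.2)^-1 * S)) -
    cpow (autom g x.2)^-1 s * ((autom g x.2)^-1 * W).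
  by rewrite /analytic_O S1 S2.
rewrite Ll (dtau_slash hg s hx dh) [slash g s h x]/(_ * _) [RHS]/(_ * _) E2 Rr.
exact: L.
Qed.

End SystemCovariance.

Lemma near_forall (R : realType) (X : normedModType (Cx R)) (I : finType) (p : X)
    (Q : I -> X -> Prop) :
  (forall i, \forall x \near p, Q i x) -> \forall x \near p, forall i, Q i x.
Proof. by move=> H; exact: filter_forall. Qed.

(** * Covariance of the two equations on germs *)

Section GermCovariance.
Variable R : realType.
Local Notation C := (Cx R).
Variable n : nat.
Local Notation P := ('rV[C]_n * C)%type.
Implicit Types (x p : P) (f h : P -> C) (s : C) (i j : 'I_n).

Lemma config_off (x : P) : config_space x <->
  0 < cIm x.2 /\ forall i j, i != j -> off_lattice (x.1 0 i - x.1 0 j) x.2.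
Proof.
split=> -[hx H]; split=> // i j.
  move=> ij [k l]; rewrite /lat /=; have := H i j k l ij; apply: contra_neq => E.
  by rewrite -addrA -E addrC subrK.
move=> k l ij; have := H i j ij (k, l); rewrite /lat /=; apply: contra_neq => ->.
by ring.
Qed.

Lemma an_wp1_differentiable i j x : i != j -> config_space x ->
  differentiable (an_wp 1 i j) x.
Proof.
move=> ij /config_off[hx H].
have d2 := (@fdiff_snd R _ _ x).1; have d1 := (@fdiff_fst R _ _ x).1.
have dc k : differentiable (fun y : P => y.1 0 k) x.
  apply: (@fdiff_comp R P _ C (fun y => y.1) (fun u => u 0 k)) d1 _.
  exact: differentiable_coord.
pose c (y : P) : C * C := (y.1 0 i - y.1 0 j, y.2).
have dF : differentiable c x.
  by apply: differentiable_pair; [exact: fdiffB (dc i) (dc j) | exact: d2].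
apply: (@fdiff_comp R P _ C c (fun q => lattice_zeta q.2 q.1)) dF _.
exact: analytic_at_diff (@lattice_zeta_analytic R (c x) hx (H i j ij)).
Qed.

Lemma an_dz_germ p f h i : same_germ p f h -> same_germ p (an_dz i f) (an_dz i h).
Proof. exact: same_germ_derive. Qed.

Lemma analytic_O_germ p f h s i : same_germ p f h ->
  same_germ p (analytic_O i s f) (analytic_O i s h).
Proof.
move=> fh.
have H1 : \forall x \near p, forall k, an_dz k f x = an_dz k h x.
  by apply: near_forall => k; exact: an_dz_germ.
have H2 : \forall x \near p, an_dtau f x = an_dtau h x.
  exact: same_germ_derive fh.
apply: filterS3 fh H1 H2 => x e0 e1 e2.
have A1 : \sum_(k < n) x.1 0 k * an_dz k f x = \sum_(k < n) x.1 0 k * an_dz k h x.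
  by apply: eq_bigr => k _; rewrite e1.
have A2 : \sum_(k < n | k != i) an_wp 1 k i x * an_dz k f x =
    \sum_(k < n | k != i) an_wp 1 k i x * an_dz k h x.
  by apply: eq_bigr => k _; rewrite e1.
have K (t G u a a' b b' c c' d d' : C) : a = a' -> b = b' -> c = c' -> d = d' ->
    t * a + G * u * b + G * c - d = t * a' + G * u * b' + G * c' - d'.
  by move=> -> -> -> ->.
exact: K e2 e0 A1 A2.
Qed.

Lemma analytic_an_dz p h i : analytic_at h p -> analytic_at (an_dz i h) p.
Proof. exact: analytic_at_D. Qed.

(** On the configuration space the coefficients G_2 and wp_1 are differentiable, so that the
    operators can be iterated. *)
Lemma analytic_at_O p h s i : (\forall x \near p, config_space x) ->
  analytic_at h p -> analytic_at (analytic_O i s h) p.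
Proof.
move=> Hc Hh.
have H1 : \forall x \near p, forall k, differentiable (an_dz k h) x.
  by apply: near_forall => k; exact: analytic_an_dz.
have H2 : \forall x \near p, differentiable (an_dtau h) x.
  exact: analytic_at_D Hh.
have H3 : \forall x \near p, config_space x /\ differentiable h x.
  by apply: filterS2 Hc Hh.
apply: filterS3 H1 H2 H3 => x d1 d2 [cx dh].
have dG : differentiable (fun y : P => Geis 0 y.2) x.
  apply: (@fdiff_comp R P _ C (fun y => y.2) (fun w => Geis 0 w)) (@fdiff_snd R _ _ x).1 _.
  by apply: Geis0_analytic; case: cx.
apply: fdiffB; last first.
  apply: fdiff_sum => k ki; apply: fdiffM (d1 k).
  exact: an_wp1_differentiable.
apply: fdiffD.
  apply: fdiffD; first exact: fdiffMl d2.
  apply: fdiffM dh; exact: fdiffM dG (fdiff_cst _ _).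
apply: fdiffM dG _; apply: fdiff_sum => k _; apply: fdiffM (d1 k).
apply: (@fdiff_comp R P _ C (fun y => y.1) (fun u => u 0 k)) (@fdiff_fst R _ _ x).1 _.
exact: differentiable_coord.
Qed.

Variables (g : 'M[int]_2) (hg : \det g = 1).

Lemma act_continuous p : 0 < cIm p.2 -> modular_act g @ p --> modular_act g p.
Proof. by move=> hp; exact: differentiable_continuous (act_differentiable hg hp). Qed.

Lemma near_act p (Q : P -> Prop) : 0 < cIm p.2 ->
  (\forall y \near modular_act g p, Q y) -> \forall x \near p, Q (modular_act g x).
Proof. by move=> hp HQ; exact: (act_continuous hp). Qed.

Lemma near_Im2 p : 0 < cIm p.2 -> \forall x \near p, 0 < cIm x.2.
Proof.
move=> /near_Im /near_nrmP[e e0 H]; apply/near_nrmP; exists e => // x xe.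
by apply: H; exact: le_lt_trans (nrm_snd (x - p)) xe.
Qed.

Lemma near_slash p h : 0 < cIm p.2 -> analytic_at h (modular_act g p) ->
  \forall x \near p, 0 < cIm x.2 /\ differentiable h (modular_act g x).
Proof. by move=> hp Hh; apply: filterS2 (near_Im2 hp) (near_act hp Hh). Qed.

Lemma slash_analytic s h p : 0 < cIm p.2 -> analytic_at h (modular_act g p) ->
  analytic_at (slash g s h) p.
Proof.
move=> hp Hh; apply: filterS (near_slash hp Hh) => x [hx dh].
exact: slash_differentiable.
Qed.

Lemma same_germ_trans p f1 f2 f3 : same_germ p f1 f2 -> same_germ p f2 f3 -> same_germ p f1 f3.
Proof. by apply: filterS2 => x ->. Qed.

Lemma dz_slash_germ s h p f i : 0 < cIm p.2 -> analytic_at h (modular_act g p) ->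
  same_germ p f (slash g s h) ->
  same_germ p (an_dz i f) (slash g (s + 1) (an_dz i h)).
Proof.
move=> hp Hh /(an_dz_germ i) H; apply: same_germ_trans H _.
apply: filterS (near_slash hp Hh) => x [hx dh].
exact: dz_slash.
Qed.

Lemma O_slash_germ s h p f i : 0 < cIm p.2 -> analytic_at h (modular_act g p) ->
  same_germ p f (slash g s h) ->
  same_germ p (analytic_O i s f) (slash g (s + 2) (analytic_O i s h)).
Proof.
move=> hp Hh /(analytic_O_germ s i) H; apply: same_germ_trans H _.
apply: filterS (near_slash hp Hh) => x [hx dh].
exact: O_slash.
Qed.

(** Analyticity belongs to the induction, because the chain rule of the next stage needs it near the
    image point. *)
Lemma iter_dz_slash s h p f i k : 0 < cIm p.2 -> analytic_at h (modular_act g p) ->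
  same_germ p f (slash g s h) ->
  analytic_at (iter k (an_dz i) h) (modular_act g p) /\
  same_germ p (iter k (an_dz i) f) (slash g (s + k%:R) (iter k (an_dz i) h)).
Proof.
move=> hp Hh Hf; elim: k => [|k [IH1 IH2]] /=; first by rewrite addr0.
split; first exact: analytic_an_dz.
by rewrite -(natr1 k) addrA; exact: dz_slash_germ.
Qed.

(** The parameters of the product are made for this: every factor O_i(alpha) meets a function of
    weight exactly alpha. *)
Lemma Oprod_slash s h p f i m : 0 < cIm p.2 -> analytic_at h (modular_act g p) ->
  (\forall y \near modular_act g p, config_space y) ->
  same_germ p f (slash g s h) ->
  same_germ p (Oprod (analytic_O i) s m f)
    (slash g (s + (2 * m)%:R) (Oprod (analytic_O i) s m h)).
Proof.
move=> hp Hh Hc Hf; rewrite /Oprod.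
(* The [t] innermost factors, those with [k] from [m - t + 1] to [m]; the innermost one has
   parameter [s]. *)
pose T t (u : P -> C) := foldr (fun k => analytic_O i (s + (2 * (m - k))%:R)) u
   (iota (m - t).+1 t).
suff K t : (t <= m)%N -> analytic_at (T t h) (modular_act g p) /\
    same_germ p (T t f) (slash g (s + (2 * t)%:R) (T t h)).
  by have [_] := K m (leqnn m); rewrite /T subnn.
elim: t => [|t IH] tm; first by rewrite /T /= muln0 addr0.
have [IH1 IH2] := IH (ltnW tm).
have E u : T t.+1 u = analytic_O i (s + (2 * t)%:R) (T t u).
  rewrite /T /= subnSK //; congr (analytic_O i (s + (2 * _)%:R) _).
  by rewrite subKn // ltnW.
rewrite !E; split; first exact: analytic_at_O.
have -> : s + (2 * t.+1)%:R = s + (2 * t)%:R + 2 by rewrite mulnS addnC natrD addrA.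
exact: O_slash_germ.
Qed.

Lemma mul_cancel_mid (a b c j : C) : j != 0 ->
  a * (b * c) = b / j * (j * a * c).
Proof. by move=> ?; field. Qed.

Lemma eq1_slash s h p f m i (a : forall w, Relt R n w) : 0 < cIm p.2 ->
  analytic_at h (modular_act g p) -> same_germ p f (slash g s h) ->
  eq1_lhs (an_dz i) (fun _ y u q => Ranalytic y q * u q) m a f p =
  cpow (autom g p.2)^-1 (s + m%:R) *
  eq1_lhs (an_dz i) (fun _ y u q => Ranalytic y q * u q) m a h (modular_act g p).
Proof.
move=> hp Hh Hf; have J0 := autom_neq0 hg hp.
have V0 : (autom g p.2)^-1 != 0 by rewrite invr_eq0.
have E k : iter k (an_dz i) f p = slash g (s + k%:R) (iter k (an_dz i) h) p.
  by have [_ /nbhs_singleton] := iter_dz_slash i k hp Hh Hf.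
rewrite /eq1_lhs !fctE !fct_sumE mulrDr E; congr (_ + _).
rewrite mulr_sumr; apply: eq_big_nat => w /andP[_ wm].
rewrite E (@Ranalytic_act R n g hg _ _ _ hp) /slash.
(* Derivative and coefficient together raise the weight by [m] in every term, so one common power
   comes out. *)
have -> : s + m%:R = s + (m - w)%:R + w%:R by rewrite -addrA -natrD subnK.
rewrite (cpowDn _ w V0) exprVn.
exact: mul_cancel_mid (expf_neq0 w J0).
Qed.

Lemma eq2_slash s h p f m i (b : forall w, Relt R n (2 * w)) : 0 < cIm p.2 ->
  analytic_at h (modular_act g p) ->
  (\forall y \near modular_act g p, config_space y) ->
  same_germ p f (slash g s h) ->
  eq2_lhs (analytic_O i) (fun _ y u q => Ranalytic y q * u q) s m b f p =
  cpow (autom g p.2)^-1 (s + (2 * m)%:R) *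
  eq2_lhs (analytic_O i) (fun _ y u q => Ranalytic y q * u q) s m b h (modular_act g p).
Proof.
move=> hp Hh Hc Hf; have J0 := autom_neq0 hg hp.
have V0 : (autom g p.2)^-1 != 0 by rewrite invr_eq0.
have E k : Oprod (analytic_O i) s k f p =
    slash g (s + (2 * k)%:R) (Oprod (analytic_O i) s k h) p.
  exact: nbhs_singleton (Oprod_slash i k hp Hh Hc Hf).
rewrite /eq2_lhs !fctE !fct_sumE mulrDr E; congr (_ + _).
rewrite mulr_sumr; apply: eq_big_nat => w /andP[_ wm].
rewrite E (@Ranalytic_act R n g hg _ _ _ hp) /slash.
have -> : s + (2 * m)%:R = s + (2 * (m - w))%:R + (2 * w)%:R.
  by rewrite -addrA -natrD -mulnDr subnK.
rewrite (cpowDn _ (2 * w) V0) exprVn.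
exact: mul_cancel_mid (expf_neq0 (2 * w) J0).
Qed.

End GermCovariance.

(** * The inverse of the modular action *)

Section ModularInverse.
Variable R : realType.
Local Notation C := (Cx R).
Variable n : nat.
Local Notation P := ('rV[C]_n * C)%type.
Implicit Types (g : 'M[int]_2) (x p : P).

(** The adjugate, which is the inverse in determinant 1. *)
Definition inv2 g : 'M[int]_2 :=
  \matrix_(i, j) (if i == j then g (rev_ord i) (rev_ord i) else - g i j).

Lemma inv2K : involutive inv2.
Proof.
by move=> g; apply/matrixP => i j; rewrite !mxE rev_ordK eqxx; case: eqP => [->|]; rewrite ?opprK.
Qed.

Lemma inv2E g : [/\ inv2 g 0 0 = g 1 1, inv2 g 0 1 = - g 0 1,
  inv2 g 1 0 = - g 1 0 & inv2 g 1 1 = g 0 0].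
Proof.
have r0 : rev_ord 0 = 1 :> 'I_2 by apply/val_inj.
have r1 : rev_ord 1 = 0 :> 'I_2 by apply/val_inj.
by rewrite !mxE /= r0 r1.
Qed.

Lemma det_inv2 g : \det (inv2 g) = \det g.
Proof.
by rewrite !det_mx2; have [-> -> -> ->] := inv2E g; ring.
Qed.

Lemma act_inv2 g p : \det g = 1 -> autom g p.2 != 0 ->
  modular_act (inv2 g) (modular_act g p) = p.
Proof.
move=> hg J0; have [e00 e01 e10 e11] := inv2E g.
have D : (g 0 0)%:~R * (g 1 1)%:~R - (g 0 1)%:~R * (g 1 0)%:~R = 1 :> C.
  by rewrite -!intrM -rmorphB /= det2.
have JE : autom (inv2 g) (mobius g p.2) = (autom g p.2)^-1.
  apply: (mulIf J0); rewrite mulVf //; apply: etrans D.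
  by rewrite /autom e10 e11 /mobius; move: J0; rewrite /autom => J0; field.
case: p J0 JE => z tau /= J0 JE.
rewrite /modular_act /= -/(mobius g tau) JE invrK scalerA divff // scale1r.
congr (_, _); apply: etrans (etrans (congr1 (fun d => tau * d) D) (mulr1 tau)).
by rewrite e00 e01 /mobius; move: J0; rewrite /autom => J0; field.
Qed.

Lemma config_act g x : \det g = 1 -> config_space x -> config_space (modular_act g x).
Proof.
move=> hg /config_off[hx H]; apply/config_off; split; first exact: mobius_H.
move=> i j ij kl; have := H i j ij (lat_map g kl); apply: contra_neq.
rewrite [(modular_act g x).2]/(mobius g x.2) lat_mobius // !mxE -mulrBr mulrC.
by apply: mulIf; rewrite invr_eq0 autom_neq0.
Qed.

Lemma config_actV g x : \det g = 1 -> config_space (modular_act g x) -> config_space x.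
Proof.
move=> hg H; have J0 : autom g x.2 != 0.
  (* A zero automorphy factor would, by [0^-1 = 0], send tau to 0, which is not in the upper half
     plane. *)
  apply/eqP => J; case: H => + _.
  by rewrite /= J invr0 mulr0 ltxx.
rewrite -(act_inv2 hg J0); apply: config_act H.
by rewrite det_inv2.
Qed.

Lemma act_inv2V g x : \det g = 1 -> config_space x ->
  modular_act g (modular_act (inv2 g) x) = x.
Proof.
move=> hg [hx _]; have hi : \det (inv2 g) = 1 by rewrite det_inv2.
by rewrite -[X in modular_act X]inv2K act_inv2 // autom_neq0.
Qed.

End ModularInverse.

(** * Continuation along paths *)

Section Paths.
Variable R : realType.
Local Notation C := (Cx R).
Variable X : normedModType C.
Implicit Types (c : R -> X) (F G : R -> X -> C).

Lemma path_near c t (Q : X -> Prop) : {within `[0, 1]%classic, continuous c} ->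
  0 <= t <= 1 -> (\forall x \near c t, Q x) ->
  \forall s \near t, 0 <= s <= 1 -> Q (c s).
Proof.
move=> /subspace_continuousP H ht HQ.
have t01 : `[0, 1]%classic t by rewrite /= in_itv.
have := H t t01 Q HQ; rewrite /= /within /= /nbhs /=; apply: filterS => s Hs h01.
by apply: Hs; rewrite /= in_itv.
Qed.

Lemma same_germ_refl (x : X) (f : X -> C) : same_germ x f f.
Proof. by apply: filterE. Qed.

(* Allows the functions at the two ends of a path to be prescribed. *)
Lemma continuation_germ c F G : {within `[0, 1]%classic, continuous c} ->
  continuation c F -> (forall t : R, 0 <= t <= 1 -> same_germ (c t) (F t) (G t)) ->
  continuation c G.
Proof.
move=> cc HF HG t ht; have [aF sF] := HF t ht; split.
  exact: eq_analytic_at (HG t ht) aF.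
apply: filterS2 sF (path_near cc ht (near_near (HG t ht))) => s H1 H2 hs.
apply: filterS3 (HG s hs) (H1 hs) (H2 hs) => x <- -> ->; exact: erefl.
Qed.

End Paths.

(** * Branches of the transformed function *)

Section ModularTransform.
Variable R : realType.
Local Notation C := (Cx R).
Variable n : nat.
Local Notation P := ('rV[C]_n * C)%type.
Variables (g : 'M[int]_2) (hg : \det g = 1).
Implicit Types (x p : P) (f h : P -> C) (s : C) (c : R -> P).

Lemma path_act g' c : \det g' = 1 -> path_in (@config_space R n) c ->
  path_in (@config_space R n) (fun t => modular_act g' (c t)).
Proof.
move=> hg' [cc dc]; split; last by move=> t /dc; exact: config_act.
apply/subspace_continuousP => t ht; move/subspace_continuousP: (cc) => /(_ t ht) H.
apply: cvg_comp H _; apply: act_continuous => //.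
by move: ht; rewrite /= in_itv /= => /dc[].
Qed.

Lemma slash_continuation s c c' F :
  (forall t : R, 0 <= t <= 1 -> 0 < cIm (c t).2 /\ modular_act g (c t) = c' t) ->
  continuation c' F -> continuation c (fun t => slash g s (F t)).
Proof.
move=> Hc HF t ht; have [aF sF] := HF t ht; have [h0 E] := Hc t ht.
rewrite -E in aF; split; first exact: (slash_analytic hg s h0 aF).
apply: filterS sF => u H hu; have {}H := H hu; have [h1 E1] := Hc u hu.
rewrite -E1 in H; apply: filterS (near_act hg h1 H) => x E2.
exact (congr1 (fun y => cpow (autom g x.2)^-1 s * y) E2).
Qed.

(** Points and paths move along the bijection [modular_act g] of the configuration space and its
    inverse, and branches are multiplied by a single-valued analytic factor. *)
Lemma multivalued_modular_transform s phi :
  multivalued_analytic (@config_space R n) phi ->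
  multivalued_analytic (@config_space R n) (modular_transform g s phi).
Proof.
move=> mv; have hi : \det (inv2 g) = 1 by rewrite det_inv2.
have D p h : phi (modular_act g p) h ->
    config_space p /\ analytic_at h (modular_act g p).
  by move=> /(mv_analytic mv)[cp an]; split; [exact: config_actV cp | exact: an].
split.
- have [p [f pf]] := mv_inhabited mv; have [cp _] := mv_analytic mv pf.
  exists (modular_act (inv2 g) p), (slash g s f); exists f; last exact: same_germ_refl.
  by rewrite act_inv2V.
- move=> p f [h ph fh]; have [cp ah] := D _ _ ph; split; first exact: cp.
  apply: eq_analytic_at (slash_analytic hg s cp.1 ah).
  by apply: filterS fh => x ->.
- move=> p f f' [h ph fh] ff'; exists h => //.
  by apply: filterS2 fh ff' => x <- <-.
- move=> p f [h ph fh]; have [cp ah] := D _ _ ph.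
  apply: filterS2 (near_act hg cp.1 (mv_open mv ph)) (near_near fh) => x H1 H2.
  by exists h.
- move=> p f c [h ph fh] pc c0; have [cp ah] := D _ _ ph.
  have [|F [cF F0 HF]] := mv_continue mv ph (path_act hg pc); first by rewrite c0.
  pose G t := if t == 0 then f else slash g s (F t).
  have GE t : same_germ (c t) (slash g s (F t)) (G t).
    rewrite /G; case: eqP => [->|_]; last exact: same_germ_refl.
    by rewrite c0 F0; apply: filterS fh => x ->.
  exists G; split; last 1 first.
  - move=> t ht; exists (F t); first exact: HF.
    by apply: filterS (GE t) => x <-.
  - apply: continuation_germ pc.1 _ (fun t _ => GE t).
    apply: slash_continuation cF => t ht; split=> //.
    by have [] := pc.2 t ht.
  - by rewrite /G eqxx.
- move=> p f p' f' [h ph fh] [h' ph' fh'].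
  have [cp ah] := D _ _ ph; have [cp' ah'] := D _ _ ph'.
  (* The connecting path runs between the image points and is pulled back by the inverse matrix. *)
  have [c' [F [pc' c0 c1 [cF F0 F1]]]] := mv_connected mv ph ph'.
  pose c t := modular_act (inv2 g) (c' t).
  have pc : path_in (@config_space R n) c by exact: path_act.
  have e0 : c 0 = p by rewrite /c c0 act_inv2 // autom_neq0 //; case: cp.
  have e1 : c 1 = p' by rewrite /c c1 act_inv2 // autom_neq0 //; case: cp'.
  pose G t := if t == 0 then f else if t == 1 then f' else slash g s (F t).
  have GE t : same_germ (c t) (slash g s (F t)) (G t).
    rewrite /G; case: eqP => [->|_].
      by rewrite e0 F0; apply: filterS fh => x ->.
    case: eqP => [->|_]; last exact: same_germ_refl.
    by rewrite e1 F1; apply: filterS fh' => x ->.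
  exists c, G; split=> //; split.
  - apply: continuation_germ pc.1 _ (fun t _ => GE t).
    apply: slash_continuation cF => t ht; split; first by have [] := pc.2 t ht.
    by apply: act_inv2V => //; exact: pc'.2.
  - by rewrite /G eqxx.
  - by rewrite /G oner_eq0 eqxx.
Qed.

Lemma modular_transform_solution s m (a : forall w, 'I_n -> Relt R n w)
    (b : forall w, 'I_n -> Relt R n (2 * w)) phi :
  analytic_solution s m a b phi ->
  analytic_solution s m a b (modular_transform g s phi).
Proof.
move=> [mv s1 s2]; split; first exact: multivalued_modular_transform.
- move=> p f i [h ph fh]; have [cp ah] := mv_analytic mv ph.
  rewrite (eq1_slash hg m i (a ^~ i) (config_actV hg cp).1 ah fh) s1 ?mulr0 //.
- move=> p f i [h ph fh]; have [cp ah] := mv_analytic mv ph.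
  have Hc : \forall y \near modular_act g p, config_space y.
    by apply: filterS (mv_open mv ph) => y /(mv_analytic mv)[].
  rewrite (eq2_slash hg m i (b ^~ i) (config_actV hg cp).1 ah Hc fh) s2 ?mulr0 //.
Qed.

End ModularTransform.

Theorem proposition7p1 (R : realType) (V : voa R) (hV : standing_assumptions V)
    (n : nat) (n_gt0 : (0 < n)%N)
    (W : nat -> vmodule V) (w : forall i, W i) (wt : nat -> Cx R)
    (hw : forall i, (i < n)%N -> homogeneous (wt i) (w i))
    (A : nat -> Cx R) (hA : log_coordinates A)
    (m : nat) (m_gt0 : (0 < m)%N)
    (a : forall p, 'I_n -> Relt R n p) (b : forall p, 'I_n -> Relt R n (2 * p))
    (hF : forall (M : nat -> vmodule V)
            (Y : forall i, intertwiner (cpred n M i) (W i) (M i))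
            (F : Cx R -> 'rV[Cx R]_n -> Cx R),
          is_qtrace A Y w F ->
          formal_solution (\sum_(i < n) wt i) m a b F)
    (phi : 'rV[Cx R]_n * Cx R -> ('rV[Cx R]_n * Cx R -> Cx R) -> Prop)
    (hphi : analytic_solution (\sum_(i < n) wt i) m a b phi)
    (g : 'M[int]_2) (hg : \det g = 1) :
  analytic_solution (\sum_(i < n) wt i) m a b
    (modular_transform g (\sum_(i < n) wt i) phi).
Proof. exact: modular_transform_solution. Qed.
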